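(* Let $d \in \mathbb{N}$, $L \in (0,\infty)$, $p \in [4, \infty)$ and $\beta \in (0, 2]$. Then, for all sequences $\{b_n : n \in \mathbb{N}\}$ in $(0,1)$, the family $\{f_{n,b_n}: n \in \mathbb{N}\}$ of Dirichlet kernel density estimators satisfies, for the $L^p$ loss, $$\liminf_{n\to \infty} \frac {R_n(f_{n,b_n}, d, \beta, L)} {r_n(d, \beta, L)} = \infty .$$
   Context: $\mathbb{N} = \{1,2,\ldots\}$, $\mathbb{N}_0 = \{0,1,2,\ldots\}$, $\|\boldsymbol{s}\|_1 = |s_1| + \cdots + |s_d|$, and $\mathcal{S}_d = \{\boldsymbol{s} \in [0,1]^d : \|\boldsymbol{s}\|_1 \leq 1\}$ is the $d$-dimensional simplex, with interior $\mathrm{Int}(\mathcal{S}_d)$. Let $\boldsymbol{1} = (1,\ldots,1) \in \mathbb{R}^d$. Dirichlet density: for $\boldsymbol{u} = (u_1,\ldots,u_d) \in (0,\infty)^d$, $v \in (0,\infty)$ and $\boldsymbol{s} \in \mathcal{S}_d$, $$K_{\boldsymbol{u},v}(\boldsymbol{s}) = \frac{\Gamma(v + u_1 + \cdots + u_d)}{\Gamma (v) \Gamma (u_1) \cdots \Gamma (u_d)} \, (1 - \|\boldsymbol{s}\|_1)^{v - 1} \prod_{i=1}^d s_i^{u_i - 1}.$$ Dirichlet kernel density estimator: given a random sample (i.i.d.) $\boldsymbol{X}_1, \ldots, \boldsymbol{X}_n$ from an unknown density $f$ on $\mathcal{S}_d$ and a bandwidth $b \in (0,\infty)$, for all $\boldsymbol{s}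 \in \mathcal{S}_d$, $$f_{n,b}(\boldsymbol{s}) = \frac{1}{n} \sum_{i=1}^n K_{\boldsymbol{s}/b + \boldsymbol{1}, (1 - \|\boldsymbol{s}\|_1)/b + 1}(\boldsymbol{X}_i).$$ Hölder space: for $\beta, L \in (0,\infty)$, let $m = \sup\{\ell \in \mathbb{N}_0 : \ell < \beta\}$ and let $\Sigma(d,\beta,L)$ be the set of functions $f : \mathcal{S}_d \to \mathbb{R}$ (having the partial derivatives involved on $\mathrm{Int}(\mathcal{S}_d)$) such that for every $\boldsymbol{\gamma} \in \mathbb{N}_0^d$ with $\|\boldsymbol{\gamma}\|_1 = m$ and all $\boldsymbol{s},\boldsymbol{t} \in \mathrm{Int}(\mathcal{S}_d)$, $$|D^{\boldsymbol{\gamma}} f(\boldsymbol{s}) - D^{\boldsymbol{\gamma}} f(\boldsymbol{t})| \leq L\, \|\boldsymbol{s} - \boldsymbol{t}\|_1^{\beta - m},$$ where $D^{\boldsymbol{\gamma}}$ is the partial derivative of multi-index $\boldsymbol{\gamma}$, with $D^{\boldsymbol{0}} f = f$. Risk: for fixed $p \in [1,\infty)$ and an estimator $f_n$ of $f$ (a measurable function of $\boldsymbol{X}_1,\ldots,\boldsymbol{X}_n$), $R_n(f_n, f) = \{\mathsf{E}(\|f_n - f\|_p^p)\}^{1/p}$, where $\|\cdot\|_p$ is the $L^p$ norm on $\mathcal{S}_d$ with respect to Lebesgue measure and the expectation is with respect to the joint law of $\boldsymbol{X}_1,\ldots,\boldsymbol{X}_n$, i.i.d. with density $f$. The risk over the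 class is $R_n(f_n,d,\beta,L) = \sup_f R_n(f_n,f)$, the supremum being over all probability densities $f$ on $\mathcal{S}_d$ belonging to $\Sigma(d,\beta,L)$, and $r_n(d,\beta,L) = \inf_{f_n} R_n(f_n,d,\beta,L)$, the infimum being over all estimators $f_n$ of $f$ based on $\boldsymbol{X}_1,\ldots,\boldsymbol{X}_n$. Both quantities depend on the chosen $p$. *)

(* Defs.v *)
From HB Require Import structures.
From mathcomp Require Import all_boot all_order all_algebra.
From mathcomp Require Import all_classical all_reals all_analysis.
From mathcomp Require Import measurable_realfun.

Set Implicit Arguments.
Unset Strict Implicit.
Unset Printing Implicit Defensive.

Import Order.TTheory GRing.Theory Num.Theory.
Import numFieldNormedType.Exports.

Local Open Scope classical_set_scope.
Local Open Scope ring_scope.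

Lemma pushforward_sigma_finite d1 d2 (T1 : measurableType d1)
    (T2 : measurableType d2) (R : realType) (mu : set T1 -> \bar R)
    (f : T1 -> T2) (g : T2 -> T1) :
  measurable_fun setT g -> cancel f g ->
  sigma_finite setT mu -> sigma_finite setT (pushforward mu f).
Proof.
move=> mg fK [F FT mF]; exists (fun n => g @^-1` F n).
  by rewrite -preimage_bigcup -FT preimage_setT.
move=> n; have [mFn Fn] := mF n; split.
  by rewrite -[X in measurable X]setTI; exact: mg.
rewrite /pushforward -comp_preimage.
by rewrite (_ : g \o f = id) ?preimage_id//; apply/funext => x /=; rewrite fK.
Qed.

(* The canonical sigma-finite structure on mu \x nu found by inference is the one
   for subprobabilities, hence this lemma. *)
Lemma product_sigma_finite d1 d2 (T1 : measurableType d1)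
    (T2 : measurableType d2) (R : realType)
    (mu : {sigma_finite_measure set T1 -> \bar R})
    (nu : {sigma_finite_measure set T2 -> \bar R}) :
  sigma_finite setT (mu \x nu)%E.
Proof.
have /sigma_finiteP[F [TF ndF Foo]] := sigma_finiteT mu.
have /sigma_finiteP[G [TG ndG Goo]] := sigma_finiteT nu.
exists (fun n => F n `*` G n).
  rewrite -setXTT TF TG predeqE => -[x y]; split.
    move=> [/= [n _ Fnx] [k _ Gky]]; exists (maxn n k) => //; split.
    - by move: x Fnx; exact/subsetPset/ndF/leq_maxl.
    - by move: y Gky; exact/subsetPset/ndG/leq_maxr.
  by move=> [n _ []/= ? ?]; split; exists n.
move=> k; have [? ?] := Foo k; have [? ?] := Goo k.
split; first exact: measurableX.
by rewrite product_measure1E// lte_mul_pinfty// ge0_fin_numE.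
Qed.

Lemma pushforward_ex d1 d2 d3 (T1 : measurableType d1) (T2 : measurableType d2)
    (T3 : measurableType d3) (R : realType)
    (mu : {sigma_finite_measure set T1 -> \bar R})
    (nu : {sigma_finite_measure set T2 -> \bar R})
    (f : T1 * T2 -> T3) (g : T3 -> T1 * T2) :
  measurable_fun setT f -> measurable_fun setT g -> cancel f g ->
  exists m : {sigma_finite_measure set T3 -> \bar R},
    pushforward (mu \x nu)%E f = m.
Proof.
move=> mf mg fK.
pose m : {measure set T3 -> \bar R} :=
  measure_function_pushforward__canonical__measure_function_Measure
    (mu \x nu)%E mf.
have msf : sigma_finite setT m.
  exact: (pushforward_sigma_finite mg fK (product_sigma_finite mu nu)).
pose mM := Measure_isSigmaFinite.Build _ _ _ (Measure.sort m) msf.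
pose m' : {sigma_finite_measure set T3 -> \bar R} :=
  HB.pack (Measure.sort m) mM.
by exists m'.
Qed.

Section power_measure.
Context d (T : measurableType d) (R : realType).

Definition tuple_cons n (z : T * n.-tuple T) : n.+1.-tuple T :=
  [tuple of z.1 :: z.2].

Definition tuple_uncons n (t : n.+1.-tuple T) : T * n.-tuple T :=
  (thead t, [tuple of behead t]).

Lemma tuple_consK n : cancel (@tuple_cons n) (@tuple_uncons n).
Proof. by case=> x t; congr pair; apply: val_inj. Qed.

Lemma measurable_tuple_cons n : measurable_fun setT (@tuple_cons n).
Proof. exact: measurable_cons. Qed.

Lemma measurable_tuple_uncons n : measurable_fun setT (@tuple_uncons n).
Proof.
apply: measurable_fun_pair; last exact: measurable_behead.
exact: measurable_tnth.
Qed.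

Fixpoint power_measure (mu : set T -> \bar R) n : set (n.-tuple T) -> \bar R :=
  match n return set (n.-tuple T) -> \bar R with
  | 0 => dirac [tuple]
  | m.+1 => pushforward (mu \x @power_measure mu m)%E (@tuple_cons m)
  end.
Arguments power_measure mu n A : clear implicits.

Variable mu : {sigma_finite_measure set T -> \bar R}.

Lemma power_measure_ex n :
  exists m : {sigma_finite_measure set (n.-tuple T) -> \bar R},
    power_measure mu n = m.
Proof.
elim: n => [|n [m mE]] /=; first by exists (dirac [tuple]).
rewrite mE.
exact: (@pushforward_ex _ _ _ T (n.-tuple T) (n.+1.-tuple T) R mu m _ _
  (@measurable_tuple_cons n) (@measurable_tuple_uncons n) (@tuple_consK n)).
Qed.

Variable n : nat.

Let power_measure0 : power_measure mu n set0 = 0%E.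
Proof. by have [m ->] := power_measure_ex n. Qed.

Let power_measure_ge0 A : (0 <= power_measure mu n A)%E.
Proof. by have [m ->] := power_measure_ex n. Qed.

Let power_measure_sigma_additive : semi_sigma_additive (power_measure mu n).
Proof.
by have [m ->] := power_measure_ex n; exact: measure_semi_sigma_additive.
Qed.

HB.instance Definition _ := isMeasure.Build _ _ _ (power_measure mu n)
  power_measure0 power_measure_ge0 power_measure_sigma_additive.

Let power_measure_sigma_finite : sigma_finite setT (power_measure mu n).
Proof. by have [m ->] := power_measure_ex n; exact: sigma_finiteT. Qed.

HB.instance Definition _ := Measure_isSigmaFinite.Build _ _ _
  (power_measure mu n) power_measure_sigma_finite.

End power_measure.
Arguments power_measure {d T R} mu n A.

Lemma power_measure_box d (T : measurableType d) (R : realType)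
    (mu : {sigma_finite_measure set T -> \bar R}) n (A : 'I_n -> set T) :
  (forall i, measurable (A i)) ->
  power_measure mu n [set t | forall i, A i (tnth t i)] =
  (\prod_(i < n) mu (A i))%E.
Proof.
elim: n A => [|n IH] A mA.
  by rewrite big_ord0 /= diracE mem_set//= => -[].
rewrite big_ord_recl /= -IH// -product_measure1E//; last first.
  rewrite (_ : [set _ | _] = \bigcap_(i in [set: 'I_n])
      (fun t : n.-tuple T => tnth t i) @^-1` A (lift ord0 i)).
    apply: fin_bigcap_measurable => // i _.
    by rewrite -[X in measurable X]setTI; exact: measurable_tnth.
  by apply/seteqP; split => t /= h i; [move=> _|]; exact: h.
rewrite /pushforward; congr (product_measure1 _ _ _).
apply/seteqP; split => -[x t] /=.
  by move=> h; split => [|i]; [exact: (h ord0)|have := h (lift ord0 i); rewrite tnthS].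
by move=> [hx ht] i; case: (unliftP ord0 i) => [j|] ->//; rewrite tnthS; exact: ht.
Qed.

Section power_probability.
Context d (T : measurableType d) (R : realType) (P : probability T R) (n : nat).

Let power_measure_setT : power_measure P n setT = 1%E.
Proof.
have := @power_measure_box _ _ _ P n (fun=> setT) (fun=> measurableT).
rewrite (_ : [set _ | _] = setT); last by apply/seteqP; split => t.
by move=> ->; rewrite big1// => i _; exact: probability_setT.
Qed.

HB.instance Definition _ := Measure_isProbability.Build _ _ _
  (power_measure P n) power_measure_setT.

End power_probability.

Definition measure_row_display : measure_display -> measure_display.
Proof. exact. Qed.

Section measurable_row.
Context {d} {T : measurableType d}.
Variable n : nat.

Let coors : 'I_n -> 'rV[T]_n -> T := fun i v => v ord0 i.

Let row_set0 : g_sigma_preimage coors set0.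
Proof. exact: sigma_algebra0. Qed.

Let row_setC A : g_sigma_preimage coors A -> g_sigma_preimage coors (~` A).
Proof. exact: sigma_algebraC. Qed.

Let row_bigcup (F : _^nat) : (forall i, g_sigma_preimage coors (F i)) ->
  g_sigma_preimage coors (\bigcup_i (F i)).
Proof. exact: sigma_algebra_bigcup. Qed.

(* The product sigma-algebra on row vectors; for T := R it is the Borel
   sigma-algebra of R^n. *)
HB.instance Definition _ := @isMeasurable.Build (measure_row_display d)
  'rV[T]_n (g_sigma_preimage coors) row_set0 row_setC row_bigcup.

End measurable_row.

Lemma measurable_row_coord d (T : measurableType d) n (i : 'I_n) :
  measurable_fun [set: 'rV[T]_n] (fun v : 'rV[T]_n => v ord0 i).
Proof.
move=> _ Y mY; rewrite setTI; apply: sub_sigma_algebra => /=.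
rewrite -bigcup_seq/=; exists i => /=; first by rewrite mem_index_enum.
by exists Y => //; rewrite setTI.
Qed.

Lemma measurable_fun_row d1 d2 (T1 : measurableType d1)
    (T2 : measurableType d2) n (f : T1 -> 'rV[T2]_n) :
  (forall i, measurable_fun setT (fun x => f x ord0 i)) ->
  measurable_fun setT f.
Proof.
move=> mf.
have sub : g_sigma_preimage (fun i x => f x ord0 i) `<=` @measurable _ T1.
  apply: smallest_sub; first exact: sigma_algebra_measurable.
  rewrite -bigcup_seq => A [i _ [B mB <-]].
  exact: mf.
move=> _ A mA; apply: sub.
rewrite (g_sigma_preimage_comp (fun i (v : 'rV[T2]_n) => v ord0 i) f).
by exists A.
Qed.

Section lebesgue_row.
Context (R : realType) (d : nat).

Definition row_of_tuple (t : d.-tuple (measurableTypeR R)) : 'rV[R]_d :=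
  \row_i tnth t i.

Definition tuple_of_row (v : 'rV[R]_d) : d.-tuple (measurableTypeR R) :=
  [tuple v ord0 i | i < d].

Lemma row_of_tupleK : cancel row_of_tuple tuple_of_row.
Proof. by move=> t; apply: eq_from_tnth => i; rewrite tnth_mktuple mxE. Qed.

Lemma measurable_row_of_tuple : measurable_fun setT row_of_tuple.
Proof.
apply: measurable_fun_row => i.
rewrite (_ : (fun _ => _) = (fun t => tnth t i)); last first.
  by apply/funext => t; rewrite mxE.
exact: (@measurable_tnth _ (measurableTypeR R) d i).
Qed.

Lemma measurable_tuple_of_row : measurable_fun setT tuple_of_row.
Proof.
apply/measurable_fun_tnthP => i.
rewrite (_ : _ \o _ = (fun v : 'rV[R]_d => v ord0 i)); last first.
  by apply/funext => v /=; rewrite tnth_mktuple.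
exact: (@measurable_row_coord _ R d i).
Qed.

Definition lebesgue_row : set 'rV[R]_d -> \bar R :=
  pushforward (power_measure lebesgue_measure d) row_of_tuple.

Let nu : {measure set 'rV[R]_d -> \bar R} :=
  measure_function_pushforward__canonical__measure_function_Measure
    (power_measure lebesgue_measure d) measurable_row_of_tuple.

Let lebesgue_row0 : lebesgue_row set0 = 0%E.
Proof. exact: (measure0 nu). Qed.

Let lebesgue_row_ge0 A : (0 <= lebesgue_row A)%E.
Proof. exact: (measure_ge0 nu). Qed.

Let lebesgue_row_sigma_additive : semi_sigma_additive lebesgue_row.
Proof. exact: (@measure_semi_sigma_additive _ _ _ nu). Qed.

HB.instance Definition _ := isMeasure.Build _ _ _ lebesgue_row
  lebesgue_row0 lebesgue_row_ge0 lebesgue_row_sigma_additive.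

Let lebesgue_row_sigma_finite : sigma_finite setT lebesgue_row.
Proof.
apply: (pushforward_sigma_finite measurable_tuple_of_row row_of_tupleK).
exact: sigma_finiteT.
Qed.

HB.instance Definition _ := Measure_isSigmaFinite.Build _ _ _ lebesgue_row
  lebesgue_row_sigma_finite.

End lebesgue_row.

Lemma lebesgue_row_box (R : realType) d (A : 'I_d -> set R) :
  (forall i, measurable (A i)) ->
  lebesgue_row [set v : 'rV[R]_d | forall i, A i (v ord0 i)] =
  (\prod_(i < d) lebesgue_measure (A i))%E.
Proof.
move=> mA; rewrite -(@power_measure_box _ (measurableTypeR R) R lebesgue_measure d A mA).
congr (power_measure _ _ _); apply/seteqP.
by split => t /= h i; have := h i; rewrite mxE.
Qed.

Definition norm1 (R : realType) d (s : 'rV[R]_d) : R :=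
  \sum_(i < d) `|s ord0 i|.

Definition simplex (R : realType) d : set 'rV[R]_d :=
  [set s : 'rV[R]_d | (forall i, 0 <= s ord0 i <= 1) /\ norm1 s <= 1].
Arguments simplex {R} d.

Lemma measurable_norm1 (R : realType) d :
  measurable_fun setT (@norm1 R d).
Proof.
apply: measurable_sum => i; apply: measurableT_comp => //.
exact: measurable_row_coord.
Qed.

Lemma measurable_simplex (R : realType) d : measurable (@simplex R d).
Proof.
rewrite (_ : simplex d = (\bigcap_(i in [set: 'I_d])
    (fun s : 'rV[R]_d => s ord0 i) @^-1` `[0, 1]) `&`
    (@norm1 R d) @^-1` `]-oo, 1]).
  apply: measurableI.
    apply: fin_bigcap_measurable => // i _.
    by rewrite -[X in measurable X]setTI; exact: measurable_row_coord.
  by rewrite -[X in measurable X]setTI; exact: measurable_norm1.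
apply/seteqP; split => s /=; rewrite ?in_itv/=.
  by move=> [h ?]; split => // i _; rewrite /= in_itv /=; exact: h.
by move=> [h ?]; split => // i; have := h i Logic.I; rewrite /= in_itv.
Qed.

Definition holder_order (R : realType) (beta : R) : nat :=
  supremum 0%N [set l : nat | l%:R < beta].

Section multi_index.
Context (R : realType) (d : nat).
Implicit Types (f : 'rV[R]_d -> R) (l : seq 'I_d).

Fixpoint partials l f : 'rV[R]_d -> R :=
  if l is i :: l' then 'D_(delta_mx ord0 i) (partials l' f) else f.

Fixpoint has_partials (U : set 'rV[R]_d) l f : Prop :=
  if l is i :: l' then
    has_partials U l' f /\
    (forall s, U s -> derivable (partials l' f) s (delta_mx ord0 i))
  else True.

(* The multi-index gamma is encoded by the sequence in which the coordinate i
   occurs gamma i times, so that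
   D^gamma = (d/ds_0)^(gamma 0) \o ... \o (d/ds_(d-1))^(gamma (d-1)). *)
Definition multi_index_seq (gamma : 'I_d -> nat) : seq 'I_d :=
  flatten [seq nseq (gamma i) i | i <- enum 'I_d].

Definition multi_derive (gamma : 'I_d -> nat) f :=
  partials (multi_index_seq gamma) f.

Definition multi_derivable (U : set 'rV[R]_d) (gamma : 'I_d -> nat) f :=
  has_partials U (multi_index_seq gamma) f.

End multi_index.

(* Only the values of f on the simplex matter: functions on the simplex are
   represented by total functions on R^d. *)
Definition holder_class (R : realType) d (beta L : R) : set ('rV[R]_d -> R) :=
  [set f | let m := holder_order beta in
    forall gamma : 'I_d -> nat, (\sum_(i < d) gamma i)%N = m ->
      multi_derivable (simplex d)° gamma f /\
      (forall s t : 'rV[R]_d, (simplex d)° s -> (simplex d)° t ->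
        `|multi_derive gamma f s - multi_derive gamma f t| <=
          L * norm1 (s - t) `^ (beta - m%:R))].

Record simplex_density (R : realType) d := SimplexDensity {
  pdf :> 'rV[R]_d -> R ;
  measurable_pdf : measurable_fun (simplex d) pdf ;
  pdf_ge0 : forall s, simplex d s -> 0 <= pdf s ;
  integral_pdf : (\int[@lebesgue_row R d]_(s in simplex d) (pdf s)%:E = 1)%E }.

Section density_law.
Context (R : realType) (d : nat) (f : simplex_density R d).

Definition density_law (A : set 'rV[R]_d) : \bar R :=
  (\int[@lebesgue_row R d]_(s in A `&` simplex d) (f s)%:E)%E.

Let density_law0 : density_law set0 = 0%E.
Proof. by rewrite /density_law set0I integral_set0. Qed.

Let density_law_ge0 A : (0 <= density_law A)%E.
Proof. by apply: integral_ge0 => s [_ Ss]; rewrite lee_fin pdf_ge0. Qed.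

Let density_law_sigma_additive : semi_sigma_additive density_law.
Proof.
move=> /= F mF tF mUF.
have mS := @measurable_simplex R d.
rewrite /density_law setI_bigcupl ge0_integral_bigcup//=; last 4 first.
- by move=> n; exact: measurableI.
- apply/measurable_EFinP; apply: measurable_funS (measurable_pdf f) => //.
  by move=> s [n _ []].
- by move=> s [n _ [_ Ss]]; rewrite lee_fin pdf_ge0.
- by apply: trivIset_setIr.
apply: is_cvg_ereal_nneg_natsum_cond => n _ _.
exact: density_law_ge0.
Qed.

HB.instance Definition _ := isMeasure.Build _ _ _ density_law
  density_law0 density_law_ge0 density_law_sigma_additive.

Let density_law_setT : density_law setT = 1%E.
Proof. by rewrite /density_law setTI integral_pdf. Qed.

HB.instance Definition _ := Measure_isProbability.Build _ _ _
  density_law density_law_setT.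

End density_law.

Definition sample_law (R : realType) d n (f : simplex_density R d) :
    set (n.-tuple 'rV[R]_d) -> \bar R :=
  power_measure (density_law f) n.
Arguments sample_law {R d} n f A.

Definition gamma_fun (R : realType) (x : R) : R :=
  \int[lebesgue_measure]_(t in `]0, +oo[) (t `^ (x - 1) * expR (- t)).

(* At boundary points 0 `^ 0 = 1, so a factor with exponent 0 is constant. *)
Definition dirichlet_pdf (R : realType) d (u : 'rV[R]_d) (v : R)
    (s : 'rV[R]_d) : R :=
  gamma_fun (v + \sum_(i < d) u ord0 i) /
    (gamma_fun v * \prod_(i < d) gamma_fun (u ord0 i)) *
  (1 - norm1 s) `^ (v - 1) * \prod_(i < d) s ord0 i `^ (u ord0 i - 1).

Definition dirichlet_kde (R : realType) d n (b : R) (X : n.-tuple 'rV[R]_d)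
    (s : 'rV[R]_d) : R :=
  n%:R^-1 * \sum_(i < n) dirichlet_pdf (b^-1 *: s + const_mx 1)
    ((1 - norm1 s) / b + 1) (tnth X i).

(* Joint measurability in the sample and the evaluation point makes the loss a
   measurable function of the sample; the values off the simplex play no role,
   as the loss and the law of the sample only see the simplex. *)
Definition is_estimator (R : realType) d n
    (T : n.-tuple 'rV[R]_d -> 'rV[R]_d -> R) : Prop :=
  measurable_fun setT (fun z : n.-tuple 'rV[R]_d * 'rV[R]_d => T z.1 z.2).

Local Open Scope ereal_scope.

Definition simplex_Lp (R : realType) d (p : R) (g : 'rV[R]_d -> R) : \bar R :=
  'N[@lebesgue_row R d]_(p%:E) [(EFin \o g) \_ (simplex d)].

Definition risk (R : realType) d n (p : R)
    (T : n.-tuple 'rV[R]_d -> 'rV[R]_d -> R) (f : simplex_density R d) :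
    \bar R :=
  (\int[sample_law n f]_X simplex_Lp p (T X \- f)%R `^ p) `^ p^-1.

Definition max_risk (R : realType) d n (p beta L : R)
    (T : n.-tuple 'rV[R]_d -> 'rV[R]_d -> R) : \bar R :=
  ereal_sup [set risk p T f |
    f in [set f : simplex_density R d | holder_class beta L f]].

Definition minimax_risk (R : realType) d n (p beta L : R) : \bar R :=
  ereal_inf [set max_risk p beta L T |
    T in [set T : n.-tuple 'rV[R]_d -> 'rV[R]_d -> R | is_estimator T]].

(* Main.v *)
Require Import Defs.
From mathcomp Require Import all_boot all_order all_algebra.
From mathcomp Require Import all_classical all_reals all_analysis.
From mathcomp Require Import measurable_realfun ring lra.

Set Implicit Arguments.
Unset Strict Implicit.
Unset Printing Implicit Defensive.

Import Order.TTheory GRing.Theory Num.Theory.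
Import numFieldNormedType.Exports.
Local Open Scope classical_set_scope.
Local Open Scope ring_scope.


(** Put r = n ^ (- beta / (2 beta + d)). The minimax risk is at most of order r,
    whereas the Dirichlet estimator cannot have a risk of that order: when
    4 <= p its variance near the faces of the simplex costs a logarithmic
    factor which no choice of the bandwidth removes.

    Minimax risk. Averaging the data over the cube Q_h(s) = (1 - h) s +
    h [0, 1/d]^d, which stays inside the simplex up to the boundary, gives a
    bias that is linear in h up to h ^ beta. The combination 2 Q_h - Q_2h
    cancels the linear part, and an exponential moment bound controls the
    stochastic part in every L^p; with n h ^ (2 beta + d) = 1 both are of order
    h ^ beta = r (minimax_risk_le).

    Bias. Take the densities c (1 + A cos (s_i / delta + tau)) for tau = 0 and
    tau = - pi / 2. At a point s, the combination of the two biases with weights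
    cos (s_i / delta) and sin (s_i / delta) is, up to sign and to the factor
    c A, the kernel mean of 1 - cos ((X_i - s_i) / delta). The kernel has
    standard deviation of order sqrt b, so for delta = C sqrt b this is bounded
    below, and the Hoelder condition allows A of order delta ^ beta. Hence the
    risk is at least of order b ^ (beta / 2) (max_risk_bias_lower).

    Variance. Under the uniform density the variance at s is 1 / n times the
    integral of the squared kernel, up to constants. By Chebyshev half of the
    mass of the kernel sits in a box with sides of order sqrt (b (s_i + b)), so
    by Cauchy-Schwarz this integral is at least of order
    prod_i (b (s_i + b)) ^ (- 1/2). The p-th power of the loss is then at least
    n ^ (- p / 2) times the product of b ^ (- p / 4) (s_i + b) ^ (- p / 4), and
    since 1 <= p / 4 its integral carries the factor ln (1 + 1 / (d b)) for each
    coordinate (max_risk_variance_lower).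

    Comparison. If b ^ (beta / 2) is at least a large multiple of r, the bias
    bound suffices. Otherwise b is at most a multiple of h ^ 2, and the variance
    bound is r times a power of ln (1 + 1 / (d b)), which tends to infinity
    (max_risk_rate_lower). *)


(** * Integration on powers and on row vectors *)

Section affine_change.
Context {R : realType}.
Local Notation mu := (@lebesgue_measure R).
Local Open Scope ereal_scope.

Lemma lebesgue_measure_affine (a c : R) (a0 : (0 < a)%R) (A : set R) :
  measurable A ->
  mu A = a%:E * mu ((fun x : R => a * x + c)%R @^-1` A).
Proof.
move=> mA.
have mphi : measurable_fun [set: measurableTypeR R]
    (fun x : R => (a * x + c)%R : measurableTypeR R).
  by apply: measurable_funD => //; exact: measurable_funM.
pose m1 : {measure set (measurableTypeR R) -> \bar R} :=
  measure_function_pushforward__canonical__measure_function_Measure mu mphi.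
pose m2 := mscale (NngNum (ltW a0)) m1.
rewrite -[RHS]/(m2 A); apply: lebesgue_measure_unique => //= _ [[u v]] _ <-.
rewrite /m2 /mscale /= /m1 /pushforward.
have -> : (fun x : R => a * x + c)%R @^-1` [set` `]u, v]%R] =
    [set` `](u - c) / a, (v - c) / a]%R].
  apply/seteqP; split => x /=; rewrite !in_itv/= ltr_pdivrMr// ler_pdivlMr//.
    by rewrite ltrBlDr lerBrDr mulrC.
  by rewrite ltrBlDr lerBrDr mulrC.
rewrite !lebesgue_measure_itv/= !lte_fin ltr_pM2r ?invr_gt0// ltrD2r.
case: ifPn => _; last by rewrite mule0.
rewrite -EFinB -EFinM -mulrBl mulrCA divff ?gt_eqF// mulr1.
by congr (_%:E); ring.
Qed.

Lemma ge0_integral_affine (a c : R) (F : R -> \bar R) : (0 < a)%R ->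
  measurable_fun setT F -> (forall x, 0 <= F x) ->
  \int[mu]_x F x = a%:E * \int[mu]_x F (a * x + c)%R.
Proof.
move=> a0 mF F0.
have mphi : measurable_fun [set: measurableTypeR R]
    (fun x : R => (a * x + c)%R : measurableTypeR R).
  by apply: measurable_funD => //; exact: measurable_funM.
pose m1 : {measure set (measurableTypeR R) -> \bar R} :=
  measure_function_pushforward__canonical__measure_function_Measure mu mphi.
transitivity (\int[mscale (NngNum (ltW a0)) m1]_x F x).
  apply: eq_measure_integral => A mA.
  move=> _; exact: lebesgue_measure_affine.
rewrite ge0_integral_mscale//=; congr (_ * _).
rewrite /m1 (@ge0_integral_pushforward _ _ (measurableTypeR R) (measurableTypeR R))//.
Qed.

End affine_change.

Section power_integral.
Context d (T : measurableType d) (R : realType).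
Local Open Scope ereal_scope.

Lemma integral_power0 (mu : set T -> \bar R) (F : 0.-tuple T -> \bar R) :
  \int[power_measure mu 0]_t F t = F [tuple].
Proof.
rewrite (eq_integral (cst (F [tuple]))) => [|t _]; last by rewrite [t]tuple0.
by rewrite integral_cst//= diracE mem_set// mule1.
Qed.

Lemma ge0_integral_powerS (mu : {sigma_finite_measure set T -> \bar R}) n
    (F : n.+1.-tuple T -> \bar R) :
  measurable_fun setT F -> (forall t, 0 <= F t) ->
  \int[power_measure mu n.+1]_t F t =
  \int[mu]_x \int[power_measure mu n]_t F [tuple of x :: t].
Proof.
move=> mF F0 /=.
have mc := @measurable_tuple_cons d T n.
have E : (mu \x power_measure mu n)%E =
   (product_measure1 mu (power_measure mu n : {sigma_finite_measure set _ -> \bar R})) by [].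
rewrite E ge0_integral_pushforward//= fubini_tonelli1//=.
by apply: measurableT_comp => //; exact: mc.
Qed.

End power_integral.

Section power_product.
Context d (T : measurableType d) (R : realType).
Local Open Scope ereal_scope.

Lemma measurable_tnth_prod n (g : 'I_n -> T -> \bar R) :
  (forall i, measurable_fun setT (g i)) ->
  measurable_fun setT (fun t : n.-tuple T => \prod_(i < n) g i (tnth t i)).
Proof.
move=> mg; elim: (index_enum _) => [|i r IH].
  by under eq_fun do rewrite big_nil; exact: measurable_cst.
under eq_fun do rewrite big_cons; apply: emeasurable_funM => //.
by apply: measurableT_comp => //; exact: measurable_tnth.
Qed.

Lemma ge0_integral_power_prod (mu : {sigma_finite_measure set T -> \bar R}) n
    (g : 'I_n -> T -> \bar R) :
  (forall i, measurable_fun setT (g i)) -> (forall i x, 0 <= g i x) ->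
  \int[power_measure mu n]_t \prod_(i < n) g i (tnth t i) =
  \prod_(i < n) \int[mu]_x g i x.
Proof.
elim: n g => [|n IH] g mg g0.
  by rewrite integral_power0 !big_ord0.
rewrite ge0_integral_powerS; last 2 first.
  - exact: measurable_tnth_prod.
  - by move=> t; apply: prode_ge0 => i _; exact: g0.
rewrite big_ord_recl -IH//.
transitivity (\int[mu]_x (g ord0 x *
    \int[power_measure mu n]_t \prod_(i < n) g (lift ord0 i) (tnth t i))).
  apply: eq_integral => x _.
  rewrite -ge0_integralZl//; last 2 first.
    - exact: (@measurable_tnth_prod n (fun i => g (lift ord0 i))).
    - by move=> t _; apply: prode_ge0 => i _; exact: g0.
  apply: eq_integral => t _; rewrite big_ord_recl; congr (_ * _).
  by apply: eq_bigr => i _; rewrite tnthS.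
by rewrite ge0_integralZr//; apply: integral_ge0 => t _; apply: prode_ge0 => i _; exact: g0.
Qed.

End power_product.

Section row_integral.
Context {R : realType} (d : nat).
Local Open Scope ereal_scope.

Lemma ge0_integral_row (F : 'rV[R]_d -> \bar R) :
  measurable_fun setT F -> (forall v, 0 <= F v) ->
  \int[@lebesgue_row R d]_v F v =
  \int[power_measure lebesgue_measure d]_t F (row_of_tuple t).
Proof.
move=> mF F0; rewrite ge0_integral_pushforward//.
exact: measurable_row_of_tuple.
Qed.

Lemma measurable_row_prod (g : 'I_d -> R -> \bar R) :
  (forall i, measurable_fun setT (g i)) ->
  measurable_fun setT (fun v : 'rV[R]_d => \prod_(i < d) g i (v ord0 i)).
Proof.
move=> mg; rewrite (_ : (fun _ => _) =
  (fun t => \prod_(i < d) g i (tnth t i)) \o @tuple_of_row R d); last first.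
  by apply/funext => v /=; apply: eq_bigr => i _; rewrite tnth_mktuple.
apply: (measurableT_comp (@measurable_tnth_prod _ (measurableTypeR R) R d g mg)).
exact: measurable_tuple_of_row.
Qed.

Lemma ge0_integral_row_prod (g : 'I_d -> R -> \bar R) :
  (forall i, measurable_fun setT (g i)) -> (forall i x, 0 <= g i x) ->
  \int[@lebesgue_row R d]_v \prod_(i < d) g i (v ord0 i) =
  \prod_(i < d) \int[lebesgue_measure]_x g i x.
Proof.
move=> mg g0; rewrite ge0_integral_row; last 2 first.
- exact: measurable_row_prod.
- by move=> v; apply: prode_ge0 => i _; exact: g0.
rewrite -(@ge0_integral_power_prod _ (measurableTypeR R) R lebesgue_measure d g)//.
apply: eq_integral => t _.
by apply: eq_bigr => i _; rewrite mxE.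
Qed.

End row_integral.

(** * The Gamma function and the Dirichlet integral *)

Section powr_aux.
Context {R : realType}.
Implicit Types a x y p : R.

Lemma measurable_fun_powR d (T : measurableType d) (f g : T -> R) :
  measurable_fun setT f -> measurable_fun setT g ->
  measurable_fun setT (fun t => f t `^ g t).
Proof.
move=> mf mg; rewrite /powR; apply: measurable_fun_ifT.
- exact: measurable_fun_eqr.
- apply: (@measurableT_comp _ _ _ _ _ _ (fun b : bool => b%:R : R)) => //.
  exact: measurable_fun_eqr.
- apply: measurableT_comp => //; apply: measurable_funM => //.
  by apply: measurableT_comp => //; exact: measurable_ln.
Qed.

(** y / p <= expR (y / p), raised to the power p. *)
Lemma powR_le_expR p y : 0 <= p -> 0 <= y -> y `^ p <= p `^ p * expR y.
Proof.
rewrite le_eqVlt => /predU1P[<- y0|p0 y0].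
  rewrite !powRr0 mul1r (le_trans _ (expR_ge1Dx _))// lerDl//.
have -> : y = p * (y / p) by rewrite mulrCA divff ?gt_eqF// mulr1.
rewrite powRM ?divr_ge0 ?(ltW p0)// ler_wpM2l ?powR_ge0//.
rewrite [X in expR X]mulrC expRM ge0_ler_powR ?nnegrE ?(ltW p0) ?divr_ge0 ?(ltW p0) ?expR_ge0//.
by rewrite (le_trans _ (expR_ge1Dx _))// lerDr.
Qed.

(** The power extended by 0 to the nonpositive reals, so that the Gamma and Beta
    integrands live on the whole line and the Beta integral is a convolution. *)
Definition ppow a x : R := if 0 < x then x `^ a else 0.

Lemma ppow_ge0 a x : 0 <= ppow a x.
Proof. by rewrite /ppow; case: ifP => // _; exact: powR_ge0. Qed.

Lemma measurable_ppow a : measurable_fun setT (ppow a).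
Proof.
by apply: measurable_fun_ifT => //; exact: measurable_fun_ltr.
Qed.

Lemma ppowM a x y : 0 < x -> ppow a (x * y) = x `^ a * ppow a y.
Proof.
move=> x0; rewrite /ppow pmulr_rgt0//; case: ifPn => [y0|]; last by rewrite mulr0.
by rewrite powRM ?ltW.
Qed.

End powr_aux.

Section gamma_beta.
Context {R : realType}.
Local Notation mu := (@lebesgue_measure R).
Implicit Types a e c : R.

Definition gamma_integrand a x : R := ppow (a - 1) x * expR (- x).

Lemma gamma_integrand_ge0 a x : 0 <= gamma_integrand a x.
Proof. by rewrite mulr_ge0 ?ppow_ge0 ?expR_ge0. Qed.

Lemma measurable_gamma_integrand a : measurable_fun setT (gamma_integrand a).
Proof.
apply: measurable_funM; first exact: measurable_ppow.
exact: measurableT_comp.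
Qed.

Lemma gamma_funE a :
  gamma_fun a = fine (\int[mu]_x (gamma_integrand a x)%:E)%E.
Proof.
rewrite /gamma_fun Rintegral_mkcond /Rintegral; congr fine.
apply: eq_integral => x _; congr (_%:E); rewrite /gamma_integrand /ppow patchE.
by rewrite mem_setE in_itv/= andbT; case: ifP; rewrite ?mul0r.
Qed.

(** Compared with the exponential density of rate 1/2, since x ^ (a - 1) is at
    most a constant times expR (x / 2). Restricting to 1 <= a, which is all that
    the kernel needs, avoids the singularity at 0. *)
Lemma gamma_fun_fin a : 1 <= a ->
  (\int[mu]_x (gamma_integrand a x)%:E < +oo)%E.
Proof.
move=> a1.
pose C := 2 `^ (a - 1) * (a - 1) `^ (a - 1) * 2.
have C0 : 0 <= C by rewrite !mulr_ge0 ?powR_ge0.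
have h : (\int[mu]_x (gamma_integrand a x)%:E <=
    \int[mu]_x (C%:E * (exponential_pdf 2^-1 x)%:E))%E.
  apply: ge0_le_integral => //.
  - by move=> x _; rewrite lee_fin gamma_integrand_ge0.
  - by apply/measurable_EFinP; exact: measurable_gamma_integrand.
  - apply/measurable_EFinP; apply: measurable_funM => //.
    exact: measurable_exponential_pdf.
  - move=> x _; rewrite -EFinM lee_fin /gamma_integrand /ppow; case: ifPn => x0; last first.
      by rewrite mul0r mulr_ge0// exponential_pdf_ge0.
    rewrite exponential_pdfE ?(ltW x0)//.
    have -> : C * (2^-1 * expR (- 2^-1 * x)) = 2 `^ (a - 1) * ((a - 1) `^ (a - 1) * expR (x / 2)) * expR (- x).
      rewrite /C (_ : - x = - (x / 2) + - (x / 2)); last by lra.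
      rewrite (_ : - 2^-1 * x = - (x / 2)); last by lra.
      by rewrite expRD !expRN; field; rewrite gt_eqF ?expR_gt0.
    rewrite ler_wpM2r ?expR_ge0//.
    rewrite [X in X `^ _](_ : x = 2 * (x / 2)); last by lra.
    rewrite powRM ?divr_ge0 ?(ltW x0)// ler_wpM2l ?powR_ge0//.
    by rewrite powR_le_expR ?subr_ge0 ?divr_ge0 ?(ltW x0).
apply: (le_lt_trans h); rewrite ge0_integralZl//.
- by rewrite integral_exponential_pdf ?invr_gt0// mule1 ltry.
- by apply/measurable_EFinP; exact: measurable_exponential_pdf.
- by move=> x _; rewrite lee_fin exponential_pdf_ge0.
Qed.

Lemma integral_gamma a : 1 <= a ->
  (\int[mu]_x (gamma_integrand a x)%:E = (gamma_fun a)%:E)%E.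
Proof.
move=> a1; rewrite gamma_funE fineK// ge0_fin_numE ?gamma_fun_fin//.
by apply: integral_ge0 => x _; rewrite lee_fin gamma_integrand_ge0.
Qed.

Lemma gamma_fun_gt0 a : 1 <= a -> 0 < gamma_fun a.
Proof.
move=> a1; rewrite -lte_fin -integral_gamma//.
apply: (@lt_le_trans _ _ (\int[mu]_(x in `[1%R, 2%R]) (expR (- 2))%:E)%E).
  rewrite integral_cst//= lebesgue_measure_itv/= lte_fin ifT; last by lra.
  by rewrite -EFinB -EFinM lte_fin mulr_gt0 ?expR_gt0//; lra.
rewrite integral_mkcond; apply: ge0_le_integral => //.
- by move=> x _; rewrite patchE; case: ifP => // _; rewrite lee_fin expR_ge0.
- by apply/(measurable_restrictT _ _).1; [exact: measurable_itv|exact: measurable_cst].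
- by apply/measurable_EFinP; exact: measurable_gamma_integrand.
- move=> x _; rewrite patchE; case: ifPn; last first.
    by rewrite lee_fin gamma_integrand_ge0.
  rewrite inE/= in_itv/= => /andP[x1 x2]; rewrite lee_fin /gamma_integrand /ppow.
  rewrite ifT; last by rewrite (lt_le_trans _ x1).
  rewrite -[leLHS]mul1r ler_pM ?expR_ge0//.
    by rewrite -[leLHS](powRr0 x) ler_powR// subr_ge0.
  by rewrite ler_expR lerN2.
Qed.

Lemma beta_integrand_scale a e c x : 0 < c ->
  c * (ppow (a - 1) (c * x + 0) * ppow (e - 1) (c - (c * x + 0))) =
  ppow (a + e - 1) c * (ppow (a - 1) x * ppow (e - 1) (1 - x)).
Proof.
move=> c0; rewrite addr0 (_ : c - c * x = c * (1 - x)); last by ring.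
rewrite !ppowM// [ppow _ c]/ppow c0.
rewrite (_ : a + e - 1 = 1 + ((a - 1) + (e - 1))); last by ring.
rewrite (@powRD _ c 1) ?(gt_eqF c0) ?implybT// powRr1 ?ltW//.
by rewrite (@powRD _ c (a - 1)) ?(gt_eqF c0) ?implybT//; ring.
Qed.

Local Open Scope ereal_scope.

(** The convolution of two powers at c: the Beta integral, up to the scaling in c
    given by beta_conv_scale. *)
Definition beta_conv a e c : \bar R :=
  \int[mu]_x (ppow (a - 1) x * ppow (e - 1) (c - x))%R%:E.

Lemma measurable_beta_integrand a e c :
  measurable_fun setT (fun x : R => (ppow (a - 1) x * ppow (e - 1) (c - x))%R%:E).
Proof.
apply/measurable_EFinP; apply: measurable_funM; first exact: measurable_ppow.
apply: measurableT_comp; first exact: measurable_ppow.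
exact: measurable_funB.
Qed.

Lemma beta_conv_scale a e c : (1 <= a)%R -> (1 <= e)%R ->
  beta_conv a e c = (ppow (a + e - 1) c)%:E * beta_conv a e 1.
Proof.
move=> a1 e1; rewrite /beta_conv; case: (ltP 0%R c) => c0; last first.
  rewrite [ppow _ c]/ppow ltNge c0/= mul0e integral0_eq// => x _.
  rewrite /ppow; case: ifPn; last by rewrite mul0r.
  by move=> x0; rewrite ifF ?mulr0//; apply/negbTE; rewrite -leNgt; lra.
have mB := measurable_beta_integrand a e.
have mA : measurable_fun setT (fun x : R => c * x + 0)%R.
  by apply: measurable_funD => //; exact: measurable_funM.
rewrite (ge0_integral_affine 0%R c0 (mB c)); last first.
  by move=> x; rewrite lee_fin mulr_ge0 ?ppow_ge0.
have mAB := measurableT_comp (mB c) mA.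
transitivity (\int[mu]_x (c%:E * (ppow (a - 1) (c * x + 0) *
    ppow (e - 1) (c - (c * x + 0)))%R%:E)).
  rewrite (ge0_integralZl mu measurableT mAB)//.
  - by move=> x _ /=; rewrite lee_fin mulr_ge0 ?ppow_ge0.
  - by rewrite lee_fin ltW.
transitivity (\int[mu]_x ((ppow (a + e - 1) c)%:E *
    (ppow (a - 1) x * ppow (e - 1) (1 - x))%R%:E)).
  by apply: eq_integral => x _; rewrite -!EFinM beta_integrand_scale.
rewrite (ge0_integralZl mu measurableT (mB 1%R))//.
- by move=> x _; rewrite lee_fin mulr_ge0 ?ppow_ge0.
- by rewrite lee_fin ppow_ge0.
Qed.

(** Tonelli on the quadrant, after the change of variable (x, y) to (x, x + y). *)
Lemma beta_conv_gamma a e : (1 <= a)%R -> (1 <= e)%R ->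
  (gamma_fun a * gamma_fun e)%:E = beta_conv a e 1 * (gamma_fun (a + e))%:E.
Proof.
move=> a1 e1; have ae1 : (1 <= a + e)%R by lra.
rewrite EFinM -(integral_gamma a1) -(integral_gamma e1) -(integral_gamma ae1).
have mg := @measurable_gamma_integrand.
transitivity (\int[mu]_x \int[mu]_y
   (gamma_integrand a x * gamma_integrand e (y - x))%:E).
  rewrite -ge0_integralZr//; last 3 first.
  - by apply/measurable_EFinP; exact: mg.
  - by move=> x _; rewrite lee_fin gamma_integrand_ge0.
  - by apply: integral_ge0 => x _; rewrite lee_fin gamma_integrand_ge0.
  apply: eq_integral => x _; under [RHS]eq_integral do rewrite EFinM.
  rewrite ge0_integralZl//; last 3 first.
  - apply/measurable_EFinP; apply: measurableT_comp; first exact: mg.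
    exact: measurable_funB.
  - by move=> y _; rewrite lee_fin gamma_integrand_ge0.
  - by rewrite lee_fin gamma_integrand_ge0.
  congr (_ * _); rewrite [LHS](@ge0_integral_affine _ 1%R (- x)%R)//; last 2 first.
  - exact/measurable_EFinP.
  - by move=> y; rewrite lee_fin gamma_integrand_ge0.
  by rewrite mul1e; apply: eq_integral => y _; rewrite mul1r.
pose F (z : R * R) := (gamma_integrand a z.1 * gamma_integrand e (z.2 - z.1))%R%:E.
have mF : measurable_fun setT F.
  apply/measurable_EFinP; apply: measurable_funM.
    by apply: measurableT_comp; [exact: mg|exact: measurable_fst].
  apply: measurableT_comp; first exact: mg.
  by apply: measurable_funB; [exact: measurable_snd|exact: measurable_fst].
rewrite (@fubini_tonelli _ _ _ _ _ mu mu F)//; last first.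
  by move=> z; rewrite lee_fin mulr_ge0// gamma_integrand_ge0.
transitivity (\int[mu]_y ((expR (- y))%:E * beta_conv a e y)).
  apply: eq_integral => y _; rewrite /beta_conv.
  rewrite -(ge0_integralZl mu measurableT (measurable_beta_integrand a e y)).
  - apply: eq_integral => x _; rewrite /F/= -EFinM; congr (_%:E).
    rewrite /gamma_integrand (_ : (- y = - x + - (y - x))%R); last by ring.
    by rewrite expRD; ring.
  - by move=> x _; rewrite lee_fin mulr_ge0 ?ppow_ge0.
  - by rewrite lee_fin expR_ge0.
under eq_integral do rewrite beta_conv_scale// muleA.
rewrite ge0_integralZr//; last 3 first.
- apply/measurable_EFinP; apply: measurable_funM; last exact: measurable_ppow.
  exact: measurableT_comp.
- by move=> x _; rewrite lee_fin mulr_ge0 ?ppow_ge0 ?expR_ge0.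
- by apply: integral_ge0 => x _; rewrite lee_fin mulr_ge0 ?ppow_ge0.
rewrite muleC; congr (_ * _); apply: eq_integral => y _.
by rewrite -EFinM /gamma_integrand mulrC.
Qed.

Lemma beta_convE a e c : (1 <= a)%R -> (1 <= e)%R ->
  beta_conv a e c =
  (gamma_fun a * gamma_fun e / gamma_fun (a + e) * ppow (a + e - 1) c)%:E.
Proof.
move=> a1 e1; rewrite beta_conv_scale// mulrC EFinM; congr (_ * _).
have ae1 : (1 <= a + e)%R by lra.
have g0 := gamma_fun_gt0 ae1.
by rewrite EFinM beta_conv_gamma// -muleA -EFinM divff ?gt_eqF// mule1.
Qed.

End gamma_beta.

(* Conversion should not unfold the integral that defines gamma_fun. *)
Opaque gamma_fun.

Section gamma_ratio.
Context {R : realType}.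
Local Notation mu := (@lebesgue_measure R).
Implicit Types a e c : R.

Lemma ppowS a x : 0 < a -> x * ppow (a - 1) x = ppow a x.
Proof.
move=> a0; rewrite /ppow; case: ifPn => [x0|_]; last by rewrite mulr0.
by rewrite mulr_powRB1 ?ltW.
Qed.

Lemma ppow1 a : ppow a 1 = 1 :> R.
Proof. by rewrite /ppow ltr01 powR1. Qed.

(** Because x + (1 - x) = 1. This is what makes gamma_ratio additive. *)
Lemma beta_conv_split a e : 1 <= a -> 1 <= e ->
  (beta_conv a e 1 = beta_conv (a + 1) e 1 + beta_conv a (e + 1) 1)%E.
Proof.
move=> a1 e1; rewrite /beta_conv -ge0_integralD//; last 4 first.
- by move=> x _; rewrite lee_fin mulr_ge0 ?ppow_ge0.
- exact: measurable_beta_integrand.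
- by move=> x _; rewrite lee_fin mulr_ge0 ?ppow_ge0.
- exact: measurable_beta_integrand.
apply: eq_integral => x _; rewrite -EFinD !addrK; congr (_%:E).
by rewrite -(@ppowS a x) -?(@ppowS e (1 - x)); [ring|lra..].
Qed.

(** Equal to a by the functional equation of Gamma. The moments below only need
    that it is proportional to a, which follows from its additivity and so
    without integration by parts. *)
Definition gamma_ratio a : R := gamma_fun (a + 1) / gamma_fun a.

Lemma gamma_ratio_gt0 a : 1 <= a -> 0 < gamma_ratio a.
Proof. by move=> a1; rewrite divr_gt0// gamma_fun_gt0//; lra. Qed.

Lemma gamma_ratioD a e : 1 <= a -> 1 <= e ->
  gamma_ratio (a + e) = gamma_ratio a + gamma_ratio e.
Proof.
move=> a1 e1; have := beta_conv_split a1 e1.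
have a2 : 1 <= a + 1 by lra.
have e2 : 1 <= e + 1 by lra.
rewrite (beta_convE 1 a1 e1) (beta_convE 1 a2 e1) (beta_convE 1 a1 e2).
have EFin_eqD (x y z p q r : R) : p = 1 -> q = 1 -> r = 1 ->
    (x * p)%:E = ((y * q)%:E + (z * r)%:E)%E -> x = y + z.
  by move=> -> -> ->; rewrite !mulr1 => -[].
move=> /(EFin_eqD _ _ _ _ _ _ (ppow1 _) (ppow1 _) (ppow1 _)).
rewrite (_ : a + 1 + e = a + e + 1); last by ring.
rewrite addrA /gamma_ratio.
have : 0 < gamma_fun a by exact: gamma_fun_gt0.
have : 0 < gamma_fun e by exact: gamma_fun_gt0.
have : 0 < gamma_fun (a + e) by apply: gamma_fun_gt0; lra.
have : 0 < gamma_fun (a + e + 1) by apply: gamma_fun_gt0; lra.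
move: (gamma_fun (a + e + 1)) (gamma_fun (a + e)) => x y x0 y0.
move: (gamma_fun e) (gamma_fun a) (gamma_fun (a + 1)) (gamma_fun (e + 1)).
move=> p q r s p0 q0 E.
apply/(mulIf (lt0r_neq0 y0))/(mulIf (lt0r_neq0 p0))/(mulIf (lt0r_neq0 q0)).
apply/(mulIf (invr_neq0 (lt0r_neq0 y0))).
rewrite (_ : x / y * y * p * q / y = x * (q * p / y)); last by field; rewrite gt_eqF.
by rewrite E; field; rewrite !gt_eqF.
Qed.

Lemma gamma_ratioMn a n : 1 <= a ->
  gamma_ratio (n.+1%:R * a) = n.+1%:R * gamma_ratio a.
Proof.
move=> a1; elim: n => [|n IH]; first by rewrite !mul1r.
rewrite -natr1 !mulrDl !mul1r gamma_ratioD ?IH//.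
by rewrite (le_trans a1)// ler_peMl ?ler1n//; lra.
Qed.

(** Cauchy equation: a positive additive function on [1, +oo[ is increasing, and
    comparing n e with multiples of a for n large gives linearity. *)
Lemma gamma_ratio_le a e : 1 <= a -> 1 <= e ->
  gamma_ratio e <= gamma_ratio a / a * e.
Proof.
move=> a1 e1; set g := gamma_ratio a / a.
have g0 : 0 < g by rewrite divr_gt0 ?gamma_ratio_gt0//; lra.
apply/ler_addgt0Pr => eps eps0.
pose n := Num.truncn (g * (1 + 2 * a) / eps).
have nP : g * (1 + 2 * a) / eps < n.+1%:R by exact: truncnS_gt.
pose m := Num.truncn ((n.+1%:R * e + 1) / a).
have mP : (n.+1%:R * e + 1) / a < m.+1%:R by exact: truncnS_gt.
have mQ : m%:R <= (n.+1%:R * e + 1) / a.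
  by rewrite truncn_le// divr_ge0 ?addr_ge0 ?mulr_ge0//; lra.
have a0 : 0 < a by lra.
rewrite ltr_pdivrMr// in mP; rewrite ler_pdivlMr// in mQ.
rewrite ltr_pdivrMr// in nP.
have key : n.+1%:R * gamma_ratio e <= (m.+1%:R + 1) * gamma_ratio a.
  rewrite natr1 -!gamma_ratioMn//.
  rewrite (_ : m.+2%:R * a = n.+1%:R * e + (m.+2%:R * a - n.+1%:R * e)); last by ring.
  have h : 1 <= m.+2%:R * a - n.+1%:R * e.
    by rewrite -natr1 mulrDl mul1r; lra.
  have h' : 1 <= n.+1%:R * e by rewrite (le_trans e1)// ler_peMl ?ler1n//; lra.
  by rewrite (gamma_ratioD h' h) lerDl ltW// gamma_ratio_gt0.
have n0 : 0 < n.+1%:R :> R by [].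
(* The error g (1 + 2 a) / n is below eps by the choice of n. *)
rewrite -(ler_pM2l n0) (le_trans key)//.
have -> : gamma_ratio a = g * a by rewrite /g divfK ?gt_eqF.
rewrite -natr1; nra.
Qed.

Lemma gamma_ratio_linear a e : 1 <= a -> 1 <= e ->
  gamma_ratio a * e = gamma_ratio e * a.
Proof.
move=> a1 e1; apply/le_anti/andP; split.
  have := gamma_ratio_le e1 a1; rewrite mulrAC ler_pdivlMr//; lra.
have := gamma_ratio_le a1 e1; rewrite mulrAC ler_pdivlMr//; lra.
Qed.

End gamma_ratio.

Section dirichlet_tuple.
Context {R : realType}.
Local Notation mu := (@lebesgue_measure R).
Local Open Scope ereal_scope.

Lemma measurable_sum_tnth d :
  measurable_fun setT (fun t : d.-tuple (measurableTypeR R) =>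
    (\sum_(i < d) tnth t i)%R : R).
Proof. by apply: measurable_sum => i; exact: measurable_tnth. Qed.

(** Induction on the dimension with the total mass c free: integrating out one
    coordinate replaces c by c - x, and what remains is a Beta convolution. *)
Lemma dirichlet_integral_tuple d (u : 'I_d -> R) (v c : R) :
  (forall i, 1 <= u i)%R -> (1 <= v)%R ->
  \int[power_measure mu d]_t ((\prod_(i < d) ppow (u i - 1) (tnth t i)) *
     ppow (v - 1) (c - \sum_(i < d) tnth t i))%R%:E =
  (gamma_fun v * \prod_(i < d) gamma_fun (u i) / gamma_fun (v + \sum_(i < d) u i)
    * ppow (v + \sum_(i < d) u i - 1) c)%R%:E.
Proof.
move=> u1 v1; have mF n (w : 'I_n -> R) y : measurable_fun setT
    (fun t : n.-tuple (measurableTypeR R) =>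
    ((\prod_(i < n) ppow (w i - 1) (tnth t i)) *
     ppow (v - 1) (y - \sum_(i < n) tnth t i))%R%:E).
  apply/measurable_EFinP; apply: measurable_funM.
    apply: measurable_prod => i _.
    by apply: measurableT_comp; [exact: measurable_ppow|exact: measurable_tnth].
  apply: measurableT_comp; first exact: measurable_ppow.
  by apply: measurable_funB => //; exact: measurable_sum_tnth.
have F0 n (w : 'I_n -> R) y (t : n.-tuple R) :
    0 <= ((\prod_(i < n) ppow (w i - 1) (tnth t i)) *
     ppow (v - 1) (y - \sum_(i < n) tnth t i))%R%:E.
  by rewrite lee_fin mulr_ge0 ?ppow_ge0// prodr_ge0// => i _; exact: ppow_ge0.
elim: d u u1 c => [|d IH] u u1 c.
  rewrite integral_power0.
  rewrite !big_ord0 subr0 addr0 mul1r mulr1 divff ?mul1r//.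
  by rewrite gt_eqF// gamma_fun_gt0.
rewrite ge0_integral_powerS; [|exact: mF|exact: F0].
pose w : R := (v + \sum_(i < d) u (lift ord0 i))%R.
have w1 : (1 <= w)%R.
  rewrite (le_trans v1)// lerDl sumr_ge0// => i _.
  by rewrite (le_trans _ (u1 _)).
pose C : R := (gamma_fun v * \prod_(i < d) gamma_fun (u (lift ord0 i)) / gamma_fun w)%R.
have C0 : (0 <= C)%R.
  rewrite divr_ge0 ?mulr_ge0 ?(ltW (gamma_fun_gt0 _))//.
  by apply: prodr_ge0 => i _; rewrite ltW ?gamma_fun_gt0.
transitivity (\int[mu]_x (C%:E *
   (ppow (u ord0 - 1) x * ppow (w - 1) (c - x))%R%:E)).
  apply: eq_integral => x _.
  transitivity (\int[power_measure mu d]_t ((ppow (u ord0 - 1) x)%:E *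
     ((\prod_(i < d) ppow (u (lift ord0 i) - 1) (tnth t i)) *
     ppow (v - 1) ((c - x) - \sum_(i < d) tnth t i))%R%:E)).
    apply: eq_integral => t _; rewrite -EFinM; congr (_%:E).
    rewrite !big_ord_recl tnth0 -mulrA; congr (_ * (_ * _))%R.
      by apply: eq_bigr => i _; rewrite tnthS.
    congr ppow; rewrite opprD addrA; congr (_ - _)%R.
    by apply: eq_bigr => i _; rewrite tnthS.
  rewrite (ge0_integralZl _ measurableT (mF _ _ _)) ?lee_fin ?ppow_ge0//.
  rewrite IH// -!EFinM; congr (_%:E); rewrite -/w -/C; ring.
rewrite (ge0_integralZl mu measurableT (measurable_beta_integrand _ _ _))//; last first.
  by move=> x _; rewrite lee_fin mulr_ge0 ?ppow_ge0.
have := @beta_convE _ (u ord0) w c (u1 _) w1; rewrite /beta_conv => ->.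
rewrite -EFinM !big_ord_recl; congr (_%:E).
rewrite (_ : v + (u ord0 + \sum_(i < d) u (lift ord0 i)) = u ord0 + w)%R; last first.
  by rewrite /w; ring.
have : (0 < gamma_fun w)%R by exact: gamma_fun_gt0.
have : (0 < gamma_fun (u ord0 + w))%R.
  by rewrite gamma_fun_gt0// (le_trans w1)// lerDr (le_trans _ (u1 _)).
rewrite /C; move: (gamma_fun w) (gamma_fun (u ord0 + w)) (ppow _ _) => x y z.
move: (\prod_(i < d) _)%R (gamma_fun v) (gamma_fun (u ord0)) => p q r y0 x0.
by field; rewrite !gt_eqF.
Qed.

(** Every section of the hyperplane along the first coordinate is a hyperplane of
    one dimension less, and a point in dimension one. *)
Lemma hyperplane_null d (c : R) : (0 < d)%N ->
  power_measure mu d [set t : d.-tuple (measurableTypeR R) |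
     (\sum_(i < d) tnth t i)%R = c] = 0.
Proof.
have mS n y : measurable [set t : n.-tuple (measurableTypeR R) |
    (\sum_(i < n) tnth t i)%R = y].
  rewrite (_ : [set _ | _] = (fun t : n.-tuple (measurableTypeR R) =>
     (\sum_(i < n) tnth t i)%R) @^-1` [set y])//.
  by rewrite -[X in measurable X]setTI; exact: measurable_sum_tnth.
have E n y : power_measure mu n [set t : n.-tuple (measurableTypeR R) |
     (\sum_(i < n) tnth t i)%R = y] =
   \int[power_measure mu n]_t (\1_[set t : n.-tuple (measurableTypeR R) |
     (\sum_(i < n) tnth t i)%R = y] t)%:E.
  by rewrite integral_indic ?setIT//; exact: mS.
case: d => // d _; elim: d c => [|d IH] c.
  rewrite E ge0_integral_powerS; last 2 first.
  - by apply/measurable_EFinP; apply: measurable_indic; exact: mS.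
  - by move=> t; rewrite lee_fin.
  transitivity (\int[mu]_x (\1_[set c] x)%:E); last first.
    by rewrite integral_indic// setIT; exact: lebesgue_measure_set1.
  apply: eq_integral => x _; rewrite integral_power0.
  congr (_%:E); rewrite !indicE; congr (_%:R); congr nat_of_bool.
  by apply/idP/idP; rewrite !inE/= big_ord1.
rewrite (E d.+2 c) ge0_integral_powerS; last 2 first.
- by apply/measurable_EFinP; apply: measurable_indic; exact: mS.
- by move=> t; rewrite lee_fin.
rewrite integral0_eq// => x _.
transitivity (power_measure mu d.+1 [set t : d.+1.-tuple (measurableTypeR R) |
     (\sum_(i < d.+1) tnth t i)%R = c - x]%R); last exact: IH.
rewrite E; apply: eq_integral => t _; congr (_%:E); rewrite !indicE.
congr (_%:R); congr nat_of_bool.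
have S0 : (\sum_(i < d.+2) tnth [tuple of x :: t] i = x + \sum_(i < d.+1) tnth t i)%R.
  by rewrite big_ord_recl tnth0; congr (_ + _)%R; apply: eq_bigr => i _; rewrite tnthS.
apply/idP/idP; rewrite !inE/= S0.
  by move=> <-; rewrite addrAC subrr add0r.
by move=> ->; rewrite addrC subrK.
Qed.

End dirichlet_tuple.

(** * Densities, bounded functions and the simplex *)

Section density_integral.
Context d (T : measurableType d) (R : realType).
Variables (mu nu : {measure set T -> \bar R}) (D : set T) (f : T -> R).
Hypotheses (mD : measurable D) (mf : measurable_fun D f).
Hypothesis f0 : forall x, D x -> 0 <= f x.
Local Open Scope ereal_scope.
Hypothesis nuE : forall A, measurable A ->
  nu A = \int[mu]_(x in A `&` D) (f x)%:E.

Import HBNNSimple.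

(** The chain rule for a density: true on simple functions, and then by monotone
    convergence. *)
Lemma ge0_integral_density (h : T -> \bar R) :
  measurable_fun setT h -> (forall x, 0 <= h x) ->
  \int[nu]_x h x = \int[mu]_(x in D) (h x * (f x)%:E).
Proof.
move=> mh h0; pose h_ := nnsfun_approx measurableT mh.
have cvgh x : EFin \o h_ ^~ x @ \oo --> h x.
  by apply: cvg_nnsfun_approx => // *; exact: h0.
have mf' : measurable_fun D (EFin \o f) by exact/measurable_EFinP.
have mhf n : measurable_fun D (fun x => (h_ n x)%:E * (f x)%:E).
  apply: emeasurable_funM => //.
  by apply/measurable_EFinP/measurable_funTS.
have step n : \int[nu]_x (h_ n x)%:E = \int[mu]_(x in D) ((h_ n x)%:E * (f x)%:E).
  under [LHS]eq_integral do rewrite fimfunE -fsumEFin//.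
  rewrite ge0_integral_fsum//; last 2 first.
  - by move=> r; exact/measurable_EFinP/measurable_funM.
  - by move=> r x _; rewrite nnfun_muleindic_ge0.
  under [RHS]eq_integral.
    move=> x _; rewrite fimfunE -fsumEFin// ge0_mule_fsuml; last first.
      by move=> r; rewrite nnfun_muleindic_ge0.
    over.
  rewrite ge0_integral_fsum//; last 2 first.
  - move=> r; apply: emeasurable_funM => //.
    by apply/measurable_funTS/measurable_EFinP/measurable_funM.
  - by move=> r x Dx; rewrite mule_ge0 ?nnfun_muleindic_ge0 ?lee_fin ?f0.
  apply: eq_fsbigr => r rh; rewrite integralZl_indic_nnsfun// integral_indic// setIT.
  have mr : measurable (h_ n @^-1` [set r]) by exact: measurable_funPTI.
  have r0 : (0 <= r)%R.
    by move: rh => /set_mem [x _ <-]; exact: fun_ge0.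
  rewrite nuE// integral_mkcondl.
  under [X in _ = X]eq_integral do rewrite EFinM -muleA.
  rewrite ge0_integralZl//.
  - congr (_ * _); apply: eq_integral => x _.
    rewrite patchE indicE; case: ifPn => xr; first by rewrite mul1e.
    by rewrite mul0e.
  - apply: emeasurable_funM => //.
    by apply/measurable_funTS/measurable_EFinP; exact: measurable_indic.
  - by move=> x Dx; rewrite mule_ge0 ?lee_fin ?f0.
transitivity (limn (fun n => \int[nu]_x (h_ n x)%:E)).
  rewrite -monotone_convergence//.
  - by apply: eq_integral => x _; apply/esym/cvg_lim => //; exact: cvgh.
  - by move=> n; exact/measurable_EFinP/measurable_funP.
  - by move=> n x _; rewrite lee_fin.
  - by move=> x _ m n mn; rewrite lee_fin; exact/lefP/nd_nnsfun_approx.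
under eq_fun do rewrite step.
rewrite -monotone_convergence//.
- apply: eq_integral => x /set_mem Dx; apply/cvg_lim => //.
  apply: cvgeZr => //; exact: cvgh.
- by move=> n x Dx; rewrite mule_ge0 ?lee_fin ?f0.
- move=> x Dx m n mn; apply: lee_wpmul2r; first by rewrite lee_fin f0.
  by rewrite lee_fin; exact/lefP/nd_nnsfun_approx.
Qed.

Lemma integral_density (g : T -> R) :
  measurable_fun setT g -> mu.-integrable D (fun x => (g x * f x)%:E) ->
  \int[nu]_x (g x)%:E = \int[mu]_(x in D) (g x * f x)%:E.
Proof.
move=> mg ig; have mG : measurable_fun setT (EFin \o g) by exact/measurable_EFinP.
rewrite integralE ge0_integral_density; last 2 first.
- exact: measurable_funepos.
- by move=> x; exact: funepos_ge0.
rewrite ge0_integral_density; last 2 first.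
- exact: measurable_funeneg.
- by move=> x; exact: funeneg_ge0.
rewrite [RHS]integralE; congr (_ - _); apply: eq_integral => x xD.
  have Dx : D x by rewrite inE in xD.
  by rewrite !funeposE EFinM maxe_pMl ?lee_fin ?f0// mul0e.
have Dx : D x by rewrite inE in xD.
by rewrite !funenegE EFinM -mulNe maxe_pMl ?lee_fin ?f0// mul0e.
Qed.

End density_integral.

Section bounded_measurable.
Context d (T : measurableType d) (R : realType).
Implicit Types (D : set T) (f g : T -> R).

(** Stable under the ring operations and integrable for every finite measure, so
    that the expansions below need no further integrability argument. *)
Definition bmfun D g : Prop :=
  measurable_fun D g /\ exists M, forall x, D x -> `|g x| <= M.

Lemma bm_cst D (c : R) : bmfun D (fun=> c).
Proof. by split; [exact: measurable_cst|exists `|c|]. Qed.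

Lemma bmD D f g : bmfun D f -> bmfun D g -> bmfun D (fun x => f x + g x).
Proof.
move=> [mf [M fM]] [mg [N gN]]; split; first exact: measurable_funD.
exists (M + N) => x Dx.
by rewrite (le_trans (ler_normD _ _))// lerD ?fM ?gN.
Qed.

Lemma bmM D f g : bmfun D f -> bmfun D g -> bmfun D (fun x => f x * g x).
Proof.
move=> [mf [M fM]] [mg [N gN]]; split; first exact: measurable_funM.
exists (M * N) => x Dx.
by rewrite normrM ler_pM// ?fM ?gN.
Qed.

Lemma bmN D g : bmfun D g -> bmfun D (fun x => - g x).
Proof.
move=> [mg [N gN]]; split; first exact: measurable_funN.
by exists N => x Dx; rewrite normrN gN.
Qed.

Lemma bmB D f g : bmfun D f -> bmfun D g -> bmfun D (fun x => f x - g x).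
Proof. by move=> bf bg; apply: bmD => //; exact: bmN. Qed.

Lemma bmX D g n : bmfun D g -> bmfun D (fun x => g x ^+ n).
Proof.
move=> bg; elim: n => [|n IH].
  by under eq_fun do rewrite expr0; exact: bm_cst.
by under eq_fun do rewrite exprS; exact: bmM.
Qed.

Lemma bm_sum D (I : Type) (r : seq I) (g : I -> T -> R) :
  (forall i, bmfun D (g i)) -> bmfun D (fun x => \sum_(i <- r) g i x).
Proof.
move=> bg; elim: r => [|i r IH].
  by under eq_fun do rewrite big_nil; exact: bm_cst.
by under eq_fun do rewrite big_cons; exact: bmD.
Qed.

Lemma bm_integrable (mu : {measure set T -> \bar R}) D g :
  measurable D -> (mu D < +oo)%E -> bmfun D g ->
  mu.-integrable D (EFin \o g).
Proof.
move=> mD Doo [mg [M gM]]; apply: measurable_bounded_integrable => //.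
exists M; split; first by rewrite num_real.
by move=> N MN x Dx; exact: le_trans (gM _ Dx) (ltW MN).
Qed.

Lemma bm_restrict D g : measurable D -> bmfun D g -> bmfun setT (g \_ D).
Proof.
move=> mD [mg [M gM]]; split; first exact/(measurable_restrictT _ _).1.
exists `|M| => x _; rewrite patchE; case: ifPn => [/set_mem Dx|]; last by rewrite normr0.
by rewrite (le_trans (gM _ Dx))// ler_norm.
Qed.

End bounded_measurable.

Section simplex_facts.
Context {R : realType} {d : nat}.
Implicit Types s t : 'rV[R]_d.
Local Notation leb := (@lebesgue_row R d).

Lemma simplex_ge0 s i : simplex d s -> 0 <= s ord0 i.
Proof. by case=> /(_ i)/andP[]. Qed.

Lemma simplex_le1 s i : simplex d s -> s ord0 i <= 1.
Proof. by case=> /(_ i)/andP[]. Qed.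

Lemma norm1_ge0E s : (forall i, 0 <= s ord0 i) -> norm1 s = \sum_i s ord0 i.
Proof. by move=> s0; apply: eq_bigr => i _; rewrite ger0_norm. Qed.

Lemma simplexP s :
  simplex d s <-> (forall i, 0 <= s ord0 i) /\ \sum_i s ord0 i <= 1.
Proof.
split=> [sS|[s0 s1]].
  split=> [i|]; first exact: simplex_ge0.
  by rewrite -norm1_ge0E => [|i]; [case: sS|exact: simplex_ge0].
split; last by rewrite norm1_ge0E.
move=> i; rewrite s0/= (le_trans _ s1)// (bigD1 i)//= lerDl sumr_ge0//.
Qed.

Lemma norm1_simplex s : simplex d s -> norm1 s = \sum_i s ord0 i.
Proof. by move=> sS; apply: norm1_ge0E => i; exact: simplex_ge0. Qed.

(** On the open simplex the estimators below are compared with f through its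
    derivatives; the rest of the simplex is a null set. *)
Definition osimplex : set 'rV[R]_d :=
  [set s | (forall i, 0 < s ord0 i) /\ \sum_i s ord0 i < 1].

Lemma osimplex_sub : osimplex `<=` simplex d.
Proof. by move=> s [s0 s1]; apply/simplexP; split=> [i|]; rewrite ltW. Qed.

Lemma osimplex_int : osimplex `<=` (simplex d)°.
Proof.
move=> s [s0 s1]; apply: (@filterS _ (nbhs s) _ osimplex).
  exact: osimplex_sub.
have c i : (fun t : 'rV[R]_d => t ord0 i) t @[t --> s] --> s ord0 i.
  exact: coord_continuous.
near=> t; split; near: t.
  by apply: filter_forall => i; exact: (cvgr_gt _ (c i)).
have : (fun t : 'rV[R]_d => \sum_i t ord0 i) t @[t --> s] --> \sum_i s ord0 i.
  elim: (index_enum _) => [|i r IH].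
    rewrite big_nil; under eq_fun do rewrite big_nil. by apply: cvg_cst; exact: nbhs_filter.
  rewrite big_cons; under eq_fun do rewrite big_cons; exact: (cvgD (c i) IH).
by move=> h; exact: (cvgr_lt _ h).
Unshelve. all: by end_near. Qed.

Lemma measurable_sum_row :
  measurable_fun setT (fun s : 'rV[R]_d => \sum_i s ord0 i).
Proof. by apply: measurable_sum => i; exact: measurable_row_coord. Qed.

Lemma measurable_osimplex : measurable osimplex.
Proof.
rewrite (_ : osimplex = (\bigcap_(i in [set: 'I_d])
    (fun s : 'rV[R]_d => s ord0 i) @^-1` `]0, +oo[) `&`
    (fun s : 'rV[R]_d => \sum_i s ord0 i) @^-1` `]-oo, 1[).
  apply: measurableI.
    apply: fin_bigcap_measurable => // i _.
    by rewrite -[X in measurable X]setTI; exact: measurable_row_coord.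
  by rewrite -[X in measurable X]setTI; exact: measurable_sum_row.
apply/seteqP; split => s /=; rewrite ?in_itv/=.
  by move=> [h ?]; split => // i _; rewrite /= in_itv /= h.
by move=> [h ?]; split => // i; have := h i Logic.I; rewrite /= in_itv/= andbT.
Qed.

Lemma simplex_boundary_null : (0 < d)%N -> leb (simplex d `\` osimplex) = 0%E.
Proof.
move=> d0.
pose H i : set 'rV[R]_d := [set s | s ord0 i = 0].
pose S1 : set 'rV[R]_d := [set s | \sum_i s ord0 i = 1].
have mH i : measurable (H i).
  rewrite (_ : H i = (fun s : 'rV[R]_d => s ord0 i) @^-1` [set 0])//.
  by rewrite -[X in measurable X]setTI; exact: measurable_row_coord.
have mS1 : measurable S1.
  rewrite (_ : S1 = (fun s : 'rV[R]_d => \sum_i s ord0 i) @^-1` [set 1])//.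
  by rewrite -[X in measurable X]setTI; exact: measurable_sum_row.
have H0 i : leb (H i) = 0%E.
  pose A j : set R := if j == i then [set 0] else setT.
  rewrite (_ : H i = [set v | forall j, A j (v ord0 j)]); last first.
    apply/seteqP; split => v /= h.
      by move=> j; rewrite /A; case: eqP => // ->.
    by have := h i; rewrite /A eqxx.
  rewrite lebesgue_row_box; last first.
    by move=> j; rewrite /A; case: ifP => // _; exact: measurable_set1.
  by rewrite (bigD1 i)//= /A eqxx lebesgue_measure_set1 mul0e.
have S10 : leb S1 = 0%E.
  rewrite -(@hyperplane_null R d 1 d0); congr (power_measure _ _ _).
  have E (t : d.-tuple R) :
      \sum_i (row_of_tuple t) ord0 i = \sum_(i < d) tnth t i.
    by apply: eq_bigr => i _; rewrite mxE.
  by apply/seteqP; split => t /=; rewrite /S1 /= E.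
have sub : simplex d `\` osimplex `<=` S1 `|` \big[setU/set0]_(i < d) H i.
  move=> s [/simplexP[s0 s1]] /not_andP[/existsNP[i /negP]|/negP].
    rewrite -leNgt => si; right; rewrite (bigD1 i)//=; left.
    by apply/le_anti; rewrite si s0.
  by rewrite -leNgt => s1'; left; apply/le_anti; rewrite s1.
have [mB B0] : measurable (\big[setU/set0]_(i < d) H i) /\
    leb (\big[setU/set0]_(i < d) H i) = 0%E.
  apply: (big_ind (fun B : set 'rV[R]_d => measurable B /\ leb B = 0%E)).
  - by split; [exact: measurable0|exact: measure0].
  - move=> A B [mA A0] [mB B0]; split; first exact: measurableU.
    exact: null_set_setU.
  - by move=> i _; split.
apply: (subset_measure0 _ _ sub).
- by apply: measurableD; [exact: measurable_simplex|exact: measurable_osimplex].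
- exact: measurableU.
exact: null_set_setU.
Qed.

End simplex_facts.

Section simplex_integral.
Context {R : realType} {d : nat}.
Hypothesis d_gt0 : (0 < d)%N.
Local Notation leb := (@lebesgue_row R d).
Local Notation S := (@simplex R d).
Local Notation O := (@osimplex R d).
Local Open Scope ereal_scope.

Lemma ge0_integral_osimplex (F : 'rV[R]_d -> \bar R) :
  measurable_fun S F -> (forall x, S x -> 0 <= F x) ->
  \int[leb]_(x in S) F x = \int[leb]_(x in O) F x.
Proof.
move=> mF F0; have mS := @measurable_simplex R d.
have mO := @measurable_osimplex R d.
have mSO : measurable (S `\` O) by exact: measurableD.
rewrite (ge0_negligible_integral mSO mS mF F0); last exact: simplex_boundary_null.
by rewrite setDD setIidr//; exact: osimplex_sub.
Qed.

Lemma lebesgue_row_cube (a b : 'I_d -> R) : (forall i, a i <= b i)%R ->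
  leb [set v | forall i, (a i <= v ord0 i <= b i)%R] =
  (\prod_(i < d) (b i - a i))%R%:E.
Proof.
move=> ab; transitivity (leb [set v | forall i, [set` `[a i, b i]%R] (v ord0 i)]).
  congr (leb _); apply/seteqP; split => v /= h i; have := h i;
    by rewrite /= in_itv.
rewrite (@lebesgue_row_box R d (fun i => [set` `[a i, b i]%R]))// -prodEFin; apply: eq_bigr => i _.
rewrite lebesgue_measure_itv/= lte_fin; case: ltP => h; first by rewrite EFinB.
by congr (_%:E); have /eqP := le_anti (introT andP (conj (ab i) h)); lra.
Qed.

Lemma measurable_cube (a b : 'I_d -> R) :
  measurable [set v : 'rV[R]_d | forall i, (a i <= v ord0 i <= b i)%R].
Proof.
rewrite (_ : [set _ | _] = \bigcap_(i in [set: 'I_d])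
    (fun s : 'rV[R]_d => s ord0 i) @^-1` `[a i, b i]).
  apply: fin_bigcap_measurable => // i _.
  by rewrite -[X in measurable X]setTI; exact: measurable_row_coord.
apply/seteqP; split => s /= h i; first by move=> _; rewrite /= in_itv/= h.
by have := h i Logic.I; rewrite /= in_itv.
Qed.

Lemma simplex_volume_le1 : leb S <= 1.
Proof.
have := @lebesgue_row_cube (fun=> 0%R) (fun=> 1%R) (fun=> ler01).
rewrite big1 => [|i _]; last by rewrite subr0.
move=> <-; apply: le_measure; rewrite ?inE.
- exact: measurable_simplex.
- exact: measurable_cube.
- by move=> s [].
Qed.

Lemma simplex_volume_lty : leb S < +oo.
Proof. by rewrite (le_lt_trans simplex_volume_le1)// ltry. Qed.

Lemma cube_sub_simplex (a b : R) : (0 <= a -> b <= d%:R^-1 ->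
  [set v : 'rV[R]_d | forall i, (a <= v ord0 i <= b)%R] `<=` S)%R.
Proof.
move=> a0 bd v /= h; apply/simplexP; split=> [i|].
  by have /andP[+ _] := h i; exact: le_trans.
apply: (@le_trans _ _ (\sum_(i < d) d%:R^-1)%R).
  by apply: ler_sum => i _; have /andP[_ +] := h i => /le_trans; apply.
by rewrite sumr_const card_ord -[leLHS]mulr_natr mulVf// pnatr_eq0 -lt0n.
Qed.

Lemma simplex_volume_gt0 : 0 < leb S.
Proof.
have d0 : (0 < d%:R^-1 :> R)%R by rewrite invr_gt0 ltr0n.
apply: (@lt_le_trans _ _ (leb [set v | forall i, (0 <= v ord0 i <= d%:R^-1)%R])).
  rewrite (@lebesgue_row_cube (fun=> 0%R) (fun=> d%:R^-1)%R) => [|i]; last exact: ltW.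
  by rewrite lte_fin prodr_gt0// => i _; rewrite subr0.
apply: le_measure; rewrite ?inE.
- exact: measurable_cube.
- exact: measurable_simplex.
- exact: cube_sub_simplex.
Qed.

Lemma bm_integrable_simplex (g : 'rV[R]_d -> R) : bmfun S g ->
  leb.-integrable S (EFin \o g).
Proof.
move=> bg; apply: bm_integrable => //; first exact: measurable_simplex.
exact: simplex_volume_lty.
Qed.

Lemma bm_coord (i : 'I_d) : bmfun S (fun s : 'rV[R]_d => s ord0 i).
Proof.
split; first by apply: measurable_funTS; exact: measurable_row_coord.
by exists 1%R => s sS; rewrite ger0_norm ?simplex_ge0 ?simplex_le1.
Qed.

End simplex_integral.

(** * Moments of the Dirichlet density *)

Section dirichlet_density.
Context {R : realType} {d : nat}.
Hypothesis d_gt0 : (0 < d)%N.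
Local Notation leb := (@lebesgue_row R d).
Local Notation S := (@simplex R d).
Local Notation O := (@osimplex R d).
Implicit Types (u x : 'rV[R]_d) (v : R).

Definition dirichlet_coef u v : R :=
  gamma_fun (v + \sum_(i < d) u ord0 i) /
    (gamma_fun v * \prod_(i < d) gamma_fun (u ord0 i)).

Definition dirichlet_param u v := (forall i, 1 <= u ord0 i) /\ 1 <= v.

Lemma dirichlet_total_ge1 u v : dirichlet_param u v ->
  1 <= v + \sum_(i < d) u ord0 i.
Proof.
move=> [u1 v1]; rewrite (le_trans v1)// lerDl sumr_ge0// => i _.
by rewrite (le_trans _ (u1 _)).
Qed.

Lemma dirichlet_coef_gt0 u v : dirichlet_param u v -> 0 < dirichlet_coef u v.
Proof.
move=> uv; rewrite divr_gt0 ?gamma_fun_gt0 ?dirichlet_total_ge1//.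
rewrite mulr_gt0 ?prodr_gt0 ?gamma_fun_gt0 ?(proj2 uv)// => i _.
by rewrite gamma_fun_gt0// (proj1 uv).
Qed.

Lemma measurable_dirichlet_pdf u v : measurable_fun setT (dirichlet_pdf u v).
Proof.
rewrite /dirichlet_pdf; apply: measurable_funM.
  apply: measurable_funM => //.
  apply: (measurableT_comp (measurable_powR _)).
  by apply: measurable_funB => //; exact: measurable_norm1.
apply: measurable_prod => i _.
by apply: (measurableT_comp (measurable_powR _)); exact: measurable_row_coord.
Qed.

Lemma powR01 (a y : R) : 0 <= a -> 0 <= y <= 1 -> 0 <= y `^ a <= 1.
Proof.
move=> a0 /andP[y0 y1]; rewrite powR_ge0/= (_ : 1 = 1 `^ a); last by rewrite powR1.
by rewrite ge0_ler_powR ?nnegrE.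
Qed.

Lemma dirichlet_pdf_bounds u v x : dirichlet_param u v -> S x ->
  0 <= dirichlet_pdf u v x <= dirichlet_coef u v.
Proof.
move=> uv Sx; have c0 := dirichlet_coef_gt0 uv; have [u1 v1] := uv.
rewrite /dirichlet_pdf -/(dirichlet_coef u v).
have /andP[n0 n1] : 0 <= (1 - norm1 x) `^ (v - 1) <= 1.
  apply: powR01; first by rewrite subr_ge0.
  rewrite subr_ge0 (proj2 Sx)/= gerBl sumr_ge0// => i _; exact: normr_ge0.
have /andP[p0 p1] : 0 <= \prod_(i < d) x ord0 i `^ (u ord0 i - 1) <= 1.
  rewrite prodr_ge0/=; last by move=> i _; exact: powR_ge0.
  apply: prodr_ile1 => i _; apply: powR01; first by rewrite subr_ge0.
  by rewrite simplex_ge0 ?simplex_le1.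
apply/andP; split; first by rewrite mulr_ge0// mulr_ge0// ltW.
by rewrite -mulrA ger_pMr// mulr_ile1.
Qed.

Lemma bm_dirichlet_pdf u v : dirichlet_param u v -> bmfun S (dirichlet_pdf u v).
Proof.
move=> uv; split; first by apply: measurable_funTS; exact: measurable_dirichlet_pdf.
exists (dirichlet_coef u v) => x Sx.
by have /andP[h1 h2] := dirichlet_pdf_bounds uv Sx; rewrite ger0_norm.
Qed.

Lemma dirichlet_pdf_int1 u v : dirichlet_param u v ->
  (\int[leb]_(x in S) (dirichlet_pdf u v x)%:E = 1)%E.
Proof.
move=> uv; have [u1 v1] := uv; have c0 := dirichlet_coef_gt0 uv.
have mO := @measurable_osimplex R d.
rewrite (ge0_integral_osimplex d_gt0); last 2 first.
- by apply/measurable_EFinP; apply: measurable_funTS; exact: measurable_dirichlet_pdf.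
- by move=> x Sx; rewrite lee_fin; have /andP[] := dirichlet_pdf_bounds uv Sx.
pose F x := (\prod_(i < d) ppow (u ord0 i - 1) (x ord0 i)) *
     ppow (v - 1) (1 - \sum_(i < d) x ord0 i).
have mF : measurable_fun setT F.
  apply: measurable_funM.
    apply: measurable_prod => i _.
    by apply: (measurableT_comp (measurable_ppow _)); exact: measurable_row_coord.
  apply: (measurableT_comp (measurable_ppow _)).
  by apply: measurable_funB => //; exact: measurable_sum_row.
have F0 x : 0 <= F x.
  by rewrite mulr_ge0 ?ppow_ge0// prodr_ge0// => i _; exact: ppow_ge0.
transitivity (\int[leb]_x ((dirichlet_coef u v)%:E * (F x)%:E))%E.
  rewrite integral_mkcond; apply: eq_integral => x _; rewrite patchE.
  case: ifPn => [/set_mem Ox|]; rewrite -EFinM.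
    congr (_%:E); rewrite /dirichlet_pdf -/(dirichlet_coef u v) -mulrA /F; congr (_ * _).
    have [x0 x1] := Ox; rewrite norm1_simplex; last exact: osimplex_sub.
    rewrite mulrC; congr (_ * _); last by rewrite /ppow subr_gt0 x1.
    by apply: eq_bigr => i _; rewrite /ppow x0.
  move=> /negP; rewrite inE => /not_andP[/existsNP[i /negP xi]|/negP xs].
    by rewrite /F (bigD1 i)//= [ppow _ (x ord0 i)]/ppow (negbTE xi) !mul0r mulr0.
  by rewrite /F [ppow (v - 1) _]/ppow subr_gt0 (negbTE xs) !mulr0.
rewrite ge0_integralZl//; last 3 first.
- exact/measurable_EFinP.
- by move=> x _; rewrite lee_fin.
- by rewrite lee_fin ltW.
rewrite ge0_integral_row; last 2 first.
- exact/measurable_EFinP.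
- by move=> x; rewrite lee_fin.
have := @dirichlet_integral_tuple R d (fun i => u ord0 i) v 1 u1 v1.
under eq_integral.
  move=> t _; rewrite -[X in X%:E](_ : F (row_of_tuple t) = _); last first.
    rewrite /F; congr (_ * ppow _ (_ - _)); last by apply: eq_bigr => i _; rewrite mxE.
    by apply: eq_bigr => i _; rewrite mxE.
  over.
move=> ->; rewrite -EFinM ppow1 mulr1; congr (_%:E).
have : 0 < \prod_(i < d) gamma_fun (u ord0 i).
  by apply: prodr_gt0 => i _; exact: gamma_fun_gt0.
have := gamma_fun_gt0 v1; have := gamma_fun_gt0 (dirichlet_total_ge1 uv).
rewrite /dirichlet_coef; move: (gamma_fun _) (gamma_fun v) (\prod_(i < d) _).
by move=> p q r p0 q0 r0; field; rewrite !gt_eqF.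
Qed.

Lemma dirichlet_param_shift u v i : dirichlet_param u v ->
  dirichlet_param (u + delta_mx ord0 i) v.
Proof.
move=> [u1 v1]; split=> // j; rewrite !mxE eqxx/=.
by rewrite (le_trans (u1 j))// lerDl ler0n.
Qed.

Lemma sum_shift u i :
  \sum_(j < d) (u + delta_mx ord0 i) ord0 j = \sum_(j < d) u ord0 j + 1.
Proof.
under eq_bigr do rewrite !mxE eqxx/=.
rewrite big_split/=; congr (_ + _); rewrite (bigD1 i)//= eqxx big1 ?addr0//.
by move=> j /negbTE ->.
Qed.

(** The only place where the ratio of Gamma values enters: proportionality of
    gamma_ratio gives u_i / (v + sum u) without knowing the constant. *)
Lemma dirichlet_coef_shift u v i : dirichlet_param u v ->
  dirichlet_coef u v = u ord0 i / (v + \sum_(j < d) u ord0 j) *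
    dirichlet_coef (u + delta_mx ord0 i) v.
Proof.
move=> uv; have [u1 v1] := uv; have N1 := dirichlet_total_ge1 uv.
rewrite /dirichlet_coef sum_shift addrA.
have PE (w : 'rV[R]_d) : \prod_(j < d) gamma_fun (w ord0 j) =
    gamma_fun (w ord0 i) * \prod_(j < d | j != i) gamma_fun (w ord0 j).
  by rewrite (bigD1 i).
have QE : \prod_(j < d | j != i) gamma_fun ((u + delta_mx ord0 i) ord0 j) =
    \prod_(j < d | j != i) gamma_fun (u ord0 j).
  by apply: eq_bigr => j /negbTE ji; rewrite !mxE eqxx/= ji addr0.
have uE : (u + delta_mx ord0 i) ord0 i = u ord0 i + 1 by rewrite !mxE !eqxx.
rewrite !PE QE uE.
have P0 : 0 < \prod_(j < d | j != i) gamma_fun (u ord0 j).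
  by apply: prodr_gt0 => j _; exact: gamma_fun_gt0.
have := gamma_ratio_linear (u1 i) N1; rewrite /gamma_ratio.
set N := v + _ in N1 *.
have N2 : 1 <= N + 1 by lra.
have u2 : 1 <= u ord0 i + 1 by have := u1 i; lra.
have := gamma_fun_gt0 v1; have := gamma_fun_gt0 N1; have := gamma_fun_gt0 (u1 i).
have := gamma_fun_gt0 N2; have := gamma_fun_gt0 u2.
have : 0 < N by lra.
have : 0 < u ord0 i by have := u1 i; lra.
move: (gamma_fun (N + 1)) (gamma_fun N) (gamma_fun v) => a b c.
move: (gamma_fun (u ord0 i + 1)) (gamma_fun (u ord0 i)) => e f.
move: (\prod_(j < d | _) _) P0 => P P0.
move: (u ord0 i) (N) => y z y0 z0 e0 a0 f0 b0 c0 E.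
have -> : b = a * f * y / (e * z).
  rewrite (_ : a * f * y = (a / b * y) * (f * b)); last by field; rewrite gt_eqF.
  by rewrite -E; field; rewrite !gt_eqF.
by field; rewrite !gt_eqF.
Qed.

Lemma dirichlet_pdf_shift u v i x : dirichlet_param u v -> S x ->
  dirichlet_pdf u v x * x ord0 i = u ord0 i / (v + \sum_(j < d) u ord0 j) *
    dirichlet_pdf (u + delta_mx ord0 i) v x.
Proof.
move=> uv Sx; have [u1 v1] := uv.
have PE : (\prod_(j < d) x ord0 j `^ (u ord0 j - 1)) * x ord0 i =
    \prod_(j < d) x ord0 j `^ ((u + delta_mx ord0 i) ord0 j - 1).
  rewrite (bigD1 i)//= [in RHS](bigD1 i)//= !mxE !eqxx/= mulrAC; congr (_ * _).
    rewrite addrK mulrC mulr_powRB1 ?simplex_ge0//.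
    by rewrite (lt_le_trans ltr01).
  by apply: eq_bigr => j /negbTE ji; rewrite !mxE eqxx/= ji addr0.
rewrite /dirichlet_pdf -/(dirichlet_coef u v) (dirichlet_coef_shift i uv).
by rewrite -mulrA PE -/(dirichlet_coef (u + delta_mx ord0 i) v) !mulrA.
Qed.

Definition dirichlet_mean u v (g : 'rV[R]_d -> R) : R :=
  \int[leb]_(x in S) (dirichlet_pdf u v x * g x).

Lemma integrable_dirichlet u v g : dirichlet_param u v -> bmfun S g ->
  leb.-integrable S (EFin \o (fun x => dirichlet_pdf u v x * g x)).
Proof.
move=> uv bg; apply: bm_integrable_simplex; apply: bmM => //.
exact: bm_dirichlet_pdf.
Qed.

Lemma dirichlet_mean_cst u v c : dirichlet_param u v ->
  dirichlet_mean u v (fun=> c) = c.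
Proof.
move=> uv; rewrite /dirichlet_mean RintegralZr.
- by rewrite /Rintegral dirichlet_pdf_int1// mul1r.
- exact: measurable_simplex.
- by apply: bm_integrable_simplex; exact: bm_dirichlet_pdf.
Qed.

Lemma dirichlet_meanD u v f g : dirichlet_param u v -> bmfun S f -> bmfun S g ->
  dirichlet_mean u v (fun x => f x + g x) =
  dirichlet_mean u v f + dirichlet_mean u v g.
Proof.
move=> uv bf bg; rewrite /dirichlet_mean -RintegralD.
- by apply: eq_Rintegral => x _; rewrite mulrDr.
- exact: measurable_simplex.
- exact: integrable_dirichlet.
- exact: integrable_dirichlet.
Qed.

Lemma dirichlet_meanZ u v c g : dirichlet_param u v -> bmfun S g ->
  dirichlet_mean u v (fun x => c * g x) = c * dirichlet_mean u v g.
Proof.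
move=> uv bg; rewrite /dirichlet_mean -RintegralZl.
- by apply: eq_Rintegral => x _; rewrite mulrCA.
- exact: measurable_simplex.
- exact: integrable_dirichlet.
Qed.

Lemma dirichlet_mean_le u v f g : dirichlet_param u v -> bmfun S f -> bmfun S g ->
  (forall x, S x -> f x <= g x) ->
  dirichlet_mean u v f <= dirichlet_mean u v g.
Proof.
move=> uv bf bg fg; apply: le_Rintegral.
- exact: measurable_simplex.
- exact: integrable_dirichlet.
- exact: integrable_dirichlet.
- move=> x Sx; apply: ler_wpM2l; last exact: fg.
  by have /andP[] := dirichlet_pdf_bounds uv Sx.
Qed.

(** Multiplying the density by a coordinate raises one parameter by 1, so moments
    reduce to normalisation of shifted densities. *)
Lemma dirichlet_mean_coordM u v i g : dirichlet_param u v -> bmfun S g ->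
  dirichlet_mean u v (fun x => x ord0 i * g x) =
  u ord0 i / (v + \sum_(j < d) u ord0 j) *
    dirichlet_mean (u + delta_mx ord0 i) v g.
Proof.
move=> uv bg; have uv' := dirichlet_param_shift i uv.
rewrite /dirichlet_mean -RintegralZl.
- apply: eq_Rintegral => x /[!inE] Sx.
  by rewrite mulrA dirichlet_pdf_shift// mulrA.
- exact: measurable_simplex.
- exact: integrable_dirichlet.
Qed.

Lemma dirichlet_moment u v i k : dirichlet_param u v ->
  dirichlet_mean u v (fun x => x ord0 i ^+ k) =
  \prod_(j < k) ((u ord0 i + j%:R) / (v + \sum_(l < d) u ord0 l + j%:R)).
Proof.
elim: k u => [|k IH] u uv.
  by rewrite big_ord0; under eq_fun do rewrite expr0; exact: dirichlet_mean_cst.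
under eq_fun do rewrite exprS; rewrite dirichlet_mean_coordM//; last first.
  by apply: bmX; exact: bm_coord.
rewrite IH; last exact: dirichlet_param_shift.
rewrite big_ord_recl !addr0; congr (_ * _); apply: eq_bigr => j _.
rewrite sum_shift !mxE !eqxx/= /bump/= natrD.
by congr (_ / _); ring.
Qed.

End dirichlet_density.

Section moment_algebra.
Context {R : realFieldType}.
Variables s b D : R.
Hypothesis sbD : [/\ 0 <= s, s <= 1, 0 < b, b < 1 & 1 <= D].

Let m k := \prod_(j < k) ((s / b + 1 + j%:R) / (b^-1 + D + j%:R)).

Let mE k : m k = \prod_(j < k) ((s + (1 + j%:R) * b) / (1 + (D + j%:R) * b)).
Proof.
have [s0 s1 b0 b1 D1] := sbD.
apply: eq_bigr => j _; have j0 : 0 <= j%:R :> R by [].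
have p0 : 0 <= (D + j%:R) * b.
  by rewrite mulr_ge0 ?(ltW b0)// addr_ge0// (le_trans _ D1).
have h : b^-1 + D + j%:R = (1 + (D + j%:R) * b) / b.
  by field; rewrite gt_eqF.
have q0 : 0 < 1 + (D + j%:R) * b by lra.
by rewrite h; field; rewrite !gt_eqF.
Qed.

Let den_gt0 (j : nat) : 0 < 1 + (D + j%:R) * b.
Proof.
have [s0 s1 b0 b1 D1] := sbD.
have j0 : 0 <= j%:R :> R by [].
have p0 : 0 <= (D + j%:R) * b.
  by rewrite mulr_ge0 ?(ltW b0)// addr_ge0// (le_trans _ D1).
lra.
Qed.

Let m2E : m 2 - 2 * s * m 1 + s ^+ 2 =
  (b * (s * (1 - s)) + b ^+ 2 * (2 - 2 * (D + 1) * s + D * (D + 1) * s ^+ 2)) /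
  ((1 + D * b) * (1 + (D + 1) * b)).
Proof.
have [s0 s1 b0 b1 D1] := sbD.
rewrite !mE !big_ord_recr !big_ord0 /= !mul1r.
have := den_gt0 0; have := den_gt0 1; rewrite !addr0 => h1 h0.
by field; rewrite !gt_eqF.
Qed.

(** The central moments are explicit rational functions of b. The factor s + b
    records that the kernel is narrower near the face where s vanishes. *)
Lemma second_moment_le :
  m 2 - 2 * s * m 1 + s ^+ 2 <= (2 + D * (D + 1)) * b * (s + b).
Proof.
have [s0 s1 b0 b1 D1] := sbD.
rewrite m2E; have := den_gt0 0; have := den_gt0 1; rewrite !addr0 => h1 h0.
have bD : 0 <= D * b by rewrite mulr_ge0 ?(ltW b0)//; lra.
rewrite ler_pdivrMr ?mulr_gt0//.
have A0 : 0 <= (2 + D * (D + 1)) * b * (s + b).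
  by rewrite !mulr_ge0 ?addr_ge0 ?mulr_ge0 ?(ltW b0)//; lra.
apply: (@le_trans _ _ ((2 + D * (D + 1)) * b * (s + b))); last first.
  rewrite ler_peMr//; rewrite -[leLHS]mul1r ler_pM//; lra.
have -> : (2 + D * (D + 1)) * b * (s + b) =
  b * ((2 + D * (D + 1)) * s) + b ^+ 2 * (2 + D * (D + 1)) by ring.
have D0 : 0 <= D * (D + 1) by rewrite mulr_ge0//; lra.
apply: lerD; rewrite ler_pM2l ?exprn_gt0//.
  by rewrite [leRHS]mulrC ler_wpM2l//; lra.
have s2 : s ^+ 2 <= 1 by rewrite expr_le1.
have : D * (D + 1) * s ^+ 2 <= D * (D + 1) by rewrite ler_piMr.
have : 0 <= (D + 1) * s by rewrite mulr_ge0//; lra.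
lra.
Qed.

(** The coefficient of b ^+ 2 in the numerator is nonnegative: D times it is
    (D + 1) (D s - 1) ^+ 2 + (D - 1). *)
Lemma second_moment_ge :
  b * (s * (1 - s)) / ((1 + D) * (2 + D)) <= m 2 - 2 * s * m 1 + s ^+ 2.
Proof.
have [s0 s1 b0 b1 D1] := sbD.
rewrite m2E; have := den_gt0 0; have := den_gt0 1; rewrite !addr0 => h1 h0.
have DbD : D * b <= D by rewrite ler_piMr; lra.
have q0 : 0 <= 2 - 2 * (D + 1) * s + D * (D + 1) * s ^+ 2.
  rewrite -(@pmulr_rge0 _ D); last by lra.
  rewrite (_ : D * (_ + _) = (D + 1) * (D * s - 1) ^+ 2 + (D - 1)); last by ring.
  have := sqr_ge0 (D * s - 1); move: (_ ^+ 2) => z z0.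
  have : 0 <= (D + 1) * z by rewrite mulr_ge0//; lra.
  lra.
apply: ler_pM.
- by rewrite !mulr_ge0 ?(ltW b0)//; lra.
- by rewrite invr_ge0 mulr_ge0//; lra.
- by rewrite lerDl mulr_ge0// exprn_ge0// ltW.
- by rewrite lef_pV2 ?posrE ?mulr_gt0//; [apply: ler_pM; lra|lra..].
Qed.

(** The sum of the positive coefficients of the numerator of the fourth central
    moment, whose two lowest powers of b cancel. *)
Definition fourth_moment_const : R :=
  192 + 108 * D + 29 * D ^+ 2 + 6 * D ^+ 3 + D ^+ 4.

Let Q := 3 * s ^+ 2 - 6 * s ^+ 3 + 3 * s ^+ 4 +
  b * (26 * s - (72 + 20 * D) * s ^+ 2 + (64 + 42 * D + 6 * D ^+ 2) * s ^+ 3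
     - (18 + 22 * D + 6 * D ^+ 2) * s ^+ 4) +
  b ^+ 2 * (24 - (72 + 24 * D) * s + (72 + 60 * D + 12 * D ^+ 2) * s ^+ 2
     - (24 + 44 * D + 24 * D ^+ 2 + 4 * D ^+ 3) * s ^+ 3
     + (6 * D + 11 * D ^+ 2 + 6 * D ^+ 3 + D ^+ 4) * s ^+ 4).

Let m4E : m 4 - 4 * s * m 3 + 6 * s ^+ 2 * m 2 - 4 * s ^+ 3 * m 1 + s ^+ 4 =
  b ^+ 2 * Q / ((1 + D * b) * (1 + (D + 1) * b) * (1 + (D + 2) * b)
    * (1 + (D + 3) * b)).
Proof.
have [s0 s1 b0 b1 D1] := sbD.
rewrite !mE !big_ord_recr !big_ord0 /= !mul1r.
have := den_gt0 0; have := den_gt0 1; have := den_gt0 2; have := den_gt0 3.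
rewrite !addr0 /Q => h3 h2 h1 h0.
by field; rewrite !gt_eqF.
Qed.

Let Q_le : Q <= fourth_moment_const.
Proof.
have [s0 s1 b0 b1 D1] := sbD.
have D0 : 0 <= D by lra.
have mono c i j : 0 <= c -> 0 <= c * (b ^+ i * s ^+ j) <= c.
  move=> c0; have h : 0 <= b ^+ i * s ^+ j <= 1.
    by rewrite mulr_ge0 ?exprn_ge0 ?(ltW b0)//= mulr_ile1 ?exprn_ge0 ?exprn_ile1 ?(ltW b0) ?(ltW b1).
  by case/andP: h => h0 h1; rewrite mulr_ge0//= ler_piMr.
have D2 := exprn_ge0 2 D0; have D3 := exprn_ge0 3 D0; have D4 := exprn_ge0 4 D0.
have /andP[_ a02] := @mono 3 0 2 ltac:(lra).
have /andP[a03 _] := @mono 6 0 3 ltac:(lra).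
have /andP[_ a04] := @mono 3 0 4 ltac:(lra).
have /andP[_ a11] := @mono 26 1 1 ltac:(lra).
have /andP[a12 _] := @mono (72 + 20 * D) 1 2 ltac:(lra).
have /andP[_ a13] := @mono (64 + 42 * D + 6 * D ^+ 2) 1 3 ltac:(lra).
have /andP[a14 _] := @mono (18 + 22 * D + 6 * D ^+ 2) 1 4 ltac:(lra).
have /andP[_ a20] := @mono 24 2 0 ltac:(lra).
have /andP[a21 _] := @mono (72 + 24 * D) 2 1 ltac:(lra).
have /andP[_ a22] := @mono (72 + 60 * D + 12 * D ^+ 2) 2 2 ltac:(lra).
have /andP[a23 _] := @mono (24 + 44 * D + 24 * D ^+ 2 + 4 * D ^+ 3) 2 3 ltac:(lra).
have /andP[_ a24] := @mono (6 * D + 11 * D ^+ 2 + 6 * D ^+ 3 + D ^+ 4) 2 4 ltac:(lra).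
rewrite /Q /fourth_moment_const.
lra.
Qed.

Lemma fourth_moment_le :
  m 4 - 4 * s * m 3 + 6 * s ^+ 2 * m 2 - 4 * s ^+ 3 * m 1 + s ^+ 4 <=
  fourth_moment_const * b ^+ 2.
Proof.
have [s0 s1 b0 b1 D1] := sbD.
have D0 : 0 <= D by lra.
have C0 : 0 <= fourth_moment_const.
  by rewrite /fourth_moment_const !addr_ge0 ?mulr_ge0 ?exprn_ge0.
rewrite m4E mulrAC; have den_ge1 (j : nat) : 1 <= 1 + (D + j%:R) * b.
  by rewrite lerDl mulr_ge0 ?addr_ge0// ltW.
have := den_ge1 0; have := den_ge1 1; have := den_ge1 2; have := den_ge1 3.
rewrite !addr0 => h3 h2 h1 h0.
set E := _ * (1 + (D + 3) * b).
have E1 : 1 <= E by rewrite /E !mulr_ege1.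
have E0 : 0 < E by lra.
apply: (@le_trans _ _ (b ^+ 2 / E * fourth_moment_const)).
  by rewrite ler_wpM2l// divr_ge0 ?exprn_ge0// ltW.
by rewrite mulrC ler_wpM2l// ler_pdivrMr// ler_peMr// exprn_ge0// ltW.
Qed.

End moment_algebra.

(** * Moments of averages of independent variables *)

Section jensen.
Context d (T : measurableType d) (R : realType) (P : probability T R).
Implicit Types (W Z g : T -> R) (p q : R).

Lemma bm_integrableT g : bmfun setT g -> P.-integrable setT (EFin \o g).
Proof.
by move=> bg; apply: bm_integrable => //; rewrite (le_lt_trans (probability_le1 P measurableT))// ltry.
Qed.

Lemma integral_EFin_bm g : bmfun setT g ->
  (\int[P]_x (g x)%:E = (\int[P]_x g x)%R%:E)%E.
Proof.
move=> bg; rewrite /Rintegral fineK//.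
by apply: integrable_fin_num => //; exact: bm_integrableT.
Qed.

Lemma Rintegral_prob_cst (c : R) : \int[P]_x c = c.
Proof.
by rewrite Rintegral_cst// (_ : fine _ = 1) ?mulr1//= probability_setT.
Qed.

(** Jensen without convexity and at the cost of a factor 2 in the mean: with t
    half of the mean, integrate the pointwise bound t ^ (q - 1) (W - t) <= W ^ q. *)
Lemma half_mean_powR_le W q : 1 <= q -> bmfun setT W -> (forall x, 0 <= W x) ->
  ((((\int[P]_x W x) / 2) `^ q)%R%:E <= \int[P]_x (W x `^ q)%:E)%E.
Proof.
move=> q1 bW W0; have m0 : 0 <= \int[P]_x W x by exact: Rintegral_ge0.
have [m mE] : exists m, \int[P]_x W x = m by eexists.
rewrite mE in m0 *.
have [->|mn0] := eqVneq m 0.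
  rewrite mul0r powR0 ?gt_eqF//; last by rewrite (lt_le_trans ltr01).
  by apply: integral_ge0 => x _; rewrite lee_fin powR_ge0.
have t0 : 0 < m / 2 by rewrite divr_gt0// lt0r mn0.
have mt : m - m / 2 = m / 2 by lra.
move: (m / 2) t0 mt => t t0 mt.
have tq : t `^ q = t `^ (q - 1) * (m - t).
  by rewrite mt mulrC mulr_powRB1 ?(ltW t0)//; lra.
have bV : bmfun setT (fun x => t `^ (q - 1) * (W x - t)).
  by apply: bmM; [exact: bm_cst|apply: bmB => //; exact: bm_cst].
have -> : ((t `^ q)%:E = \int[P]_x (t `^ (q - 1) * (W x - t))%:E)%E.
  rewrite integral_EFin_bm// RintegralZl//; last first.
    by apply: bm_integrableT; apply: bmB => //; exact: bm_cst.
  rewrite RintegralB//; first by rewrite Rintegral_prob_cst tq mE.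
  - exact: bm_integrableT.
  - by apply: bm_integrableT; exact: bm_cst.
have mWq : measurable_fun setT (fun x => W x `^ q).
  by apply: (measurableT_comp (measurable_powR q)); case: bW.
have bWq : bmfun setT (fun x => W x `^ q).
  split => //; have [_ [M WM]] := bW; exists (`|M| `^ q) => x _.
  rewrite ger0_norm ?powR_ge0// ge0_ler_powR ?nnegrE//; first by lra.
  by rewrite -[leLHS]ger0_norm// (le_trans (WM x Logic.I))// ler_norm.
apply: le_integral => //.
- exact: bm_integrableT.
- exact: bm_integrableT.
- move=> x _; rewrite lee_fin.
  have [tW|Wt] := leP t (W x); last first.
    rewrite (@le_trans _ _ 0) ?powR_ge0//.
    by rewrite mulr_ge0_le0 ?powR_ge0// subr_le0 ltW.
  have Wx0 : 0 <= W x by rewrite W0.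
  apply: (@le_trans _ _ (W x `^ (q - 1) * W x)); last first.
    by rewrite mulrC mulr_powRB1//; lra.
  apply: ler_pM; rewrite ?powR_ge0 ?subr_ge0//; last by lra.
  by rewrite ge0_ler_powR ?nnegrE ?subr_ge0// ltW.
Qed.

Lemma mean_powR_le Z p : 1 <= p -> bmfun setT Z ->
  (((`|\int[P]_x Z x| / 2) `^ p)%R%:E <= \int[P]_x (`|Z x| `^ p)%:E)%E.
Proof.
move=> p1 bZ; have bA : bmfun setT (fun x => `|Z x|).
  case: bZ => mZ [M ZM]; split; first exact: measurableT_comp.
  by exists M => x xT; rewrite normr_id ZM.
apply: le_trans (half_mean_powR_le p1 bA _) => //.
rewrite lee_fin ge0_ler_powR ?nnegrE ?divr_ge0//; first by lra.
  by rewrite Rintegral_ge0.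
rewrite ler_pM2r ?invr_gt0//.
by apply: le_normr_Rintegral => //; exact: bm_integrableT.
Qed.

Lemma mean_sqr_powR_le Z p : 2 <= p -> bmfun setT Z ->
  ((((\int[P]_x (Z x ^+ 2)) / 2) `^ (p / 2))%R%:E <=
   \int[P]_x (`|Z x| `^ p)%:E)%E.
Proof.
move=> p2 bZ; have b2 : bmfun setT (fun x => Z x ^+ 2) by exact: bmX.
have q1 : 1 <= p / 2 by lra.
apply: (le_trans (half_mean_powR_le q1 b2 (fun x => sqr_ge0 (Z x)))).
rewrite le_eqVlt; apply/orP; left; apply/eqP; apply: eq_integral => x _.
congr (_%:E); rewrite -real_normK ?num_real// -powR_mulrn// -powRrM.
by congr (_ `^ _); lra.
Qed.

End jensen.

Section iid.
Context d (T : measurableType d) (R : realType) (P : probability T R).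
Local Open Scope ereal_scope.

Lemma ge0_integral_marginal n (i : 'I_n) (h : T -> \bar R) :
  measurable_fun setT h -> (forall x, 0 <= h x) ->
  \int[power_measure P n]_t h (tnth t i) = \int[P]_x h x.
Proof.
move=> mh h0; pose g j : T -> \bar R := if j == i then h else cst 1.
have gE t : h (tnth t i) = \prod_(j < n) g j (tnth t j).
  by rewrite (bigD1 i)//= /g eqxx big1 ?mule1// => j /negbTE ->.
transitivity (\int[power_measure P n]_t \prod_(j < n) g j (tnth t j)).
  by apply: eq_integral => t _; exact: gE.
rewrite ge0_integral_power_prod.
- rewrite (bigD1 i)//= {1}/g eqxx big1 ?mule1// => j /negbTE ji.
  by rewrite /g ji integral_cst//= probability_setT mule1.
- by move=> j; rewrite /g; case: ifP.
- by move=> j x; rewrite /g; case: ifP.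
Qed.

Lemma integral_marginal n (i : 'I_n) (h : T -> \bar R) :
  measurable_fun setT h ->
  \int[power_measure P n]_t h (tnth t i) = \int[P]_x h x.
Proof.
move=> mh; rewrite [LHS]integralE [RHS]integralE.
rewrite -(ge0_integral_marginal i (measurable_funepos mh))//.
rewrite -(ge0_integral_marginal i (measurable_funeneg mh))//.
congr (_ - _); apply: eq_integral => t _; first by rewrite !funeposE.
by rewrite !funenegE.
Qed.

Local Open Scope ring_scope.

Lemma bm_tnth n (i : 'I_n) (g : T -> R) : bmfun setT g ->
  bmfun setT (fun t : n.-tuple T => g (tnth t i)).
Proof.
move=> [mg [M gM]]; split; last by exists M => t _; exact: gM.
by apply: (measurableT_comp mg); exact: measurable_tnth.
Qed.

Local Notation Pn n := (power_measure P n).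

Lemma integral_iid_sum n (g : T -> R) : bmfun setT g ->
  \int[Pn n]_t (\sum_(i < n) g (tnth t i)) = n%:R * \int[P]_x g x.
Proof.
move=> bg; transitivity (fine (\int[Pn n]_t (\sum_(i < n) (g (tnth t i))%:E))%E).
  by congr fine; apply: eq_integral => t _; rewrite sumEFin.
rewrite integral_sum//; last first.
  by move=> i; apply: (@bm_integrableT _ _ _ (Pn n)); exact: bm_tnth.
rewrite (eq_bigr (fun=> (\int[P]_x g x)%:E)).
  by rewrite sumEFin/= sumr_const card_ord mulr_natl.
move=> i _; rewrite (@integral_marginal n i (EFin \o g)); last first.
  by apply/measurable_EFinP; case: bg.
exact: integral_EFin_bm.
Qed.

Lemma bm_iid_sum n (g : T -> R) : bmfun setT g ->
  bmfun setT (fun t : n.-tuple T => \sum_(i < n) g (tnth t i)).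
Proof. by move=> bg; apply: bm_sum => i; exact: bm_tnth. Qed.

Lemma integral_iid_sum_sqr n (g : T -> R) : bmfun setT g ->
  \int[P]_x g x = 0 ->
  (\int[Pn n]_t ((\sum_(i < n) g (tnth t i)) ^+ 2)%:E =
   (n%:R * \int[P]_x (g x ^+ 2))%:E)%E.
Proof.
move=> bg g0; have bg2 : bmfun setT (fun x => g x ^+ 2) by exact: bmX.
elim: n => [|n IH]; first by rewrite integral_power0 big_ord0 mul0r expr0n.
rewrite ge0_integral_powerS; last 2 first.
- by apply/measurable_EFinP; apply: measurable_funX; case: (bm_iid_sum n.+1 bg).
- by move=> t; rewrite lee_fin sqr_ge0.
pose V := \int[P]_x (g x ^+ 2).
have bS := bm_iid_sum n bg.
have bS2 : bmfun setT (fun t : n.-tuple T => (\sum_(i < n) g (tnth t i)) ^+ 2).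
  exact: bmX.
have iS2 : \int[Pn n]_t ((\sum_(i < n) g (tnth t i)) ^+ 2) = n%:R * V.
  by rewrite /Rintegral IH.
transitivity (\int[P]_x (g x ^+ 2 + n%:R * V)%:E)%E.
  apply: eq_integral => x _.
  transitivity (\int[Pn n]_t (g x ^+ 2 + (2 * g x) * (\sum_(i < n) g (tnth t i)) +
     (\sum_(i < n) g (tnth t i)) ^+ 2)%:E)%E.
    apply: eq_integral => t _; congr (_%:E); rewrite big_ord_recl tnth0.
    under eq_bigr do rewrite tnthS.
    by ring.
  have b1 : bmfun setT (fun t : n.-tuple T => (2 * g x) * (\sum_(i < n) g (tnth t i))).
    exact: (bmM (bm_cst _ _) bS).
  have bc : bmfun [set: n.-tuple T] (fun=> g x ^+ 2) by exact: bm_cst.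
  have ib f : bmfun setT f -> (Pn n).-integrable setT (EFin \o f).
    by move=> bf; exact: (@bm_integrableT _ _ _ (Pn n)).
  rewrite (@integral_EFin_bm _ _ _ (Pn n)); last by do 2 apply: bmD => //.
  congr (_%:E); rewrite RintegralD//; [|by apply: ib; exact: bmD|exact: ib].
  rewrite RintegralD//; [|exact: ib..].
  rewrite RintegralZl//; last exact: ib.
  by rewrite (Rintegral_prob_cst (Pn n)) integral_iid_sum// g0 !mulr0 addr0 iS2.
rewrite (@integral_EFin_bm _ _ _ P); last by apply: bmD => //; exact: bm_cst.
congr (_%:E); rewrite RintegralD//; try exact: bm_integrableT.
  by rewrite Rintegral_prob_cst -/V -natr1; ring.
by apply: bm_integrableT; exact: bm_cst.
Qed.

Lemma integral_iid_avg n (g : T -> R) c : (0 < n)%N -> bmfun setT g ->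
  \int[Pn n]_t (n%:R^-1 * \sum_(i < n) g (tnth t i) - c) = \int[P]_x g x - c.
Proof.
move=> n0 bg; have bS := bm_iid_sum n bg.
have ib f := @bm_integrableT _ _ _ (Pn n) f.
rewrite (RintegralB measurableT (ib _ (bmM (bm_cst _ _) bS)) (ib _ (bm_cst _ _))).
rewrite (Rintegral_prob_cst (Pn n)) (RintegralZl _ measurableT (ib _ bS)).
rewrite (integral_iid_sum _ bg) mulrA mulVf ?mul1r//.
by rewrite pnatr_eq0 -lt0n.
Qed.

Lemma integral_iid_avg_sqr n (g : T -> R) k : (0 < n)%N -> bmfun setT g ->
  \int[P]_x g x = k ->
  \int[Pn n]_t ((n%:R^-1 * \sum_(i < n) g (tnth t i) - k) ^+ 2) =
  n%:R^-1 * (\int[P]_x (g x ^+ 2) - k ^+ 2).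
Proof.
move=> n0 bg mk; have nn0 : n%:R != 0 :> R by rewrite pnatr_eq0 -lt0n.
have bgk : bmfun setT (fun x => g x - k) := bmB bg (bm_cst _ k).
have iP h := @bm_integrableT _ _ _ P h.
have iPn h := @bm_integrableT _ _ _ (Pn n) h.
have mgk : \int[P]_x (g x - k) = 0.
  rewrite (RintegralB measurableT (iP _ bg) (iP _ (bm_cst _ k))) mk.
  by rewrite (Rintegral_prob_cst P) subrr.
have vgk : \int[P]_x ((g x - k) ^+ 2) = \int[P]_x (g x ^+ 2) - k ^+ 2.
  transitivity (\int[P]_x ((g x ^+ 2 - 2 * k * g x) + k ^+ 2)).
    by apply: eq_Rintegral => x _; ring.
  have b1 : bmfun setT (fun x => 2 * k * g x) := bmM (bm_cst _ _) bg.
  have b2 : bmfun setT (fun x => g x ^+ 2) := bmX 2 bg.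
  rewrite (RintegralD measurableT (iP _ (bmB b2 b1)) (iP _ (bm_cst _ _))).
  rewrite (RintegralB measurableT (iP _ b2) (iP _ b1)).
  rewrite (RintegralZl _ measurableT (iP _ bg)) mk (Rintegral_prob_cst P).
  by move: (Rintegral _ _ _) => I; ring.
have bS := bm_iid_sum n bgk.
transitivity (\int[Pn n]_t
    (n%:R^-1 ^+ 2 * (\sum_(i < n) (g (tnth t i) - k)) ^+ 2)).
  apply: eq_Rintegral => t _; rewrite -exprMn; congr (_ ^+ _).
  rewrite sumrB mulrBr; congr (_ - _).
  by rewrite sumr_const card_ord -[k *+ n]mulr_natl mulKf.
rewrite (RintegralZl _ measurableT (iPn _ (bmX 2 bS))).
rewrite [X in _ * X]/Rintegral (integral_iid_sum_sqr n bgk mgk) vgk/=.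
by move: (_ - k ^+ 2) => I; field.
Qed.

End iid.

(** * The risk as an integral of pointwise losses *)

Lemma ge0_poweR_le {R : realType} (r : R) (x y : \bar R) : 0 <= r ->
  (0 <= x -> x <= y -> x `^ r <= y `^ r)%E.
Proof.
move=> r0 x0 xy; apply: (gt0_ler_poweR r0) => //.
  by rewrite in_itv/= x0 leey.
by rewrite in_itv/= (le_trans x0 xy) leey.
Qed.

Section risk_formula.
Context {R : realType} {d : nat}.
Local Notation leb := (@lebesgue_row R d).
Local Notation S := (@simplex R d).
Local Open Scope ereal_scope.

Lemma simplex_Lp_powR (p : R) (g : 'rV[R]_d -> R) : (0 < p)%R ->
  simplex_Lp p g `^ p = \int[leb]_(s in S) (`|g s| `^ p)%R%:E.
Proof.
move=> p0; rewrite /simplex_Lp poweR_Lnorm ?gt_eqF// [RHS]integral_mkcond.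
apply: eq_integral => s _; rewrite !patchE; case: ifPn => _.
  by rewrite -poweR_EFin.
by rewrite abse0 poweR0r// gt_eqF.
Qed.

Variables (n : nat) (T : n.-tuple 'rV[R]_d -> 'rV[R]_d -> R).
Variables (f : simplex_density R d) (p : R).
Hypotheses (mT : is_estimator T) (p_gt0 : (0 < p)%R).

Let loss (z : n.-tuple 'rV[R]_d * 'rV[R]_d) : \bar R :=
  (`|T z.1 z.2 - f z.2| `^ p)%R%:E * (\1_S z.2)%:E.

Let loss_ge0 z : 0 <= loss z.
Proof. by rewrite mule_ge0// lee_fin// powR_ge0. Qed.

Let measurable_loss : measurable_fun setT loss.
Proof.
have mf : measurable_fun setT (fun s => (f \_ S) s).
  apply/(measurable_restrictT _ _).1; first exact: measurable_simplex.
  exact: measurable_pdf.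
rewrite (_ : loss = fun z => ((`|T z.1 z.2 - (f \_ S) z.2| `^ p) * \1_S z.2)%R%:E).
  apply/measurable_EFinP; apply: measurable_funM.
    apply: (measurableT_comp (measurable_powR _)); apply: measurableT_comp => //.
    apply: measurable_funB; first exact: mT.
    by apply: (measurableT_comp mf); exact: measurable_snd.
  apply: (measurableT_comp (measurable_indic _)); last exact: measurable_snd.
  exact: measurable_simplex.
apply/funext => z; rewrite /loss -EFinM; congr (_%:E); rewrite indicE patchE.
by case: (z.2 \in S); rewrite ?mulr0.
Qed.

Lemma integral_loss X :
  simplex_Lp p (T X \- f)%R `^ p = \int[leb]_s loss (X, s).
Proof.
rewrite simplex_Lp_powR// integral_mkcond; apply: eq_integral => s _.
by rewrite patchE /loss indicE; case: (s \in S); rewrite ?mule1 ?mule0.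
Qed.

(** Exchanging the expectation and the integral over the simplex reduces all the
    bounds on the risk to bounds at a fixed point s. *)
Lemma risk_tonelli :
  risk p T f = (\int[leb]_(s in S)
    \int[sample_law n f]_X (`|T X s - f s| `^ p)%R%:E) `^ p^-1.
Proof.
rewrite /risk; congr (_ `^ _).
transitivity (\int[sample_law n f]_X \int[leb]_s loss (X, s)).
  by apply: eq_integral => X _; exact: integral_loss.
rewrite (fubini_tonelli (m1 := power_measure (density_law f) n) (m2 := leb) loss measurable_loss loss_ge0).
rewrite [RHS]integral_mkcond; apply: eq_integral => s _; rewrite patchE /loss/=.
rewrite indicE; case: (s \in S).
  by apply: eq_integral => X _; rewrite mule1.
by rewrite integral0_eq// => X _; rewrite mule0.
Qed.

Lemma measurable_mean_loss : measurable_fun S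
  (fun s => \int[sample_law n f]_X (`|T X s - f s| `^ p)%R%:E).
Proof.
have := measurable_fun_fubini_tonelli_G (m1 := power_measure (density_law f) n)
   loss measurable_loss loss_ge0.
move=> h; apply: (eq_measurable_fun _ _ (measurable_funTS h)) => s sS.
by apply: eq_integral => X _; rewrite /= /loss/= indicE sS mule1.
Qed.

Lemma risk_le (c : R) : (0 <= c)%R ->
  (forall s, osimplex s ->
     \int[sample_law n f]_X (`|T X s - f s| `^ p)%R%:E <= c%:E) -> (0 < d)%N ->
  risk p T f <= (c `^ p^-1)%R%:E.
Proof.
move=> c0 h d0; rewrite risk_tonelli.
have mS := @measurable_simplex R d; have mO := @measurable_osimplex R d.
rewrite -poweR_EFin; apply: ge0_poweR_le; first by rewrite invr_ge0 ltW.
  by apply: integral_ge0 => s Ss; apply: integral_ge0 => X _; rewrite lee_fin powR_ge0.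
rewrite (ge0_integral_osimplex d0); last 2 first.
- exact: measurable_mean_loss.
- by move=> s Ss; apply: integral_ge0 => X _; rewrite lee_fin powR_ge0.
apply: (@le_trans _ _ (\int[leb]_(s in osimplex) c%:E)).
  apply: ge0_le_integral => //.
  - by move=> s Ss; apply: integral_ge0 => X _; rewrite lee_fin powR_ge0.
  - by apply: measurable_funS measurable_mean_loss => //; exact: osimplex_sub.
rewrite integral_cst//= -[leRHS]mule1 lee_wpmul2l ?lee_fin//.
apply: le_trans (@simplex_volume_le1 R d); apply: le_measure; rewrite ?inE//.
exact: osimplex_sub.
Qed.

End risk_formula.

Section kde_measurability.
Context {R : realType} {d : nat}.
Local Notation S := (@simplex R d).

Lemma gamma_fun_ge0 (a : R) : 0 <= gamma_fun a.
Proof.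
rewrite gamma_funE fine_ge0// integral_ge0// => x _.
by rewrite lee_fin gamma_integrand_ge0.
Qed.

(** The parameters of the kernel depend on s, so the joint measurability of the
    estimator requires that of Gamma in its argument. *)
Lemma measurable_gamma_fun : measurable_fun setT (@gamma_fun R).
Proof.
rewrite (_ : @gamma_fun R = fine \o (fun a =>
  \int[lebesgue_measure]_x (gamma_integrand a x)%:E)%E); last first.
  by apply/funext => a; rewrite gamma_funE.
apply: measurableT_comp => //.
pose F (z : R * R) : \bar R := (gamma_integrand z.1 z.2)%:E.
apply: (measurable_fun_fubini_tonelli_F (m2 := @lebesgue_measure R) F).
  apply/measurable_EFinP; apply: measurable_funM.
    apply: measurable_fun_ifT => //.
      by apply: measurable_fun_ltr => //; exact: measurable_snd.
    apply: measurable_fun_powR; first exact: measurable_snd.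
    by apply: measurable_funB => //; exact: measurable_fst.
  by apply: measurableT_comp => //; apply: measurable_funN; exact: measurable_snd.
by move=> z; rewrite lee_fin gamma_integrand_ge0.
Qed.

Definition kde_shape (b : R) (s : 'rV[R]_d) : 'rV[R]_d := b^-1 *: s + const_mx 1.
Definition kde_last (b : R) (s : 'rV[R]_d) : R := (1 - norm1 s) / b + 1.
Definition kde_kernel (b : R) (s : 'rV[R]_d) := dirichlet_pdf (kde_shape b s) (kde_last b s).

Lemma measurable_kde_kernel b d0 (U : measurableType d0) (g h : U -> 'rV[R]_d) :
  measurable_fun setT g -> measurable_fun setT h ->
  measurable_fun setT (fun u => kde_kernel b (g u) (h u)).
Proof.
move=> mg mh.
have mc (k : U -> 'rV[R]_d) i : measurable_fun setT k ->
    measurable_fun setT (fun u => k u ord0 i).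
  by move=> mk; apply: (measurableT_comp (measurable_row_coord _) mk).
have msh i : measurable_fun setT (fun u => kde_shape b (g u) ord0 i).
  rewrite (_ : (fun _ => _) = fun u => b^-1 * g u ord0 i + 1); last first.
    by apply/funext => u; rewrite !mxE.
  by apply: measurable_funD => //; apply: measurable_funM => //; exact: mc.
have mn (k : U -> 'rV[R]_d) : measurable_fun setT k ->
    measurable_fun setT (fun u => norm1 (k u)).
  by move=> mk; apply: (measurableT_comp (@measurable_norm1 R d) mk).
have ml : measurable_fun setT (fun u => kde_last b (g u)).
  apply: measurable_funD => //; apply: measurable_funM => //.
  by apply: measurable_funB => //; exact: mn.
have mG (k : U -> R) : measurable_fun setT k ->
    measurable_fun setT (fun u => gamma_fun (k u)).
  by move=> mk; apply: (measurableT_comp measurable_gamma_fun mk).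
rewrite /kde_kernel /dirichlet_pdf.
apply: measurable_funM; last first.
  apply: measurable_prod => i _; apply: measurable_fun_powR; first exact: mc.
  exact: measurable_funB.
apply: measurable_funM; last first.
  apply: measurable_fun_powR; last exact: measurable_funB.
  by apply: measurable_funB => //; exact: mn.
apply: measurable_funM.
  by apply: mG; apply: measurable_funD => //; exact: measurable_sum.
pose den u := gamma_fun (kde_last b (g u)) *
  \prod_(i < d) gamma_fun (kde_shape b (g u) ord0 i).
rewrite (_ : (fun _ => _) = fun u => den u `^ (-1)); last first.
  apply/funext => u; rewrite powR_inv1// mulr_ge0 ?gamma_fun_ge0//.
  by apply: prodr_ge0 => i _; exact: gamma_fun_ge0.
apply: (measurableT_comp (measurable_powR _)); apply: measurable_funM.
  exact: mG.
by apply: measurable_prod => i _; exact: mG.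
Qed.

Lemma is_estimator_kde b n : is_estimator (@dirichlet_kde R d n b).
Proof.
apply: measurable_funM => //; apply: measurable_sum => i.
apply: measurable_kde_kernel; first exact: measurable_snd.
exact: (measurableT_comp (measurable_tnth i) measurable_fst).
Qed.

End kde_measurability.

(** * Pointwise loss of the Dirichlet estimator *)

Section sample_simplex.
Context {R : realType} {d : nat} (f : simplex_density R d) (n : nat).
Local Notation leb := (@lebesgue_row R d).
Local Notation S := (@simplex R d).
Local Notation P := (density_law f).
Local Notation Pn := (power_measure P n).

Lemma mean_density_law (g : 'rV[R]_d -> R) :
  measurable_fun setT g -> leb.-integrable S (fun x => (g x * f x)%:E) ->
  (\int[P]_x (g x)%:E = \int[leb]_(x in S) (g x * f x)%:E)%E.
Proof.
move=> mg ig; apply: (integral_density _ _ _ _ mg ig) => //.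
- exact: measurable_simplex.
- exact: measurable_pdf.
- exact: pdf_ge0.
Qed.

(** Almost surely all the observations lie in the simplex. This allows replacing
    the kernel, which is unbounded off the simplex, by its restriction. *)
Lemma integral_sample_simplex (F G : n.-tuple 'rV[R]_d -> \bar R) :
  measurable_fun setT F -> measurable_fun setT G ->
  (forall X, 0 <= F X)%E -> (forall X, 0 <= G X)%E ->
  (forall X, (forall i, S (tnth X i)) -> F X = G X) ->
  (\int[sample_law n f]_X F X = \int[Pn]_X G X)%E.
Proof.
move=> mF mG F0 G0 FG.
pose A := [set X : n.-tuple 'rV[R]_d | forall i, S (tnth X i)].
have mA : measurable A.
  rewrite (_ : A = \bigcap_(i in [set: 'I_n])
      (fun X : n.-tuple 'rV[R]_d => tnth X i) @^-1` S).
    apply: fin_bigcap_measurable => // i _.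
    rewrite -[X in measurable X]setTI; apply: measurable_tnth => //.
    exact: measurable_simplex.
  by apply/seteqP; split => X h i; [move=> _; exact: h|exact: (h i Logic.I)].
have PS : P S = 1%E by rewrite /density_law setIid integral_pdf.
have PA : Pn A = 1%E.
  rewrite /A (power_measure_box P (A := fun=> S)) => [|_]; last exact: measurable_simplex.
  by rewrite big1.
rewrite -[sample_law n f]/(power_measure P n).
apply: ge0_ae_eq_integral => //.
exists (~` A); split; first exact: measurableC.
  by have /= -> := probability_setC Pn mA; rewrite PA subee.
by move=> X /= h HA; apply: h => _; exact: FG.
Qed.

End sample_simplex.

Section kde_lower.
Context {R : realType} {d : nat} (d_gt0 : (0 < d)%N).
Local Notation leb := (@lebesgue_row R d).
Local Notation S := (@simplex R d).
Variables (f : simplex_density R d) (n : nat) (b p : R) (s : 'rV[R]_d).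
Hypotheses (n_gt0 : (0 < n)%N) (b_gt0 : 0 < b) (Ss : S s) (bf : bmfun S f).
Local Notation P := (density_law f).
Local Notation Pn := (power_measure P n).

Lemma kde_param : dirichlet_param (kde_shape b s) (kde_last b s).
Proof.
split=> [i|]; first by rewrite !mxE lerDr mulr_ge0 ?simplex_ge0// invr_ge0 ltW.
by rewrite lerDr divr_ge0 ?(ltW b_gt0)// subr_ge0; case: Ss.
Qed.

Lemma kde_total :
  kde_last b s + \sum_(i < d) kde_shape b s ord0 i = b^-1 + (d%:R + 1).
Proof.
under eq_bigr do rewrite !mxE.
rewrite big_split/= -mulr_sumr sumr_const card_ord /kde_last norm1_simplex//.
by field; rewrite gt_eqF.
Qed.

(** Applied to the density it gives the mean of the estimator at s; applied to the
    kernel it gives the integral of the squared kernel. *)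
Definition kde_mean (g : 'rV[R]_d -> R) : R :=
  dirichlet_mean (kde_shape b s) (kde_last b s) g.

Let g := kde_kernel b s \_ S.

Let bK : bmfun S (kde_kernel b s).
Proof. exact: (bm_dirichlet_pdf kde_param). Qed.

Let bg : bmfun setT g.
Proof. by apply: bm_restrict => //; exact: measurable_simplex. Qed.

Let Rmean (h : 'rV[R]_d -> R) : bmfun setT h ->
  (\int[P]_x h x = \int[leb]_(x in S) (h x * f x))%R.
Proof.
move=> bh; rewrite /Rintegral mean_density_law//; first by case: bh.
apply: bm_integrable_simplex; apply: bmM => //.
by case: bh => mh [M hM]; split; [exact: measurable_funTS|exists M => x _; exact: hM].
Qed.

Let mean_g : \int[P]_x g x = kde_mean f.
Proof.
rewrite Rmean// /kde_mean /dirichlet_mean; apply: eq_Rintegral => x xS.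
by rewrite /g patchE xS.
Qed.

Let Z (X : n.-tuple 'rV[R]_d) := n%:R^-1 * (\sum_(i < n) g (tnth X i)) - f s.

Let bZ : bmfun setT Z.
Proof.
by apply: bmB; [apply: bmM; [exact: bm_cst|exact: bm_iid_sum]|exact: bm_cst].
Qed.

Let mean_Z : \int[Pn]_X Z X = kde_mean f - f s.
Proof. by rewrite /Z (integral_iid_avg P (f s) n_gt0 bg) mean_g. Qed.

Let loss_Z : (\int[sample_law n f]_X (`|dirichlet_kde b X s - f s| `^ p)%R%:E =
  \int[Pn]_X (`|Z X| `^ p)%R%:E)%E.
Proof.
apply: integral_sample_simplex.
- apply/measurable_EFinP; apply: (measurableT_comp (measurable_powR _)).
  apply: measurableT_comp => //; apply: measurable_funB => //.
  have mk := @is_estimator_kde R d b n.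
  exact: (measurableT_comp mk (pair2_measurable s)).
- apply/measurable_EFinP; apply: (measurableT_comp (measurable_powR _)).
  by apply: measurableT_comp => //; case: bZ.
- by move=> X; rewrite lee_fin powR_ge0.
- by move=> X; rewrite lee_fin powR_ge0.
move=> X SX; congr (`|_ - _| `^ _)%:E; congr (_ * _); apply: eq_bigr => i _.
by rewrite /g patchE mem_set.
Qed.

Lemma kde_bias_le : 1 <= p ->
  (((`|kde_mean f - f s| / 2) `^ p)%R%:E <=
   \int[sample_law n f]_X (`|dirichlet_kde b X s - f s| `^ p)%R%:E)%E.
Proof.
by move=> p1; rewrite loss_Z -mean_Z; exact: (mean_powR_le Pn p1 bZ).
Qed.

Lemma kde_variance_le (k : R) : 2 <= p -> (forall x, S x -> f x = k) ->
  (((n%:R^-1 * (k * kde_mean (kde_kernel b s) - k ^+ 2) / 2) `^ (p / 2))%R%:E <=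
   \int[sample_law n f]_X (`|dirichlet_kde b X s - f s| `^ p)%R%:E)%E.
Proof.
move=> p2 fk; rewrite loss_Z.
have mk : \int[P]_x g x = k.
  rewrite mean_g -[RHS](dirichlet_mean_cst d_gt0 k kde_param).
  by apply: eq_Rintegral => x /[!inE] Sx; rewrite fk.
have mg2 : \int[P]_x (g x ^+ 2) = k * kde_mean (kde_kernel b s).
  rewrite (Rmean (bmX 2 bg)) /kde_mean -(dirichlet_meanZ _ kde_param bK).
  apply: eq_Rintegral => x xS; rewrite /g patchE xS -/(kde_kernel b s x).
  by rewrite fk ?expr2; [rewrite mulrAC mulrA|rewrite inE in xS].
have -> : n%:R^-1 * (k * kde_mean (kde_kernel b s) - k ^+ 2) =
    \int[Pn]_X (Z X ^+ 2); last exact: (mean_sqr_powR_le Pn p2 bZ).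
rewrite /Z (fk s Ss) (integral_iid_avg_sqr (P := P) n_gt0 bg mk).
by rewrite mg2.
Qed.

End kde_lower.

Section kde_moments.
Context {R : realType} {d : nat} (d_gt0 : (0 < d)%N).
Local Notation leb := (@lebesgue_row R d).
Local Notation S := (@simplex R d).
Variables (b : R) (s : 'rV[R]_d).
Hypothesis bs : [/\ 0 < b, b < 1 & S s].
Local Notation D := (d%:R + 1 : R).

Let m (i : 'I_d) k := \prod_(j < k)
  ((s ord0 i / b + 1 + j%:R) / (b^-1 + D + j%:R)).

Let uv : dirichlet_param (kde_shape b s) (kde_last b s).
Proof. by have [b0 _ Ss] := bs; exact: kde_param. Qed.

Let momentE i k : kde_mean b s (fun x => x ord0 i ^+ k) = m i k.
Proof.
have [b0 _ Ss] := bs; rewrite /kde_mean (dirichlet_moment d_gt0 i k uv).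
apply: eq_bigr => j _; rewrite kde_total//; congr (_ / _).
by rewrite !mxE mulrC.
Qed.

Let bc i k c : bmfun S (fun x : 'rV[R]_d => c * x ord0 i ^+ k).
Proof. by apply: bmM; [exact: bm_cst|apply: bmX; exact: bm_coord]. Qed.

Let momentZE i k c : kde_mean b s (fun x => c * x ord0 i ^+ k) = c * m i k.
Proof.
by rewrite /kde_mean dirichlet_meanZ -?momentE//; apply: bmX; exact: bm_coord.
Qed.

Let bxs i : bmfun S (fun x : 'rV[R]_d => x ord0 i - s ord0 i).
Proof. by apply: bmB; [exact: bm_coord|exact: bm_cst]. Qed.

Let secondE i : kde_mean b s (fun x => (x ord0 i - s ord0 i) ^+ 2) =
  m i 2 - 2 * s ord0 i * m i 1 + s ord0 i ^+ 2.
Proof.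
transitivity (kde_mean b s (fun x => (1 * x ord0 i ^+ 2 +
    (- (2 * s ord0 i)) * x ord0 i ^+ 1) + s ord0 i ^+ 2)).
  by congr (kde_mean b s _); apply/funext => x; ring.
rewrite /kde_mean dirichlet_meanD//; [|by apply: bmD|exact: bm_cst].
rewrite dirichlet_meanD// (dirichlet_mean_cst d_gt0 _ uv) -!/(kde_mean b s _) !momentZE.
by rewrite mul1r mulNr.
Qed.

Let fourthE i : kde_mean b s (fun x => (x ord0 i - s ord0 i) ^+ 4) =
  m i 4 - 4 * s ord0 i * m i 3 + 6 * s ord0 i ^+ 2 * m i 2
   - 4 * s ord0 i ^+ 3 * m i 1 + s ord0 i ^+ 4.
Proof.
transitivity (kde_mean b s (fun x => ((((1 * x ord0 i ^+ 4 +
    (- (4 * s ord0 i)) * x ord0 i ^+ 3) + (6 * s ord0 i ^+ 2) * x ord0 i ^+ 2) +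
    (- (4 * s ord0 i ^+ 3)) * x ord0 i ^+ 1)) + s ord0 i ^+ 4)).
  by congr (kde_mean b s _); apply/funext => x; ring.
rewrite /kde_mean dirichlet_meanD//; [|by do 3 apply: bmD => //|exact: bm_cst].
rewrite dirichlet_meanD//; [|by do 2 apply: bmD => //].
rewrite dirichlet_meanD//; [|by apply: bmD => //].
rewrite dirichlet_meanD// (dirichlet_mean_cst d_gt0 _ uv) -!/(kde_mean b s _) !momentZE.
by rewrite mul1r !mulNr.
Qed.

Let hyp i : [/\ 0 <= s ord0 i, s ord0 i <= 1, 0 < b, b < 1 & 1 <= D].
Proof.
have [b0 b1 Ss] := bs; split=> //; [exact: simplex_ge0|exact: simplex_le1|].
by rewrite lerDr.
Qed.

Lemma kde_second_le i : kde_mean b s (fun x => (x ord0 i - s ord0 i) ^+ 2) <=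
  (2 + D * (D + 1)) * b * (s ord0 i + b).
Proof. by rewrite secondE; exact: second_moment_le (hyp i). Qed.

Lemma kde_second_ge i : b * (s ord0 i * (1 - s ord0 i)) / ((1 + D) * (2 + D)) <=
  kde_mean b s (fun x => (x ord0 i - s ord0 i) ^+ 2).
Proof. by rewrite secondE; exact: second_moment_ge (hyp i). Qed.

Lemma kde_fourth_le i : kde_mean b s (fun x => (x ord0 i - s ord0 i) ^+ 4) <=
  fourth_moment_const D * b ^+ 2.
Proof. by rewrite fourthE; exact: fourth_moment_le (hyp i). Qed.

Local Notation C2 := (2 + D * (D + 1)).

Let v_gt0 i : 0 < 2 * d%:R * C2 * b * (s ord0 i + b).
Proof.
have [b0 _ Ss] := bs; have d0 : 0 < d%:R :> R by rewrite ltr0n.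
have C0 : 0 < C2 by rewrite addr_gt0// mulr_gt0//; lra.
have sb : 0 < s ord0 i + b by rewrite ltr_wpDl// simplex_ge0.
by rewrite !mulr_gt0.
Qed.

(** The volume of the box around s whose half-sides are sqrt (2 d) times the upper
    bound of the standard deviation in each coordinate. *)
Definition kde_box_volume : R :=
  \prod_(i < d) (2 * Num.sqrt (2 * d%:R * C2 * b * (s ord0 i + b))).

Lemma kde_box_volume_gt0 : 0 < kde_box_volume.
Proof.
have [b0 _ Ss] := bs; apply: prodr_gt0 => i _; rewrite mulr_gt0// sqrtr_gt0.
exact: v_gt0.
Qed.

(** Chebyshev in each coordinate leaves mass 1/2 on the box, and Cauchy-Schwarz
    turns this mass into a lower bound by the inverse volume. *)
Lemma kde_kernel_sqr_ge :
  (4 * kde_box_volume)^-1 <= kde_mean b s (kde_kernel b s).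
Proof.
have [b0 b1 Ss] := bs; have V0 := kde_box_volume_gt0.
have d0 : 0 < d%:R :> R by rewrite ltr0n.
pose v i := 2 * d%:R * C2 * b * (s ord0 i + b).
have v0 i : 0 < v i by exact: v_gt0.
pose r i := Num.sqrt (v i).
pose B := [set x : 'rV[R]_d | forall i, s ord0 i - r i <= x ord0 i <= s ord0 i + r i].
have mB : measurable B := measurable_cube _ _.
have VB : leb B = kde_box_volume%:E.
  rewrite /B (@lebesgue_row_cube R d (fun i => s ord0 i - r i) (fun i => s ord0 i + r i)).
    by congr (_%:E); apply: eq_bigr => i _; rewrite -/(v i) -/(r i); ring.
  by move=> i; rewrite lerBlDr -addrA lerDl addr_ge0 ?sqrtr_ge0.
pose w : 'rV[R]_d -> R := \1_B.
have bw : bmfun S w.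
  split; first exact: measurable_indic.
  by exists 1 => x _; rewrite /w indicE; case: (_ \in _); rewrite ?normr1 ?normr0.
have bK : bmfun S (kde_kernel b s) by exact: bm_dirichlet_pdf uv.
have Ew : 2^-1 <= kde_mean b s w.
  (* The indicator of the box is at least 1 - q. *)
  pose q (x : 'rV[R]_d) : R := \sum_(i < d) (v i)^-1 * (x ord0 i - s ord0 i) ^+ 2.
  have bi i : bmfun S (fun x : 'rV[R]_d => (v i)^-1 * (x ord0 i - s ord0 i) ^+ 2).
    by apply: bmM; [exact: bm_cst|exact: bmX].
  have bq : bmfun S q by exact: bm_sum.
  have Eq : kde_mean b s q <= 2^-1.
    have -> : kde_mean b s q = \sum_(i < d) kde_mean b s
        (fun x : 'rV[R]_d => (v i)^-1 * (x ord0 i - s ord0 i) ^+ 2).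
      rewrite /q; elim: (index_enum _) => [|i l IH].
        rewrite big_nil -[RHS](dirichlet_mean_cst d_gt0 0 uv).
        by congr dirichlet_mean; apply/funext => x; rewrite big_nil.
      rewrite big_cons -IH /kde_mean -(dirichlet_meanD uv (bi i) (bm_sum _ bi)).
      by congr dirichlet_mean; apply/funext => x; rewrite big_cons.
    apply: (@le_trans _ _ (\sum_(i < d) (2 * d%:R)^-1)); last first.
      rewrite sumr_const card_ord -[leLHS]mulr_natr invfM -mulrA mulVf ?mulr1//.
      by rewrite gt_eqF.
    apply: ler_sum => i _; rewrite /kde_mean dirichlet_meanZ//; last exact: bmX.
    have := kde_second_le i; rewrite -/(kde_mean _ _ _) => h.
    rewrite mulrC ler_pdivrMr//; apply: (le_trans h).
    rewrite /v le_eqVlt; apply/orP; left; apply/eqP; field; rewrite gt_eqF//.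
  have h : kde_mean b s (fun x => 1 - q x) <= kde_mean b s w.
    apply: dirichlet_mean_le => //; first by apply: bmB => //; exact: bm_cst.
    move=> x Sx; rewrite /w indicE; case: (boolP (x \in B)) => xB.
      by rewrite gerBl /q sumr_ge0// => i _; rewrite mulr_ge0 ?sqr_ge0// invr_ge0 ltW.
    rewrite subr_le0; move: xB => /negP; rewrite inE => /existsNP[i /negP xi].
    rewrite /q (bigD1 i)//= (@le_trans _ _ ((v i)^-1 * (x ord0 i - s ord0 i) ^+ 2))//.
      rewrite mulrC ler_pdivlMr// mul1r -(@sqr_sqrtr _ (v i)) ?(ltW (v0 i))// -/(r i).
      rewrite -[leRHS]real_normK ?num_real// ler_pXn2r ?nnegrE ?sqrtr_ge0//.
      move: xi; rewrite negb_and -!ltNge => /orP[h|h].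
        by rewrite ler0_norm; have := sqrtr_ge0 (v i); rewrite -/(r i); lra.
      by rewrite ger0_norm; have := sqrtr_ge0 (v i); rewrite -/(r i); lra.
    by rewrite lerDl sumr_ge0// => j _; rewrite mulr_ge0 ?sqr_ge0// invr_ge0 ltW.
  apply: le_trans h; rewrite /kde_mean (dirichlet_meanD uv (bm_cst _ _) (bmN bq)).
  rewrite (dirichlet_mean_cst d_gt0 _ uv).
  have -> : dirichlet_mean (kde_shape b s) (kde_last b s) (fun x => - q x) = - kde_mean b s q.
    rewrite -mulN1r -(dirichlet_meanZ _ uv bq); congr dirichlet_mean.
    by apply/funext => x; rewrite mulN1r.
  by move: (kde_mean _ _ _) Eq => e; lra.
(* Cauchy-Schwarz in the form K ^+ 2 >= 2 a K - a ^+ 2, at the optimal a. *)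
pose a := (2 * kde_box_volume)^-1.
have a0 : 0 < a by rewrite invr_gt0 mulr_gt0.
have iS h : bmfun S h -> leb.-integrable S (EFin \o h).
  exact: bm_integrable_simplex.
have key : 2 * a * kde_mean b s w - a ^+ 2 * \int[leb]_(x in S) w x <=
    kde_mean b s (kde_kernel b s).
  have mS := @measurable_simplex R d.
  rewrite /kde_mean /dirichlet_mean -/(kde_kernel b s).
  rewrite -(RintegralZl _ mS (iS _ (bmM bK bw))) -(RintegralZl _ mS (iS _ bw)).
  have b1' := bmM (bm_cst S (2 * a)) (bmM bK bw).
  have b2' := bmM (bm_cst S (a ^+ 2)) bw.
  rewrite -(RintegralB mS (iS _ b1') (iS _ b2')).
  apply: (le_Rintegral mS (iS _ (bmB b1' b2')) (iS _ (bmM bK bK))) => x Sx.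
  rewrite /w indicE; case: (_ \in _) => /=; rewrite ?mulr0 ?mulr1 ?subr0 -?expr2 ?sqr_ge0//.
  have := sqr_ge0 (kde_kernel b s x - a); rewrite sqrrB -/(kde_kernel b s x).
  by move: (kde_kernel b s x) => K; lra.
apply: le_trans key.
have wV : \int[leb]_(x in S) w x <= kde_box_volume.
  rewrite /Rintegral /w integral_indic//; last exact: measurable_simplex.
  rewrite -lee_fin fineK; last first.
    rewrite ge0_fin_numE//; apply: le_lt_trans (@simplex_volume_lty R d).
    by apply: le_measure; rewrite ?inE//; [apply: measurableI => //|]; exact: measurable_simplex.
  rewrite -VB; apply: le_measure; rewrite ?inE//.
  by apply: measurableI => //; exact: measurable_simplex.
have -> : (4 * kde_box_volume)^-1 = 2 * a * 2^-1 - a ^+ 2 * kde_box_volume.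
  by rewrite /a; field; rewrite gt_eqF.
apply: lerB; first by rewrite ler_pM2l// mulr_gt0.
by rewrite ler_pM2l// exprn_gt0.
Qed.

End kde_moments.

(** * Hoelder classes and wave densities *)

Section trigo_bounds.
Context {R : realType}.
Implicit Types x y : R.

Lemma lipschitz_of_derive (f df : R -> R) x y :
  (forall x, is_derive x 1 f (df x)) -> (forall x, `|df x| <= 1) ->
  `|f x - f y| <= `|x - y|.
Proof.
move=> fd df1; wlog xy : x y / x <= y => [h|].
  by have [/h//|/ltW/h] := leP x y; rewrite distrC [in X in _ <= X]distrC.
have cf : {within `[x, y], continuous f}.
  apply: continuous_subspaceT => z; apply: differentiable_continuous.
  by apply/derivable1_diffP; have [] := fd z.
have [c _ E] := MVT_segment xy (fun z _ => fd z) cf.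
by rewrite distrC E normrM [leRHS]distrC ler_piMl.
Qed.

Lemma cos_lipschitz x y : `|cos x - cos y| <= `|x - y|.
Proof.
apply: (@lipschitz_of_derive _ (fun x => - sin x)) => z.
by rewrite normrN sin_max.
Qed.

Lemma sin_lipschitz x y : `|sin x - sin y| <= `|x - y|.
Proof. by apply: (@lipschitz_of_derive _ cos) => z; exact: cos_max. Qed.

Lemma sin_ge_half x : 0 <= x -> x <= 2^-1 -> x / 2 <= sin x.
Proof.
move=> x0 x1; have cs : {within `[0, x], continuous sin}.
  apply: continuous_subspaceT => z; apply: differentiable_continuous.
  by apply/derivable1_diffP; have [] := is_derive_sin z.
have [c] := MVT_segment x0 (fun z _ => is_derive_sin z) cs.
rewrite in_itv/= => /andP[c0 cx]; rewrite sin0 !subr0 => ->.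
rewrite mulrC ler_wpM2r//.
have := cos_lipschitz 0 c; rewrite cos0 sub0r normrN (ger0_norm c0) => h.
have := ler_norm (1 - cos c); lra.
Qed.

(** The quartic correction makes the bound hold for all y, so that it can be
    averaged under the kernel without truncation. *)
Lemma one_minus_cos_ge y : (y ^+ 2 - y ^+ 4) / 8 <= 1 - cos y.
Proof.
wlog y0 : y / 0 <= y => [h|].
  have [/h//|/ltW y0] := leP 0 y.
  have := h (- y); rewrite oppr_ge0 cosN sqrrN (_ : (- y) ^+ 4 = y ^+ 4); last by ring.
  exact.
have [y1|y1] := leP y 1; last first.
  apply: (@le_trans _ _ 0); last by rewrite subr_ge0; exact: cos_le1.
  rewrite pmulr_lle0// subr_le0 ler_eXn2l//; lra.
have -> : cos y = 1 - 2 * sin (y / 2) ^+ 2.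
  rewrite [in LHS](_ : y = y / 2 + y / 2); last by lra.
  by rewrite cosD -!expr2 cos2sin2; ring.
have := @sin_ge_half (y / 2) ltac:(lra) ltac:(lra) => h.
have h2 : (y / 2 / 2) ^+ 2 <= sin (y / 2) ^+ 2.
  by rewrite ler_pXn2r ?nnegrE//; lra.
have y4 : 0 <= y ^+ 4 by exact: exprn_ge0.
have E : (y / 2 / 2) ^+ 2 = y ^+ 2 / 16 by field.
lra.
Qed.

End trigo_bounds.

Section holder_class_char.
Context {R : realType} {d : nat}.
Implicit Types (f : 'rV[R]_d -> R) (beta L : R).
Local Notation e_ i := (delta_mx ord0 i : 'rV[R]_d).

Lemma holder_orderE (beta : R) (m : nat) : m%:R < beta <= m.+1%:R ->
  holder_order beta = m.
Proof.
move=> /andP[mb bm]; rewrite /holder_order.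
have ubm : ubound [set l : nat | l%:R < beta] m.
  by move=> l /= lb; have := lt_le_trans lb bm; rewrite ltr_nat ltnS.
have ne : supremums [set l : nat | l%:R < beta] !=set0.
  by apply: nat_supremums_neq0; exists m.
apply/eqP; rewrite eq_le; apply/andP; split; last exact: ge_supremum_Nmem.
rewrite /supremum; case: ifPn => // _.
have [x Hx] := ne; rewrite (@xget_subset1 _ 0%N _ x Hx (@is_subset1_supremums _ _ _)).
by case: Hx => _; exact.
Qed.

Lemma multi_index_seq0 : multi_index_seq (fun=> 0%N : nat) = [::] :> seq 'I_d.
Proof. by rewrite /multi_index_seq; elim: (enum _). Qed.

Lemma multi_index_seq1 i :
  multi_index_seq (fun j : 'I_d => (j == i : nat)) = [:: i].
Proof.
rewrite /multi_index_seq.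
have : i \in enum 'I_d by rewrite mem_enum.
have : uniq (enum 'I_d) by exact: enum_uniq.
elim: (enum _) => //= j l IH /andP[jl ul]; rewrite inE.
have [ji _|ij /= il] := eqVneq i j.
  rewrite -{}ji in jl *.
  rewrite (_ : flatten _ = [::])//.
  elim: l jl {IH ul} => //= k l IH; rewrite inE negb_or => /andP[ik il].
  by rewrite [k == _]eq_sym (negbTE ik)/= IH.
exact: IH.
Qed.

Lemma sum_nat_eq1 (gamma : 'I_d -> nat) : (\sum_(i < d) gamma i = 1)%N ->
  exists i, gamma = fun j => (j == i : nat).
Proof.
move=> g1; have [i gi] : exists i, gamma i != 0%N.
  apply/existsP; apply: contra_eqT g1; rewrite negb_exists => /forallP h.
  by rewrite big1// => i _; apply/eqP; have := h i; rewrite negbK.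
exists i; apply/funext => j; move: g1; rewrite (bigD1 i)//=.
case gi' : (gamma i) gi => [//|k] _; rewrite addSn => -[] /eqP.
rewrite addn_eq0 => /andP[/eqP k0 /eqP s0].
have [->|ji] := eqVneq j i; first by rewrite gi' k0.
by move: s0; rewrite (bigD1 j)//= => /eqP; rewrite addn_eq0 => /andP[/eqP].
Qed.

Lemma holder_class_le1 beta L f : 0 < beta -> beta <= 1 ->
  holder_class beta L f <->
  (forall s t, (simplex d)° s -> (simplex d)° t ->
     `|f s - f t| <= L * norm1 (s - t) `^ beta).
Proof.
move=> b0 b1; rewrite /holder_class/= (@holder_orderE beta 0) ?b0//.
rewrite subr0; split=> [h|h gamma].
  have [|_] := h (fun=> 0%N); first by rewrite big1.
  by rewrite /multi_derive multi_index_seq0.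
move=> /eqP; rewrite sum_nat_eq0 => /forallP g0.
have -> : gamma = fun=> 0%N by apply/funext => i; apply/eqP; exact: g0.
by rewrite /multi_derive /multi_derivable multi_index_seq0.
Qed.

Lemma holder_class_gt1 beta L f : 1 < beta -> beta <= 2 ->
  holder_class beta L f <->
  (forall i, (forall s, (simplex d)° s -> derivable f s (e_ i)) /\
    (forall s t, (simplex d)° s -> (simplex d)° t ->
     `|'D_(e_ i) f s - 'D_(e_ i) f t| <= L * norm1 (s - t) `^ (beta - 1))).
Proof.
move=> b1 b2; rewrite /holder_class/= (@holder_orderE beta 1) ?b1//.
split=> [h i|h gamma].
  have [|] := h (fun j => (j == i : nat)).
    by rewrite (bigD1 i)//= eqxx big1 ?addn0// => j /negbTE ->.
  by rewrite /multi_derive /multi_derivable multi_index_seq1 /= => -[_].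
move=> /sum_nat_eq1[i ->].
by rewrite /multi_derive /multi_derivable multi_index_seq1 /=; have [? ?] := h i.
Qed.

Let line_quotient f s (v : 'rV[R]_d) (t : R) :
  (fun h : R => h^-1 *: ((f \o shift (t *: v + s)) (h *: v) - f (t *: v + s))) =
  (fun h : R => h^-1 *: (((fun u : R => f (u *: v + s)) \o shift t) (h *: 1) - f (t *: v + s))).
Proof.
apply/funext => h; rewrite /shift/=.
have -> : h *: 1 = h :> R by rewrite -[LHS]/(h * 1) mulr1.
by rewrite scalerDl addrA.
Qed.

(** Partial derivatives are derivatives along a line, hence accessible to the
    one-variable mean value theorem. *)
Lemma derive_line f s (v : 'rV[R]_d) (t : R) :
  'D_v f (t *: v + s) = 'D_1 (fun u : R => f (u *: v + s)) t.
Proof. by rewrite /derive line_quotient. Qed.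

Lemma derivable_line f s (v : 'rV[R]_d) (t : R) :
  derivable f (t *: v + s) v <-> derivable (fun u : R => f (u *: v + s)) t 1.
Proof. by rewrite /derivable line_quotient. Qed.

End holder_class_char.

Section wave_density.
Context {R : realType} {d : nat} (d_gt0 : (0 < d)%N).
Local Notation leb := (@lebesgue_row R d).
Local Notation S := (@simplex R d).
Variables (i : 'I_d) (A delta tau : R).

(** A perturbation of the uniform density that oscillates in one coordinate only
    at scale delta. *)
Definition wave (s : 'rV[R]_d) : R := A * cos (s ord0 i / delta + tau).

Definition simplex_volume : R := fine (leb S).

Lemma simplex_volumeE : leb S = simplex_volume%:E.
Proof.
by rewrite fineK// ge0_fin_numE// simplex_volume_lty.
Qed.

Lemma simplex_volume_pos : 0 < simplex_volume.
Proof. by rewrite -lte_fin -simplex_volumeE simplex_volume_gt0. Qed.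

Lemma measurable_wave : measurable_fun setT wave.
Proof.
apply: measurable_funM => //; apply: measurableT_comp.
  by apply: continuous_measurable_fun; exact: continuous_cos.
apply: measurable_funD => //; apply: measurable_funM => //.
exact: measurable_row_coord.
Qed.

Hypothesis A_bound : 0 <= A <= 2^-1.

Lemma wave_le s : `|wave s| <= 2^-1.
Proof.
case/andP: A_bound => A0 A1; rewrite normrM ger0_norm//.
by rewrite (le_trans _ A1)// ler_piMr// cos_max.
Qed.

Lemma bm_wave1 : bmfun S (fun s => 1 + wave s).
Proof.
apply: bmD; first exact: bm_cst.
split; first by apply: measurable_funTS; exact: measurable_wave.
by exists 2^-1 => s _; exact: wave_le.
Qed.

(** The normalising constant is bounded above and below independently of delta and
    tau, since the wave has amplitude at most 1/2. *)
Lemma exists_wave_density : exists (f : simplex_density R d) (c : R),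
  [/\ 2 / 3 <= c, c <= 2 / simplex_volume & forall s, f s = c * (1 + wave s)].
Proof.
have V0 := simplex_volume_pos; have mS := @measurable_simplex R d.
have V1 : simplex_volume <= 1 by rewrite -lee_fin -simplex_volumeE simplex_volume_le1.
have iw := bm_integrable_simplex bm_wave1.
have ic (c : R) := bm_integrable_simplex (bm_cst S c).
pose I := \int[leb]_(s in S) (1 + wave s).
have wb s : 2^-1 <= 1 + wave s <= 3 / 2.
  by have := wave_le s; rewrite ler_norml => /andP[? ?]; apply/andP; split; lra.
have I1 : simplex_volume / 2 <= I.
  have := le_Rintegral mS (ic 2^-1) iw (fun s _ => (andP (wb s)).1).
  by rewrite Rintegral_cst// mulrC.
have I2 : I <= 3 / 2 * simplex_volume.
  have := le_Rintegral mS iw (ic (3 / 2)) (fun s _ => (andP (wb s)).2).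
  by rewrite Rintegral_cst.
have I0 : 0 < I by lra.
have mf : measurable_fun S (fun s => I^-1 * (1 + wave s)).
  by apply: measurable_funM => //; have [] := bm_wave1.
have f0 s : S s -> 0 <= I^-1 * (1 + wave s).
  by move=> _; rewrite mulr_ge0 ?invr_ge0 ?(ltW I0)//; case/andP: (wb s); lra.
have f1 : (\int[leb]_(s in S) (I^-1 * (1 + wave s))%:E = 1)%E.
  under eq_integral do rewrite EFinM.
  rewrite integralZl// -[X in (_ * X)%E]fineK; last exact: integrable_fin_num.
  by rewrite -[fine _]/I -EFinM mulVf// gt_eqF.
exists (SimplexDensity mf f0 f1), I^-1; split => //.
  by rewrite -[leLHS]invf_div lef_pV2 ?posrE//; lra.
by rewrite -[leRHS]invf_div lef_pV2 ?posrE// divr_gt0.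
Qed.

Lemma norm1_coord (s t : 'rV[R]_d) : `|s ord0 i - t ord0 i| <= norm1 (s - t).
Proof. by rewrite /norm1 (bigD1 i)//= !mxE lerDl sumr_ge0. Qed.

Lemma le_two_powR (x r theta : R) : 0 <= theta <= 1 -> 0 <= r -> x <= r ->
  x <= 2 -> x <= 2 * r `^ theta.
Proof.
move=> /andP[t0 t1] r0 xr x2; have [r1|r1] := leP r 1.
  move: r0; rewrite le_eqVlt => /predU1P[r00|r0].
    by rewrite (le_trans xr)// -r00 mulr_ge0// powR_ge0.
  rewrite (le_trans xr)// (@le_trans _ _ (r `^ theta))//.
    by apply: ger1_powR => //; rewrite r0.
  by rewrite ler_peMl ?powR_ge0//; lra.
rewrite (le_trans x2)// ler_peMr// -[leLHS](powRr0 r) ler_powR//.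
exact: ltW.
Qed.

(** Interpolation: phi is both bounded and Lipschitz, so at scale delta it is
    Hoelder of any exponent theta in [0, 1], with constant of order
    delta ^ (- theta). *)
Lemma wave_holder (phi : R -> R) (c L theta : R) (s t : 'rV[R]_d) :
  (forall x y, `|phi x - phi y| <= `|x - y|) -> (forall x, `|phi x| <= 1) ->
  0 < delta -> 0 <= c -> 0 <= theta <= 1 -> 0 <= L ->
  2 * c <= L * delta `^ theta ->
  `|c * phi (s ord0 i / delta + tau) - c * phi (t ord0 i / delta + tau)| <=
  L * norm1 (s - t) `^ theta.
Proof.
move=> lip bd de0 c0 t01 L0 cL.
pose r := `|s ord0 i - t ord0 i| / delta.
have r0 : 0 <= r by rewrite divr_ge0// ltW.
rewrite -mulrBr normrM (ger0_norm c0).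
apply: (@le_trans _ _ (c * (2 * r `^ theta))).
  rewrite ler_wpM2l// le_two_powR//.
    apply: (le_trans (lip _ _)).
    rewrite opprD addrACA subrr addr0 -mulrBl normrM normfV.
    by rewrite (gtr0_norm de0).
  by rewrite (le_trans (ler_normB _ _))// -[leRHS]/(1 + 1) lerD.
rewrite mulrA [c * 2]mulrC (@le_trans _ _ (L * delta `^ theta * r `^ theta))//.
  by rewrite ler_wpM2r// powR_ge0.
rewrite -mulrA -powRM ?(ltW de0)// ler_wpM2l//.
have /andP[t0 _] := t01; apply: ge0_ler_powR => //; rewrite ?nnegrE.
- by rewrite mulr_ge0// ltW.
- by rewrite /norm1 sumr_ge0.
- by rewrite /r mulrC divfK ?gt_eqF// norm1_coord.
Qed.

Lemma wave_is_derive (c : R) (s : 'rV[R]_d) j :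
  is_derive s (delta_mx ord0 j : 'rV[R]_d) (fun s => c * (1 + wave s))
    (if j == i then - (c * A / delta) * sin (s ord0 i / delta + tau) else 0).
Proof.
have E (u : R) : c * (1 + wave (u *: (delta_mx ord0 j : 'rV[R]_d) + s)) =
    c * (1 + A * cos ((u * (j == i)%:R + s ord0 i) / delta + tau)).
  by rewrite /wave !mxE eqxx/= eq_sym.
have H : is_derive (0 : R) 1
    (fun u : R => c * (1 + A * cos ((u * (j == i)%:R + s ord0 i) / delta + tau)))
    (if j == i then - (c * A / delta) * sin (s ord0 i / delta + tau) else 0).
  apply: is_derive_eq; rewrite mul0r add0r.
  rewrite /GRing.scale/=; case: (j == i) => /=; rewrite ?(add0r (s ord0 i)); ring.
have s0 : s = 0 *: (delta_mx ord0 j : 'rV[R]_d) + s by rewrite scale0r add0r.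
split.
  rewrite s0 derivable_line; under eq_fun do rewrite E.
  by have [] := H.
rewrite [in LHS]s0 derive_line; under eq_fun do rewrite E.
by have [_] := H.
Qed.

End wave_density.

(** * The bias of the Dirichlet estimator *)

Section max_risk_lower.
Context {R : realType} {d : nat} (d_gt0 : (0 < d)%N).
Local Notation leb := (@lebesgue_row R d).
Local Notation S := (@simplex R d).
Variables (p beta L : R).
Hypotheses (p_gt0 : 0 < p) (beta_gt0 : 0 < beta) (beta_le2 : beta <= 2)
  (L_gt0 : 0 < L).

(** The amplitude A may be of order delta ^ beta: the wave itself is used when
    beta <= 1, and its derivative, of amplitude A / delta, when 1 < beta. *)
Lemma wave_class (i : 'I_d) (A delta tau c : R) (f : 'rV[R]_d -> R) :
  (forall s, f s = c * (1 + wave i A delta tau s)) -> 0 < delta -> 0 <= A ->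
  0 <= c -> 2 * (c * A) <= L * delta `^ beta -> holder_class beta L f.
Proof.
move=> fE de0 A0 c0 h; have cA : 0 <= c * A by rewrite mulr_ge0.
have := beta_gt0; have := beta_le2; have := L_gt0 => L0 b2 b0.
have [b1|b1] := leP beta 1.
  apply/(holder_class_le1 L f b0 b1) => s t _ _; rewrite !fE.
  rewrite (_ : _ - _ = c * A * cos (s ord0 i / delta + tau) -
                       c * A * cos (t ord0 i / delta + tau)); last first.
    by rewrite /wave; ring.
  apply: wave_holder => //; [exact: cos_lipschitz|exact: cos_max| |].
    by rewrite (ltW b0).
  exact: ltW.
apply/(holder_class_gt1 L f b1 b2) => j.
have -> : f = fun s => c * (1 + wave i A delta tau s) by apply/funext.
have dw s := wave_is_derive i A delta tau c s j.
split=> [s _|s t _ _]; first by have [] := dw s.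
have [_ ->] := dw s; have [_ ->] := dw t.
case: (j == i); last by rewrite subrr normr0 mulr_ge0 ?powR_ge0 ?(ltW L0).
rewrite !mulNr -opprD normrN.
rewrite -[_ - _]/(c * A / delta * sin (s ord0 i / delta + tau) -
  c * A / delta * sin (t ord0 i / delta + tau)).
apply: wave_holder => //; [exact: sin_lipschitz|exact: sin_max| | | |].
- by rewrite divr_ge0// ltW.
- by apply/andP; split; lra.
- exact: ltW.
rewrite mulrA ler_pdivrMr// (le_trans h)//.
by rewrite -mulrA ler_wpM2l ?(ltW L0)// mulrC mulr_powRB1// ltW.
Qed.

Section loss_bound.
Variables (n : nat) (T : n.-tuple 'rV[R]_d -> 'rV[R]_d -> R).
Hypothesis mT : is_estimator T.
Local Open Scope ereal_scope.

Definition mean_loss (f : simplex_density R d) (s : 'rV[R]_d) : \bar R :=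
  \int[sample_law n f]_X (`|T X s - f s| `^ p)%R%:E.

Lemma mean_loss_ge0 f s : 0 <= mean_loss f s.
Proof. by apply: integral_ge0 => X _; rewrite lee_fin powR_ge0. Qed.

(** The supremum is over a nonempty class: it contains the uniform density. *)
Lemma max_risk_ge0 : 0 <= max_risk p beta L T.
Proof.
have i : 'I_d by exact: Ordinal d_gt0.
have h0 : (0 <= (0:R) <= 2^-1)%R by lra.
have [f [c [c1 c2 fE]]] := @exists_wave_density R d d_gt0 i 0 1 0 h0.
apply: (@le_trans _ _ (risk p T f)); first exact: poweR_ge0.
apply: ereal_sup_ubound; exists f => //=.
apply: wave_class fE _ _ _ _ => //; first by lra.
by rewrite mulr0 mulr0 mulr_ge0 ?powR_ge0 ?(ltW L_gt0).
Qed.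

Lemma max_risk_mean_loss (f : simplex_density R d) (D : set 'rV[R]_d) :
  holder_class beta L f -> measurable D -> D `<=` S ->
  \int[leb]_(s in D) mean_loss f s <= max_risk p beta L T `^ p.
Proof.
move=> fL mD DS; apply: (@le_trans _ _ (risk p T f `^ p)); last first.
  apply: ge0_poweR_le; [exact: ltW|exact: poweR_ge0|].
  by apply: ereal_sup_ubound; exists f.
have p0 := p_gt0.
have mm := @measurable_mean_loss R d n T f p mT.
have mS := @measurable_simplex R d.
rewrite risk_tonelli// -poweRrM mulVf ?gt_eqF// poweRe1; last first.
  by apply: integral_ge0 => s _; exact: mean_loss_ge0.
by apply: ge0_subset_integral => // s _; exact: mean_loss_ge0.
Qed.

Lemma max_risk_ge (c : R) : (0 <= c)%R -> c%:E <= max_risk p beta L T `^ p ->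
  (c `^ p^-1)%R%:E <= max_risk p beta L T.
Proof.
move=> c0 h; have M0 := max_risk_ge0; have p0 := p_gt0.
rewrite -[leRHS]poweRe1// -(mulfV (lt0r_neq0 p0)) poweRrM -poweR_EFin.
by apply: ge0_poweR_le => //; rewrite invr_ge0 ltW.
Qed.

End loss_bound.

Section bias.
Variables (n : nat) (b : R).
Hypotheses (n_gt0 : (0 < n)%N) (b01 : 0 < b < 1) (p_ge1 : 1 <= p).
Local Notation T := (@dirichlet_kde R d n b).
Local Notation D1 := (d%:R + 1 : R).

Lemma kde_mean_affine s g (k c : R) : S s -> bmfun S g ->
  kde_mean b s (fun x => k * g x + c) = k * kde_mean b s g + c.
Proof.
case/andP: b01 => b0 b1 Ss bg; have uv := kde_param b0 Ss.
rewrite /kde_mean dirichlet_meanD//; last exact: bm_cst.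
  by rewrite dirichlet_meanZ// (dirichlet_mean_cst d_gt0 _ uv).
by apply: bmM => //; exact: bm_cst.
Qed.

Lemma bm_fun_coord (i : 'I_d) (phi : R -> R) : measurable_fun setT phi ->
  (forall x, `|phi x| <= 1) -> bmfun S (fun x : 'rV[R]_d => phi (x ord0 i)).
Proof.
move=> mphi phi1; split; last by exists 1 => x _.
apply: measurable_funTS; apply: (measurableT_comp mphi).
exact: measurable_row_coord.
Qed.

(** One of the two phases must have a large bias: with th = s_i / delta, the
    weights cos th and sin th combine the biases into the kernel mean of
    1 - cos (x_i / delta - th), which the second and the fourth central moments
    bound below. *)
Lemma kde_oscillation (i : 'I_d) (delta : R) s : 0 < delta -> S s ->
  b / delta ^+ 2 * (s ord0 i * (1 - s ord0 i)) / ((1 + D1) * (2 + D1)) / 8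
    - fourth_moment_const D1 * b ^+ 2 / delta ^+ 4 / 8 <=
  `|kde_mean b s (fun x => cos (x ord0 i / delta)) - cos (s ord0 i / delta)| +
  `|kde_mean b s (fun x => sin (x ord0 i / delta)) - sin (s ord0 i / delta)|.
Proof.
move=> de0 Ss; have /andP[b0 b1] := b01; have uv := kde_param b0 Ss.
have mdiv : measurable_fun setT (fun x : R => x / delta) by exact: measurable_funM.
have bC : bmfun S (fun x : 'rV[R]_d => cos (x ord0 i / delta)).
  apply: (@bm_fun_coord i (fun x => cos (x / delta))) => [|x]; last exact: cos_max.
  apply: measurableT_comp => //.
  by apply: continuous_measurable_fun; exact: continuous_cos.
have bS : bmfun S (fun x : 'rV[R]_d => sin (x ord0 i / delta)).
  apply: (@bm_fun_coord i (fun x => sin (x / delta))) => [|x]; last exact: sin_max.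
  apply: measurableT_comp => //.
  by apply: continuous_measurable_fun; exact: continuous_sin.
set th := s ord0 i / delta.
have bY : bmfun S (fun x : 'rV[R]_d => x ord0 i - s ord0 i).
  by apply: bmB; [exact: bm_coord|exact: bm_cst].
pose c2 := (8 * delta ^+ 2)^-1; pose c4 := (8 * delta ^+ 4)^-1.
pose low (x : 'rV[R]_d) := c2 * (x ord0 i - s ord0 i) ^+ 2 +
   (- c4) * (x ord0 i - s ord0 i) ^+ 4.
pose up (x : 'rV[R]_d) := (- cos th) * cos (x ord0 i / delta) +
   ((- sin th) * sin (x ord0 i / delta) + 1).
have bl2 : bmfun S (fun x => c2 * (x ord0 i - s ord0 i) ^+ 2).
  by apply: bmM; [exact: bm_cst|exact: bmX].
have bl4 : bmfun S (fun x => - c4 * (x ord0 i - s ord0 i) ^+ 4).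
  by apply: bmM; [exact: bm_cst|exact: bmX].
have bu1 : bmfun S (fun x => - cos th * cos (x ord0 i / delta)).
  by apply: bmM => //; exact: bm_cst.
have bu2 : bmfun S (fun x => - sin th * sin (x ord0 i / delta) + 1).
  by apply: bmD; [apply: bmM => //|]; exact: bm_cst.
have lu : kde_mean b s low <= kde_mean b s up.
  apply: dirichlet_mean_le => //; [exact: bmD|exact: bmD|].
  move=> x Sx; have := one_minus_cos_ge (x ord0 i / delta - th).
  rewrite cosB => h; rewrite /up.
  have -> : low x = ((x ord0 i / delta - th) ^+ 2 - (x ord0 i / delta - th) ^+ 4) / 8.
    by rewrite /low /c2 /c4 /th; field; rewrite gt_eqF.
  by apply: (le_trans h); rewrite le_eqVlt; apply/orP; left; apply/eqP; ring.
have Elow : b / delta ^+ 2 * (s ord0 i * (1 - s ord0 i)) / ((1 + D1) * (2 + D1)) / 8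
    - fourth_moment_const D1 * b ^+ 2 / delta ^+ 4 / 8 <= kde_mean b s low.
  rewrite /kde_mean dirichlet_meanD// !dirichlet_meanZ//; [|exact: bmX|exact: bmX].
  rewrite -!/(kde_mean b s _).
  have hyp : [/\ 0 < b, b < 1 & S s] by [].
  have h2 := kde_second_ge d_gt0 hyp i; have h4 := kde_fourth_le d_gt0 hyp i.
  have c20 : 0 <= c2 by rewrite invr_ge0 mulr_ge0// exprn_ge0// ltW.
  have c40 : 0 <= c4 by rewrite invr_ge0 mulr_ge0// exprn_ge0// ltW.
  have := ler_wpM2l c20 h2; have := ler_wpM2l c40 h4.
  move: (kde_mean _ _ _) (kde_mean _ _ _) => e4 e2 {}h4 {}h2.
  have d0 : 0 <= d%:R :> R by [].
  have -> : b / delta ^+ 2 * (s ord0 i * (1 - s ord0 i)) / ((1 + D1) * (2 + D1)) / 8 =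
     c2 * (b * (s ord0 i * (1 - s ord0 i)) / ((1 + D1) * (2 + D1))).
    by rewrite /c2; field; rewrite !gt_eqF//; lra.
  have -> : fourth_moment_const D1 * b ^+ 2 / delta ^+ 4 / 8 =
     c4 * (fourth_moment_const D1 * b ^+ 2).
    by rewrite /c4; move: (fourth_moment_const _) => q; field; rewrite gt_eqF.
  by rewrite mulNr; lra.
apply: (le_trans Elow); apply: (le_trans lu).
rewrite /kde_mean dirichlet_meanD// dirichlet_meanZ//.
rewrite -!/(kde_mean b s _) kde_mean_affine//.
move: (kde_mean _ _ _) (kde_mean _ _ _) => ES EC.
have -> : - cos th * EC + (- sin th * ES + 1) =
   cos th * (cos th - EC) + sin th * (sin th - ES).
  by have := cos2Dsin2 th; move: (cos th) (sin th) => x y xy; rewrite -[1]xy; ring.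
apply: lerD; rewrite (le_trans (ler_norm _))// normrM distrC ler_piMl//.
  exact: cos_max.
exact: sin_max.
Qed.

End bias.

End max_risk_lower.

Section bias_lower.
Context {R : realType} {d : nat} (d_gt0 : (0 < d)%N).
Local Notation leb := (@lebesgue_row R d).
Local Notation S := (@simplex R d).
Variables (p beta L : R).
Hypotheses (p_ge1 : 1 <= p) (beta_gt0 : 0 < beta) (beta_le2 : beta <= 2)
  (L_gt0 : 0 < L).
Local Notation D1 := (d%:R + 1 : R).

Let dR : 0 < d%:R :> R. Proof. by rewrite ltr0n. Qed.
Let p_gt0 : 0 < p. Proof. exact: lt_le_trans ltr01 p_ge1. Qed.

Let Q : set 'rV[R]_d :=
  [set v | forall j, (4 * d%:R)^-1 <= v ord0 j <= (2 * d%:R)^-1].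

Let QS : Q `<=` S.
Proof.
have d0 := dR; apply: (cube_sub_simplex d_gt0).
  by rewrite invr_ge0 mulr_ge0// ltW.
by rewrite lef_pV2 ?posrE ?mulr_gt0//; lra.
Qed.

Let mQ : measurable Q. Proof. exact: measurable_cube. Qed.

Let VQ : R := \prod_(j < d) ((2 * d%:R)^-1 - (4 * d%:R)^-1).

Let VQ_gt0 : 0 < VQ.
Proof.
apply: prodr_gt0 => j _; rewrite subr_gt0 ltf_pV2 ?posrE ?mulr_gt0//.
by rewrite ltr_pM2r//; lra.
Qed.

Let QE : leb Q = VQ%:E.
Proof.
apply: (@lebesgue_row_cube R d (fun=> (4 * d%:R)^-1) (fun=> (2 * d%:R)^-1)).
by move=> j; rewrite lef_pV2 ?posrE ?mulr_gt0// ler_pM2r//; lra.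
Qed.

Let c1 : R := (8 * d%:R)^-1 / ((1 + D1) * (2 + D1)) / 8.
Let c4 : R := fourth_moment_const D1 / 8.

Let c1_gt0 : 0 < c1.
Proof.
have := dR => d0; apply: divr_gt0 => //; apply: divr_gt0.
  by rewrite invr_gt0 mulr_gt0.
by apply: mulr_gt0; lra.
Qed.

Let c4_gt0 : 0 < c4.
Proof.
have d0 : 0 <= D1 by have := dR; lra.
rewrite divr_gt0// /fourth_moment_const.
have := exprn_ge0 2 d0; have := exprn_ge0 3 d0; have := exprn_ge0 4 d0.
move: D1 d0 => x x0 x2 x3 x4; lra.
Qed.

Let q := 2 * c4 / c1.
Let kappa := c1 ^+ 2 / (4 * c4).

Let q_gt0 : 0 < q. Proof. by rewrite divr_gt0// mulr_gt0. Qed.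
Let kappa_gt0 : 0 < kappa.
Proof. by apply: divr_gt0; [exact: exprn_gt0|exact: mulr_gt0]. Qed.

(** The constant q in delta ^+ 2 = q b is chosen so that the fourth moment term is
    half of the second moment term. *)
Lemma kde_oscillation_cube (i : 'I_d) b delta s : 0 < b < 1 -> Q s ->
  0 < delta -> delta ^+ 2 = q * b ->
  kappa <=
  `|kde_mean b s (fun x => cos (x ord0 i / delta)) - cos (s ord0 i / delta)| +
  `|kde_mean b s (fun x => sin (x ord0 i / delta)) - sin (s ord0 i / delta)|.
Proof.
move=> b01 Qs de0 d2; have /andP[b0 b1] := b01.
have d4 : delta ^+ 4 = (q * b) ^+ 2 by rewrite -d2 -exprM.
apply: le_trans (kde_oscillation d_gt0 b01 i de0 (QS Qs)).
rewrite d2 d4.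
have := Qs i; have := dR => d0 /andP[s1 s2].
have s3 : s ord0 i <= 2^-1.
  apply: (le_trans s2); rewrite lef_pV2 ?posrE ?mulr_gt0// ler_peMr//.
  by rewrite ler1n.
have ss : (8 * d%:R)^-1 <= s ord0 i * (1 - s ord0 i).
  rewrite (_ : 8 * d%:R = 4 * d%:R * 2); last by ring.
  have h4 : 0 <= (4 * d%:R : R)^-1 by rewrite invr_ge0 mulr_ge0// ltW.
  have h2 : 0 <= (2 : R)^-1 by rewrite invr_ge0.
  have s4 : 2^-1 <= 1 - s ord0 i by lra.
  by rewrite invfM; exact: (ler_pM h4 h2 s1 s4).
have E4 : fourth_moment_const D1 * b ^+ 2 / (q * b) ^+ 2 / 8 = c4 / q ^+ 2.
  by rewrite /c4; move: (fourth_moment_const _) (q) q_gt0 => m z z0; field; rewrite !gt_eqF.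
rewrite E4.
have E2 : b / (q * b) = q^-1 by move: (q) q_gt0 => z z0; field; rewrite !gt_eqF.
rewrite E2.
have -> : kappa = q^-1 * (8 * d%:R)^-1 / ((1 + D1) * (2 + D1)) / 8 - c4 / q ^+ 2.
  rewrite (_ : q^-1 * _ / _ / _ = q^-1 * c1); last by rewrite /c1 !mulrA.
  rewrite /kappa /q; move: (c1) (c4) c1_gt0 c4_gt0 => x y x0 y0.
  by field; rewrite !gt_eqF.
apply: lerB => //; apply: ler_wpM2r => //; apply: ler_wpM2r.
  by rewrite invr_ge0 mulr_ge0//; lra.
by apply: ler_wpM2l => //; rewrite invr_ge0 ltW.
Qed.

Lemma wave_bias (i : 'I_d) (A delta tau k b : R) (f : simplex_density R d) n s :
  (0 < n)%N -> 0 < b < 1 -> 0 <= A <= 2^-1 -> 2 / 3 <= k ->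
  (forall s, f s = k * (1 + wave i A delta tau s)) -> S s ->
  (((A / 3 * `|kde_mean b s (fun x => cos (x ord0 i / delta + tau)) -
      cos (s ord0 i / delta + tau)|) `^ p)%R%:E <=
  mean_loss p (@dirichlet_kde R d n b) f s)%E.
Proof.
move=> n0 b01 A01 k0 fE Ss; have /andP[b0 b1] := b01; have /andP[A0 A1] := A01.
have bf : bmfun S f.
  rewrite (_ : pdf f = fun s => k * (1 + wave i A delta tau s)); last exact/funext.
  by apply: bmM; [exact: bm_cst|exact: bm_wave1].
have bC : bmfun S (fun x : 'rV[R]_d => cos (x ord0 i / delta + tau)).
  apply: (@bm_fun_coord _ _ i (fun x => cos (x / delta + tau))) => [|x]; last exact: cos_max.
  apply: measurableT_comp; last by apply: measurable_funD => //; exact: measurable_funM.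
  by apply: continuous_measurable_fun; exact: continuous_cos.
rewrite /mean_loss; apply: le_trans (kde_bias_le n0 b0 Ss bf p_ge1).
have -> : kde_mean b s f = k * A * kde_mean b s (fun x => cos (x ord0 i / delta + tau)) + k.
  rewrite -(kde_mean_affine d_gt0 b01)//; congr kde_mean.
  by apply/funext => x; rewrite fE /wave; ring.
rewrite fE /wave; move: (kde_mean _ _ _) (cos _) => e w.
rewrite lee_fin ge0_ler_powR ?nnegrE ?mulr_ge0 ?divr_ge0//; first by have := p_ge1; lra.
rewrite (_ : k * A * e + k - k * (1 + A * w) = k * A * (e - w)); last by ring.
rewrite normrM ger0_norm ?mulr_ge0//; last by lra.
rewrite [leRHS]mulrAC ler_wpM2r//.
by have := ler_wpM2r A0 k0; lra.
Qed.

Lemma max_risk_bias_lower : exists2 c, 0 < c & forall n b, (0 < n)%N -> 0 < b < 1 ->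
  ((c * b `^ (beta * p / 2))%:E <=
   max_risk p beta L (@dirichlet_kde R d n b) `^ p)%E.
Proof.
have V0 := simplex_volume_pos d_gt0 (R := R).
have qb2 : 0 < q `^ (beta / 2) by rewrite powR_gt0.
(* The first bound keeps the amplitude below 1/2, the second one keeps the wave
   in the Hoelder class. *)
pose a := Num.min (2 * q `^ (beta / 2))^-1 (L * (@simplex_volume R d) / 4).
have a0 : 0 < a by rewrite lt_min invr_gt0 mulr_gt0//= divr_gt0// mulr_gt0.
pose e := a * q `^ (beta / 2) * kappa / 6.
have e0 : 0 < e by rewrite divr_gt0// mulr_gt0// mulr_gt0.
exists (e `^ p * VQ / 2); first by rewrite divr_gt0// mulr_gt0// powR_gt0.
move=> n b n0 b01; have /andP[b0 b1] := b01.
set M := max_risk _ _ _ _.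
pose i := Ordinal d_gt0; pose delta := Num.sqrt (q * b).
have qb : 0 < q * b by rewrite mulr_gt0.
have de0 : 0 < delta by rewrite sqrtr_gt0.
have d2 : delta ^+ 2 = q * b by rewrite sqr_sqrtr// ltW.
have dbeta : delta `^ beta = q `^ (beta / 2) * b `^ (beta / 2).
  rewrite /delta -powR12_sqrt ?(ltW qb)// -powRrM [2^-1 * _]mulrC powRM// ltW//.
pose A := a * delta `^ beta.
have A0 : 0 <= A by rewrite mulr_ge0 ?powR_ge0// ltW.
have b21 : b `^ (beta / 2) <= 1.
  rewrite -[leRHS](powRr0 b); apply: ger_powR; first by rewrite b0 ltW.
  by rewrite divr_ge0// ltW.
have A1 : A <= 2^-1.
  apply: (@le_trans _ _ ((2 * q `^ (beta / 2))^-1 * (q `^ (beta / 2) * 1))).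
    rewrite /A dbeta ler_pM ?mulr_ge0 ?powR_ge0 ?(ltW a0)//.
      by rewrite /a ge_min lexx.
    by rewrite ler_wpM2l// powR_ge0.
  rewrite mulr1 invfM -mulrA mulVf ?mulr1// gt_eqF//.
have A01 : 0 <= A <= 2^-1 by rewrite A0.
have [f0 [k0 [k01 k02 f0E]]] := exists_wave_density d_gt0 i delta 0 A01.
have [f1 [k1 [k11 k12 f1E]]] := exists_wave_density d_gt0 i delta (- (pi / 2)) A01.
have cls k tau (f : simplex_density R d) : 2 / 3 <= k -> k <= 2 / (@simplex_volume R d) ->
    (forall s, f s = k * (1 + wave i A delta tau s)) -> holder_class beta L f.
  move=> k3 kV fE; apply: (wave_class beta_gt0 beta_le2 L_gt0 fE de0 A0); first by lra.
  rewrite /A mulrA mulrA ler_wpM2r ?powR_ge0//.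
  apply: (@le_trans _ _ (2 * (2 / (@simplex_volume R d)) * (L * (@simplex_volume R d) / 4))).
    apply: ler_pM; rewrite ?mulr_ge0 ?(ltW a0)//; try lra.
    by rewrite /a ge_min lexx orbT.
  by rewrite le_eqVlt; apply/orP; left; apply/eqP; field; rewrite gt_eqF.
have mk := @is_estimator_kde R d b n.
pose m f := mean_loss p (@dirichlet_kde R d n b) f.
have m_ge0 f s : (0 <= m f s)%E := mean_loss_ge0 p (@dirichlet_kde R d n b) f s.
have mm f : measurable_fun Q (m f).
  apply: measurable_funS (@measurable_mean_loss R d n _ f p mk) => //.
  exact: measurable_simplex.
have low s : Q s -> (((e * b `^ (beta / 2)) `^ p)%R%:E <= m f0 s + m f1 s)%E.
  move=> Qs; have Ss := QS Qs.
  have := kde_oscillation_cube i b01 Qs de0 d2.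
  have := wave_bias n0 b01 A01 k01 f0E Ss.
  have := wave_bias n0 b01 A01 k11 f1E Ss.
  rewrite !addr0 cosBpihalf.
  have -> : (fun x : 'rV[R]_d => cos (x ord0 i / delta + - (pi / 2))) =
            (fun x => sin (x ord0 i / delta)).
    by apply/funext => x; rewrite cosBpihalf.
  have -> : (fun x : 'rV[R]_d => cos (x ord0 i / delta + 0)) =
            (fun x => cos (x ord0 i / delta)).
    by apply/funext => x; rewrite addr0.
  rewrite -/(m f0 s) -/(m f1 s).
  move: (`|kde_mean _ _ _ - cos _|) (normr_ge0 (kde_mean b s (fun x => cos (x ord0 i / delta)) - cos (s ord0 i / delta))) => u u0.
  move: (`|kde_mean _ _ _ - sin _|) (normr_ge0 (kde_mean b s (fun x => sin (x ord0 i / delta)) - sin (s ord0 i / delta))) => v v0.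
  move=> hv hu uv.
  have eE : e * b `^ (beta / 2) = A / 3 * (kappa / 2).
    rewrite /e /A dbeta.
    by move: (a) (q `^ (beta / 2)) (b `^ (beta / 2)) (kappa) => x y z w; field.
  have big w : 0 <= w -> kappa / 2 <= w -> (e * b `^ (beta / 2)) `^ p <= (A / 3 * w) `^ p.
    move=> w0 kw; have A3 : 0 <= A / 3 by rewrite divr_ge0.
    have k2 : 0 <= kappa / 2 by rewrite divr_ge0// ltW.
    rewrite eE; apply: ge0_ler_powR; rewrite ?nnegrE; first exact: ltW.
    - exact: mulr_ge0.
    - exact: mulr_ge0.
    - exact: ler_wpM2l.
  (* One of the two oscillations is at least kappa / 2. *)
  have [ku|uk] := leP (kappa / 2) u.
    apply: (@le_trans _ _ (m f0 s)); last by rewrite leeDl.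
    by apply: le_trans hu; rewrite lee_fin big.
  apply: (@le_trans _ _ (m f1 s)); last by rewrite leeDr.
  by apply: le_trans hv; rewrite lee_fin big//; lra.
have main : (((e * b `^ (beta / 2)) `^ p * VQ)%:E <= M `^ p + M `^ p)%E.
  rewrite EFinM -QE -integral_cst//.
  apply: (@le_trans _ _ (\int[leb]_(s in Q) (m f0 s + m f1 s))%E).
    apply: ge0_le_integral => //.
    - by move=> s _; rewrite lee_fin powR_ge0.
    - exact: emeasurable_funD.
  rewrite ge0_integralD//; apply: leeD.
    by apply: max_risk_mean_loss => //; exact: cls k01 k02 f0E.
  by apply: max_risk_mean_loss => //; exact: cls k11 k12 f1E.
have -> : e `^ p * VQ / 2 * b `^ (beta * p / 2) = (e * b `^ (beta / 2)) `^ p * VQ / 2.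
  rewrite (powRM p (ltW e0) (powR_ge0 b (beta / 2))) -powRrM.
  rewrite (_ : beta / 2 * p = beta * p / 2); last by ring.
  by move: (e `^ p) (b `^ _) VQ => x y z; ring.
move: (M `^ p)%E main (poweR_ge0 M p) => [x h _|_ _|//]; last exact: leey.
by move: h; rewrite -EFinD !lee_fin ler_pdivrMr//; lra.
Qed.

End bias_lower.

(** * The variance of the Dirichlet estimator *)

Section inverse_integral.
Context {R : realType}.
Local Notation mu := (@lebesgue_measure R).

(** The source of the logarithm. *)
Lemma integral_inv_shift (a b : R) : 0 < a -> 0 < b ->
  (\int[mu]_(x in `[0%R, a]) ((x + b)^-1)%:E = (ln (1 + a / b))%:E)%E.
Proof.
move=> a0 b0.
have dln (x : R) : 0 <= x -> is_derive x 1 (fun y : R => ln (y + b)) (x + b)^-1.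
  move=> x0; have xb : 0 < x + b by rewrite ltr_wpDl.
  have h1 := is_derive1_ln xb.
  have h2 : is_derive x 1 (fun y : R => y + b) 1.
    by apply: is_derive_eq; rewrite addr0.
  have := @is_derive1_comp R (@ln R) (fun y : R => y + b) x _ _ h1 h2.
  by rewrite mulr1.
have cln (x : R) : 0 <= x -> {for x, continuous (fun y : R => ln (y + b))}.
  move=> x0; apply: differentiable_continuous; apply/derivable1_diffP.
  by have [] := dln x x0.
rewrite (@continuous_FTC2 _ _ (fun y : R => ln (y + b)))//.
- rewrite add0r -EFinB -ln_div ?posrE ?addr_gt0//; congr (ln _)%:E.
  by rewrite mulrDl divff ?gt_eqF// addrC.
- apply: continuous_in_subspaceT => x; rewrite inE/= in_itv/= => /andP[x0 _].
  apply: (@cvgV _ R^o); first by rewrite gt_eqF// ltr_wpDl.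
  by apply: cvgD; [exact: cvg_id|exact: cvg_cst].
- split.
  + by move=> x; rewrite in_itv/= => /andP[x0 _]; have [] := dln x (ltW x0).
  + by apply: cvg_at_right_filter; exact: cln.
  + by apply: cvg_at_left_filter; exact: (cln a (ltW a0)).
- move=> x; rewrite in_itv/= => /andP[x0 _]; rewrite derive1E.
  by have [_] := dln x (ltW x0).
Qed.

Lemma powR_prod (I : Type) (l : seq I) (F : I -> R) (r : R) :
  (forall i, 0 <= F i) ->
  (\prod_(i <- l) F i) `^ r = \prod_(i <- l) F i `^ r.
Proof.
move=> F0; elim: l => [|i l IH]; first by rewrite !big_nil powR1.
by rewrite !big_cons powRM ?IH// prodr_ge0.
Qed.

End inverse_integral.

Section variance_lower.
Context {R : realType} {d : nat} (d_gt0 : (0 < d)%N).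
Local Notation leb := (@lebesgue_row R d).
Local Notation S := (@simplex R d).
Variables (p beta L : R).
Hypotheses (p_ge4 : 4 <= p) (beta_gt0 : 0 < beta) (beta_le2 : beta <= 2)
  (L_gt0 : 0 < L).
Local Notation D1 := (d%:R + 1 : R).

Let V := @simplex_volume R d.
Let V_gt0 : 0 < V. Proof. exact: simplex_volume_pos. Qed.

Let dR : 0 < d%:R :> R. Proof. by rewrite ltr0n. Qed.

Let w : R := 2 * d%:R * (2 + D1 * (D1 + 1)).

Let w_gt0 : 0 < w.
Proof.
have d0 := dR; rewrite mulr_gt0// ?mulr_gt0// addr_gt0// mulr_gt0//; lra.
Qed.

Let eta := Num.min 1 (V / 16).
Let eta_gt0 : 0 < eta. Proof. by rewrite lt_min ltr01 divr_gt0. Qed.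

(** Below this bandwidth every box is so small that the integral of the squared
    kernel dominates the square of the mean in the variance. *)
Definition variance_bandwidth : R := (eta / 2) ^+ 2 / (2 * w).

Lemma variance_bandwidth_gt0 : 0 < variance_bandwidth.
Proof. by rewrite divr_gt0 ?exprn_gt0 ?divr_gt0 ?mulr_gt0. Qed.

Let side (b : R) (s : 'rV[R]_d) i := 2 * Num.sqrt (w * b * (s ord0 i + b)).

Let side_gt0 b s i : 0 < b -> S s -> 0 < side b s i.
Proof.
move=> b0 Ss; have := simplex_ge0 i Ss => si.
by rewrite mulr_gt0// sqrtr_gt0 mulr_gt0 ?ltr_wpDl// mulr_gt0.
Qed.

Lemma kde_box_volume_le b s : 0 < b < 1 -> b <= variance_bandwidth -> S s ->
  kde_box_volume b s <= V / 16.
Proof.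
move=> /andP[b0 b1] bb Ss.
have side1 i : 0 <= side b s i <= eta.
  rewrite (ltW (side_gt0 i b0 Ss))/= /side mulrC -ler_pdivlMr//.
  have e2 : 0 <= eta / 2 by rewrite divr_ge0// ltW.
  rewrite -[leRHS]ger0_norm// -sqrtr_sqr ler_wsqrtr//.
  have := simplex_le1 i Ss => si; have := simplex_ge0 i Ss => si0.
  apply: (@le_trans _ _ (w * b * 2)).
    by rewrite ler_wpM2l ?mulr_ge0 ?(ltW w_gt0) ?(ltW b0)//; lra.
  move: bb; rewrite /variance_bandwidth ler_pdivlMr ?mulr_gt0//.
  by apply: le_trans; rewrite le_eqVlt; apply/orP; left; apply/eqP; ring.
rewrite /kde_box_volume -/w (bigD1 (Ordinal d_gt0))//= -!/(side b s _).
apply: (@le_trans _ _ (eta * 1)); last by rewrite mulr1 ge_min lexx orbT.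
apply: ler_pM; [by case/andP: (side1 (Ordinal d_gt0))| |by case/andP: (side1 (Ordinal d_gt0))|].
  by apply: prodr_ge0 => j _; rewrite -/(side b s j); case/andP: (side1 j).
apply: prodr_ile1 => j _; rewrite -/(side b s j); case/andP: (side1 j) => -> /= h.
by rewrite (le_trans h)// ge_min lexx.
Qed.

Let G : R := 2 * (8 * w) `^ (- (p / 4)).

Let G_gt0 : 0 < G. Proof. by rewrite mulr_gt0// powR_gt0// mulr_gt0. Qed.

(** Here 1 <= p / 4 is used: ((s_i + b) / 2) ^ (- p / 4) is at least the inverse of
    (s_i + b) / 2, as this number is at most 1. *)
Lemma side_powR b s i : 0 < b < 1 -> S s ->
  G * b `^ (- (p / 4)) / (s ord0 i + b) <= (side b s i)^-1 `^ (p / 2).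
Proof.
move=> /andP[b0 b1] Ss; have := simplex_le1 i Ss => si; have := simplex_ge0 i Ss => si0.
pose y := (s ord0 i + b) / 2.
have y0 : 0 < y by rewrite divr_gt0// ltr_wpDl.
have wb : 0 < 8 * w * b by rewrite mulr_gt0// mulr_gt0.
have sE : side b s i = (8 * w * b * y) `^ (2^-1).
  rewrite powR12_sqrt; last by rewrite mulr_ge0 ?ltW.
  rewrite /side (_ : 8 * w * b * y = 2 ^+ 2 * (w * b * (s ord0 i + b))); last by rewrite /y; field.
  by rewrite [in RHS]sqrtrM ?exprn_ge0// sqrtr_sqr ger0_norm.
have -> : (side b s i)^-1 `^ (p / 2) = (8 * w * b * y) `^ (- (p / 4)).
  by rewrite sE -powRN -powRrM; congr (_ `^ _); field.
have w8 : 0 < 8 * w by rewrite mulr_gt0.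
rewrite (powRM _ (ltW wb) (ltW y0)) (powRM _ (ltW w8) (ltW b0)).
have h : y^-1 <= y `^ (- (p / 4)).
  rewrite -powR_inv1 ?(ltW y0)//; apply: ger_powR.
    by rewrite y0 /y; lra.
  by have := p_ge4; lra.
have -> : G * b `^ (- (p / 4)) / (s ord0 i + b) =
    (8 * w) `^ (- (p / 4)) * b `^ (- (p / 4)) * y^-1.
  rewrite /G /y invf_div; move: ((8 * w) `^ _) (b `^ _) => u v.
  by rewrite !mulrA; congr (_ / _); ring.
by rewrite ler_wpM2l// mulr_ge0// powR_ge0.
Qed.

Let Q : set 'rV[R]_d := [set v | forall j, 0 <= v ord0 j <= d%:R^-1].

Let QS : Q `<=` S. Proof. exact: cube_sub_simplex. Qed.

Let mQ : measurable Q. Proof. exact: measurable_cube. Qed.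

Let phi (n : nat) (b : R) (s : 'rV[R]_d) : R :=
  (24 `^ (- (p / 2)) * n%:R `^ (- (p / 2))) *
  \prod_(i < d) (G * b `^ (- (p / 4)) / (s ord0 i + b)).

Let phi_ge0 n b s : 0 < b -> Q s -> 0 <= phi n b s.
Proof.
move=> b0 Qs; rewrite mulr_ge0 ?mulr_ge0 ?powR_ge0// prodr_ge0// => i _.
have := simplex_ge0 i (QS Qs) => s0.
by rewrite divr_ge0 ?mulr_ge0 ?powR_ge0 ?(ltW G_gt0) ?addr_ge0// ltW.
Qed.

Lemma uniform_mean_loss_ge n b k (f : simplex_density R d) s : (0 < n)%N ->
  0 < b < 1 -> b <= variance_bandwidth -> 2 / 3 <= k -> k <= 2 / V ->
  (forall s, f s = k) -> Q s ->
  ((phi n b s)%:E <= mean_loss p (@dirichlet_kde R d n b) f s)%E.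
Proof.
move=> n0 b01 bb k0 kV fk Qs; have /andP[b0 b1] := b01.
have Ss := QS Qs; have nR : 0 < n%:R :> R by rewrite ltr0n.
have bf : bmfun S f.
  by rewrite (_ : pdf f = fun=> k); [exact: bm_cst|exact/funext].
have p2 : 2 <= p by have := p_ge4; lra.
apply: le_trans (kde_variance_le d_gt0 n0 b0 Ss bf p2 (fun x _ => fk x)).
have hyp : [/\ 0 < b, b < 1 & S s] by [].
have X0 := kde_box_volume_gt0 d_gt0 hyp.
have XV := kde_box_volume_le b01 bb Ss.
have := kde_kernel_sqr_ge d_gt0 hyp.
have XE : (kde_box_volume b s)^-1 = \prod_(i < d) (side b s i)^-1 by rewrite prodfV.
have XP : 0 < (kde_box_volume b s)^-1 by rewrite invr_gt0.
move: (kde_mean b s _) => EK EKge.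
have hk : 2 * k <= EK.
  apply: le_trans EKge; apply: (@le_trans _ _ (2 * (2 / V))); first by rewrite ler_wpM2l.
  rewrite (_ : 2 * (2 / V) = (4 * (V / 16))^-1); last by field; rewrite gt_eqF.
  by rewrite lef_pV2 ?posrE ?mulr_gt0 ?divr_gt0// ler_wpM2l.
rewrite lee_fin.
apply: (@le_trans _ _ ((24^-1 * n%:R^-1 * (kde_box_volume b s)^-1) `^ (p / 2))); last first.
  have EK0 : 0 <= EK by have := k0; lra.
  have k1 : 0 <= k by lra.
  have hX : 3^-1 * (4 * kde_box_volume b s)^-1 <= k * EK - k ^+ 2.
    apply: (@le_trans _ _ (3^-1 * EK)); first by rewrite ler_wpM2l.
    have h1 : 0 <= (k - 2 / 3) * EK by rewrite mulr_ge0//; lra.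
    have h2 : 0 <= k * (EK - 2 * k) by rewrite mulr_ge0//; lra.
    by rewrite expr2; lra.
  have Y0 : 0 <= 24^-1 * n%:R^-1 * (kde_box_volume b s)^-1.
    by rewrite !mulr_ge0 ?invr_ge0// ltW.
  have YY : 24^-1 * n%:R^-1 * (kde_box_volume b s)^-1 <= n%:R^-1 * (k * EK - k ^+ 2) / 2.
    rewrite (_ : _ * _ * _ = n%:R^-1 * (3^-1 * (4 * kde_box_volume b s)^-1) / 2); last first.
      by field; rewrite !gt_eqF.
    by rewrite ler_wpM2r// ler_wpM2l// invr_ge0 ltW.
  apply: ge0_ler_powR; rewrite ?nnegrE//; first by have := p_ge4; lra.
  exact: le_trans YY.
have n1 : 0 <= (n%:R : R)^-1 by rewrite invr_ge0 ltW.
rewrite powRM ?(ltW XP) ?mulr_ge0// (@powRM _ 24^-1)//.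
have invE (x : R) : 0 <= x -> x^-1 `^ (p / 2) = x `^ (- (p / 2)).
  by move=> x0; rewrite -powR_inv1// -powRrM mulN1r.
rewrite !invE ?(ltW nR) ?(ltW X0)// /phi.
rewrite ler_wpM2l ?mulr_ge0 ?powR_ge0// -invE ?(ltW X0)// XE powR_prod; last first.
  by move=> i; rewrite invr_ge0 ltW// side_gt0.
apply: ler_prod => i _; rewrite side_powR// andbT.
have := simplex_ge0 i Ss => s0.
by rewrite divr_ge0 ?mulr_ge0 ?powR_ge0 ?(ltW G_gt0) ?addr_ge0// ltW.
Qed.

Lemma integral_phi n b : 0 < b ->
  (\int[leb]_(s in Q) (phi n b s)%:E =
   (24 `^ (- (p / 2)) * n%:R `^ (- (p / 2)) *
    (G * b `^ (- (p / 4)) * ln (1 + (d%:R * b)^-1)) ^+ d)%:E)%E.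
Proof.
move=> b0; set C := 24 `^ _ * _; set H := G * b `^ _.
have C0 : 0 <= C by rewrite mulr_ge0 ?powR_ge0.
have H0 : 0 <= H by rewrite mulr_ge0 ?powR_ge0 ?(ltW G_gt0).
pose I : set R := [set` `[0, d%:R^-1]].
pose g (i : 'I_d) : R -> \bar R := (fun x => (H / (x + b))%:E) \_ I.
have mfun : measurable_fun I (fun x : R => H / (x + b)).
  apply: measurable_funM => //.
  apply: (eq_measurable_fun (fun x : R => (x + b) `^ (-1))).
    move=> x /set_mem; rewrite /I/= in_itv/= => /andP[x0 _].
    by rewrite powR_inv1// addr_ge0// ltW.
  apply: measurable_funTS; apply: (measurableT_comp (measurable_powR _)).
  exact: measurable_funD.
have mI : measurable I by exact: measurable_itv.
have mg i : measurable_fun setT (g i).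
  by apply/(measurable_restrictT _ _).1 => //; exact/measurable_EFinP.
have g0 i x : (0 <= g i x)%E.
  rewrite /g patchE; case: ifPn => // /set_mem; rewrite /I/= in_itv/= => /andP[x0 _].
  by rewrite lee_fin divr_ge0// addr_ge0// ltW.
have gI i : (\int[lebesgue_measure]_x g i x = (H * ln (1 + (d%:R * b)^-1))%:E)%E.
  rewrite /g -integral_mkcond; under eq_integral do rewrite EFinM.
  rewrite ge0_integralZl//.
  - rewrite integral_inv_shift// ?invr_gt0// -EFinM; congr (_ * ln (1 + _))%:E.
    by rewrite invfM.
  - apply/measurable_EFinP.
    apply: (eq_measurable_fun (fun x : R => (x + b) `^ (-1))).
      move=> x /set_mem; rewrite /I/= in_itv/= => /andP[x0 _].
      by rewrite powR_inv1// addr_ge0// ltW.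
    apply: measurable_funTS; apply: (measurableT_comp (measurable_powR _)).
    exact: measurable_funD.
  - move=> x; rewrite /I/= in_itv/= => /andP[x0 _].
    by rewrite lee_fin invr_ge0 addr_ge0// ltW.
rewrite integral_mkcond.
transitivity (\int[leb]_s (C%:E * \prod_(i < d) g i (s ord0 i)))%E.
  apply: eq_integral => s _; rewrite patchE; case: ifPn => [/set_mem Qs|].
    rewrite /phi -/C EFinM -prodEFin; congr (_ * _)%E; apply: eq_bigr => i _.
    by rewrite /g patchE mem_set// /I/= in_itv/= Qs.
  move=> /negP; rewrite inE => /existsNP[i si].
  by rewrite (bigD1 i)//= /g patchE memNset ?mul0e ?mule0.
have mgp := measurable_row_prod mg.
have gp0 (s : 'rV[R]_d) : [set: 'rV[R]_d] s -> (0 <= \prod_(i < d) g i (s ord0 i))%E.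
  by move=> _; apply: prode_ge0 => i _; exact: g0.
rewrite (ge0_integralZl_EFin leb measurableT gp0 mgp C0).
rewrite (ge0_integral_row_prod mg g0) (eq_bigr (fun=> (H * ln (1 + (d%:R * b)^-1))%:E)); last first.
  by move=> i _; exact: gI.
by rewrite prodEFin -EFinM prodr_const card_ord.
Qed.

Lemma max_risk_variance_lower : exists2 c, 0 < c & forall n b, (0 < n)%N ->
  0 < b < 1 -> b <= variance_bandwidth ->
  ((c * n%:R `^ (- (p / 2)) *
     (b `^ (- (p / 4)) * ln (1 + (d%:R * b)^-1)) ^+ d)%:E <=
   max_risk p beta L (@dirichlet_kde R d n b) `^ p)%E.
Proof.
exists (24 `^ (- (p / 2)) * G ^+ d).
  by rewrite mulr_gt0 ?exprn_gt0// powR_gt0.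
move=> n b n0 b01 bb; have /andP[b0 b1] := b01.
have p0 : 0 < p by have := p_ge4; lra.
have i : 'I_d by exact: Ordinal d_gt0.
have h0 : 0 <= (0 : R) <= 2^-1 by lra.
have [f [k [k1 k2 fE]]] := @exists_wave_density R d d_gt0 i 0 1 0 h0.
have fk s : f s = k by rewrite fE /wave mul0r addr0 mulr1.
have fL : holder_class beta L f.
  apply: (wave_class beta_gt0 beta_le2 L_gt0 fE) => //; first by lra.
  by rewrite mulr0 mulr0 mulr_ge0 ?powR_ge0 ?(ltW L_gt0).
have mk := @is_estimator_kde R d b n.
apply: le_trans (max_risk_mean_loss p0 mk fL mQ QS).
rewrite (_ : _ * _ * _ ^+ d = 24 `^ (- (p / 2)) * n%:R `^ (- (p / 2)) *
    (G * b `^ (- (p / 4)) * ln (1 + (d%:R * b)^-1)) ^+ d); last first.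
  rewrite -(mulrA G) (exprMn _ G).
  by move: (24 `^ _) (n%:R `^ _) (G ^+ d) (_ ^+ d) => x y z t; ring.
rewrite -(integral_phi n b0); apply: ge0_le_integral => //.
- by move=> s Qs; rewrite lee_fin phi_ge0.
- apply/measurable_EFinP; apply: measurable_funM => //.
  apply: measurable_prod => j _.
  apply: (eq_measurable_fun (fun s : 'rV[R]_d => G * b `^ (- (p / 4)) * (s ord0 j + b) `^ (-1))).
    move=> s; rewrite inE => Qs; rewrite powR_inv1// addr_ge0 ?(ltW b0)//.
    exact: simplex_ge0 (QS Qs).
  apply: measurable_funM => //; apply: measurable_funTS.
  apply: (measurableT_comp (measurable_powR _)); apply: measurable_funD => //.
  exact: measurable_row_coord.
- apply: measurable_funS (@measurable_mean_loss R d n _ f p mk) => //.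
  exact: measurable_simplex.
- by move=> s Qs; exact: uniform_mean_loss_ge k1 k2 fk Qs.
Qed.

End variance_lower.

(** * Taylor expansion in the Hoelder class *)

Section taylor.
Context {R : realType} {d : nat}.
Implicit Types (f : 'rV[R]_d -> R) (beta L : R).
Local Notation e_ i := (delta_mx ord0 i : 'rV[R]_d).

Lemma mean_value_coordinate f i (z : 'rV[R]_d) a b : a <= b ->
  (forall u, a <= u <= b -> derivable f (u *: e_ i + z) (e_ i)) ->
  exists2 u, a <= u <= b &
    f (b *: e_ i + z) - f (a *: e_ i + z) = 'D_(e_ i) f (u *: e_ i + z) * (b - a).
Proof.
move=> ab df.
have dg u : a <= u <= b -> is_derive u 1 (fun u : R => f (u *: e_ i + z))
    ('D_(e_ i) f (u *: e_ i + z)).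
  move=> /df /(derivable_line f z (e_ i) u).1 du.
  by split => //; rewrite derive_line.
have dgo u : u \in `]a, b[ -> is_derive u 1 (fun u : R => f (u *: e_ i + z))
    ('D_(e_ i) f (u *: e_ i + z)).
  by rewrite in_itv/= => /andP[au ub]; apply: dg; rewrite !ltW.
have [|u uab fu] := MVT_segment ab dgo; last first.
  by exists u => //; move: uab; rewrite in_itv.
apply: derivable_within_continuous => u; rewrite in_itv/= => /dg uab.
by have [] := uab.
Qed.

(** The coordinates are changed from m to y one at a time. Because m <= y, all the
    intermediate points lie between m and y. *)
Lemma taylor_monotone f (m y : 'rV[R]_d) (c : 'I_d -> R) K :
  (forall j, m ord0 j <= y ord0 j) ->
  (forall (i : 'I_d) (z : 'rV[R]_d), (forall j, m ord0 j <= z ord0 j <= y ord0 j) ->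
    derivable f z (e_ i) /\ `|'D_(e_ i) f z - c i| <= K) ->
  `|f y - f m - \sum_i c i * (y ord0 i - m ord0 i)| <=
    K * \sum_i (y ord0 i - m ord0 i).
Proof.
move=> my hD.
pose q (l : seq 'I_d) : 'rV[R]_d :=
  \row_j (if j \in l then y ord0 j else m ord0 j).
have -> : y = q (index_enum 'I_d).
  by apply/rowP => j; rewrite mxE mem_index_enum.
have yE i : q (index_enum 'I_d) ord0 i = y ord0 i by rewrite mxE mem_index_enum.
under eq_bigr do rewrite yE; under [in leRHS]eq_bigr do rewrite yE.
have : uniq (index_enum 'I_d) by exact: index_enum_uniq.
elim: (index_enum _) => [_|i l IH /= /andP[il ul]].
  rewrite !big_nil mulr0 subr0 (_ : q [::] = m) ?subrr ?normr0//.
  by apply/rowP => j; rewrite mxE.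
pose z : 'rV[R]_d := \row_j (if j == i then 0 else q l ord0 j).
have q0 : q l = m ord0 i *: e_ i + z.
  apply/rowP => j; rewrite !mxE eqxx/=; have [->|ji] := eqVneq j i.
    by rewrite (negbTE il) mulr1 addr0.
  by rewrite mulr0 add0r.
have q1 : q (i :: l) = y ord0 i *: e_ i + z.
  apply/rowP => j; rewrite !mxE eqxx/= inE; have [->|ji] := eqVneq j i.
    by rewrite mulr1 addr0.
  by rewrite mulr0 add0r.
have hz u : m ord0 i <= u <= y ord0 i ->
    forall j, m ord0 j <= (u *: e_ i + z) ord0 j <= y ord0 j.
  move=> hu j; rewrite !mxE eqxx/=; have [->|ji] := eqVneq j i.
    by rewrite mulr1 addr0.
  by rewrite mulr0 add0r; case: ifP => _; rewrite ?lexx ?my.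
have [u hu E] := mean_value_coordinate (my i)
  (fun u hu => (hD i _ (hz u hu)).1).
have [_ Dc] := hD i _ (hz u hu).
rewrite !big_cons; set D := 'D_(e_ i) f _ in E Dc.
rewrite (_ : _ - _ = (D - c i) * (y ord0 i - m ord0 i) +
   (f (q l) - f m - \sum_(j <- l) c j * (y ord0 j - m ord0 j))); last first.
  rewrite mulrBl -E q1 -q0.
  move: (c i * _) (\sum_(j <- l) c j * _) (f (q l)) (f _) (f m) => A B C F G; ring.
rewrite (le_trans (ler_normD _ _))// [leRHS]mulrDr lerD//; last exact: IH.
rewrite normrM (ger0_norm (_ : 0 <= y ord0 i - _)) ?subr_ge0//.
by rewrite ler_wpM2r// subr_ge0.
Qed.

Lemma osimplex_between (m y z : 'rV[R]_d) : osimplex y ->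
  (forall j, 0 < m ord0 j) ->
  (forall j, m ord0 j <= z ord0 j <= y ord0 j) -> osimplex z.
Proof.
move=> [y0 y1] m0 hz; split=> [j|].
  by have /andP[h _] := hz j; exact: lt_le_trans (m0 j) h.
by apply: le_lt_trans y1; apply: ler_sum => j _; have /andP[] := hz j.
Qed.

(** First order Taylor formula without second derivatives. The path from s to x
    goes through their coordinatewise minimum, so that it is monotone on both
    legs and stays in the open simplex at distance at most norm1 (x - s) of s. *)
Lemma holder_taylor beta L f s : 0 < beta -> beta <= 2 -> 0 <= L ->
  holder_class beta L f -> osimplex s ->
  exists c : 'I_d -> R, forall x, osimplex x ->
    `|f x - f s - \sum_i c i * (x ord0 i - s ord0 i)| <=
      L * norm1 (x - s) `^ beta.
Proof.
move=> b0 b2 L0 fL Ss; have [b1|b1] := leP beta 1.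
  exists (fun=> 0) => x Sx; rewrite big1 ?subr0 => [|i _]; last by rewrite mul0r.
  by have /holder_class_le1 := fL; apply => //; exact: osimplex_int.
have /holder_class_gt1 := fL => /(_ b1 b2) hf.
exists (fun i => 'D_(e_ i) f s) => x Sx.
(* The intermediate point of the path. *)
pose m : 'rV[R]_d := \row_j Num.min (s ord0 j) (x ord0 j).
have [s0 _] := Ss; have [x0 _] := Sx.
have m0 j : 0 < m ord0 j by rewrite mxE lt_min s0 x0.
have ms j : m ord0 j <= s ord0 j by rewrite mxE ge_min lexx.
have mx j : m ord0 j <= x ord0 j by rewrite mxE ge_min lexx orbT.
set K := L * norm1 (x - s) `^ (beta - 1).
have N0 : 0 <= norm1 (x - s) by rewrite sumr_ge0.
have hK i (z : 'rV[R]_d) : osimplex z -> (forall j, `|z ord0 j - s ord0 j| <= `|x ord0 j - s ord0 j|) ->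
    derivable f z (e_ i) /\ `|'D_(e_ i) f z - 'D_(e_ i) f s| <= K.
  move=> /osimplex_int Sz hz; have [h1 h2] := hf i; split; first exact: h1.
  apply: (le_trans (h2 _ _ Sz (osimplex_int Ss))).
  rewrite ler_wpM2l//; apply: ge0_ler_powR; rewrite ?nnegrE//.
  - by lra.
  - by rewrite sumr_ge0.
  - by apply: ler_sum => j _; rewrite !mxE.
have Hx : `|f x - f m - \sum_i 'D_(e_ i) f s * (x ord0 i - m ord0 i)| <=
    K * \sum_i (x ord0 i - m ord0 i).
  apply: taylor_monotone => // i z hz; apply: hK.
    exact: osimplex_between Sx m0 hz.
  move=> j; have := hz j; rewrite mxE; case: (lerP (s ord0 j) (x ord0 j)) => h /andP[h1 h2].
    by rewrite ger0_norm ?subr_ge0// lerB.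
  have -> : z ord0 j = x ord0 j.
    by apply/eqP; rewrite eq_le h1 h2.
  by rewrite ler0_norm ?subr_le0 ?(ltW h)// opprB.

have Hs : `|f s - f m - \sum_i 'D_(e_ i) f s * (s ord0 i - m ord0 i)| <=
    K * \sum_i (s ord0 i - m ord0 i).
  apply: taylor_monotone => // i z hz; apply: hK.
    exact: osimplex_between Ss m0 hz.
  move=> j; have := hz j; rewrite mxE; case: (lerP (s ord0 j) (x ord0 j)) => h /andP[h1 h2].
    have -> : z ord0 j = s ord0 j; last by rewrite subrr normr0 subr_ge0.
      by apply/eqP; rewrite eq_le h1 h2.
  by rewrite ler0_norm ?subr_le0// opprB lerB.
have -> : f x - f s - \sum_i 'D_(e_ i) f s * (x ord0 i - s ord0 i) =
    (f x - f m - \sum_i 'D_(e_ i) f s * (x ord0 i - m ord0 i)) -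
    (f s - f m - \sum_i 'D_(e_ i) f s * (s ord0 i - m ord0 i)).
  rewrite (_ : \sum_i _ = \sum_i 'D_(e_ i) f s * (x ord0 i - m ord0 i) -
      \sum_i 'D_(e_ i) f s * (s ord0 i - m ord0 i)); last first.
    by rewrite -sumrB; apply: eq_bigr => i _; rewrite -mulrBr; congr (_ * _); ring.
  move: (\sum_i _) (\sum_i _) => A B; move: (f x) (f m) (f s) => X M Y; ring.
rewrite (le_trans (ler_normB _ _))// (le_trans (lerD Hx Hs))// -mulrDr -big_split/=.
rewrite (eq_bigr (fun i => `|(x - s) ord0 i|)); last first.
  move=> i _; rewrite !mxE; case: (lerP (s ord0 i) (x ord0 i)) => h.
    by rewrite subrr addr0.
  by rewrite subrr add0r.
by rewrite -/(norm1 _) -mulrA [_ `^ _ * _]mulrC mulr_powRB1.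
Qed.

End taylor.

(** * Exponential moments of averages *)

(** From expR (- x) >= 1 - x and (1 - x) (1 + x + 2 x ^+ 2) >= 1. *)
Lemma expR_le_quadratic {R : realType} (x : R) : x <= 2^-1 ->
  expR x <= 1 + x + 2 * x ^+ 2.
Proof.
move=> x2; have x1 : 0 < 1 - x by lra.
have h : expR x <= (1 - x)^-1.
  rewrite -[leLHS]invrK -expRN lef_pV2 ?posrE ?expR_gt0//.
  exact: expR_ge1Dx.
apply: (le_trans h); rewrite -[leLHS]mul1r ler_pdivrMr//.
have : 0 <= x ^+ 2 * (1 - 2 * x) by rewrite mulr_ge0 ?sqr_ge0//; lra.
by rewrite expr2; lra.
Qed.

Section exponential_moments.
Context d (T : measurableType d) (R : realType) (P : probability T R).
Variables (Y : T -> R) (v : R).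
Hypotheses (bY : bmfun setT Y) (Y0 : \int[P]_x Y x = 0)
  (Yv : \int[P]_x (Y x ^+ 2) <= v).
Local Notation Pn n := (power_measure P n).

Lemma mean_expR_le t : (forall x, t * Y x <= 2^-1) ->
  (\int[P]_x (expR (t * Y x))%:E <= (expR (2 * t ^+ 2 * v))%:E)%E.
Proof.
move=> tY; have [mY _] := bY.
have bt : bmfun setT (fun x => t * Y x) by apply: bmM => //; exact: bm_cst.
have b2 : bmfun setT (fun x => 2 * t ^+ 2 * Y x ^+ 2).
  by apply: bmM; [exact: bm_cst|exact: bmX].
have b1 : bmfun setT (fun x => 1 + t * Y x) by apply: bmD => //; exact: bm_cst.
have bq : bmfun setT (fun x => 1 + t * Y x + 2 * t ^+ 2 * Y x ^+ 2) by exact: bmD.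
apply: (@le_trans _ _ (\int[P]_x (1 + t * Y x + 2 * t ^+ 2 * Y x ^+ 2)%:E)%E).
  apply: ge0_le_integral => //.
  - apply/measurable_EFinP; apply: measurableT_comp => //.
    by case: bt.
  - by case: bq => + _ => /measurable_EFinP.
  - move=> x ?; rewrite lee_fin (le_trans (expR_le_quadratic (tY x)))//.
    by rewrite exprMn mulrA.
rewrite (integral_EFin_bm P bq) lee_fin.
have i1 := bm_integrableT P b1; have i2 := bm_integrableT P b2.
have it := bm_integrableT P bt; have ic := bm_integrableT P (bm_cst setT (1 : R)).
have iY := bm_integrableT P bY; have iY2 := bm_integrableT P (bmX 2 bY).
rewrite (RintegralD measurableT i1 i2) (RintegralD measurableT ic it).
rewrite Rintegral_prob_cst (RintegralZl _ measurableT iY) Y0 mulr0 addr0.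
rewrite (RintegralZl _ measurableT iY2).
apply: le_trans (expR_ge1Dx _); rewrite lerD2l ler_wpM2l//.
by rewrite mulr_ge0// sqr_ge0.
Qed.

Lemma mean_expR_sum_le n t : (forall x, t * Y x <= 2^-1) ->
  (\int[Pn n]_X (expR (t * \sum_(i < n) Y (tnth X i)))%:E <=
   (expR (n%:R * (2 * t ^+ 2 * v)))%:E)%E.
Proof.
move=> tY; have [mY _] := bY.
pose g (_ : 'I_n) x := (expR (t * Y x))%:E.
have mg i : measurable_fun setT (g i).
  by apply/measurable_EFinP; apply: measurableT_comp => //; exact: measurable_funM.
have g0 i x : (0 <= g i x)%E by rewrite lee_fin expR_ge0.
under eq_integral do rewrite mulr_sumr expR_sum -prodEFin.
rewrite (ge0_integral_power_prod P mg g0).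
rewrite mulrC expRM_natr -[in leRHS](card_ord n) -prodr_const -prodEFin.
elim: (index_enum _) => [|i r IH]; rewrite ?big_nil// !big_cons.
apply: lee_pmul => //; last exact: mean_expR_le.
- by apply: integral_ge0 => x _; exact: g0.
- by apply: prode_ge0 => j _; apply: integral_ge0 => x _; exact: g0.
Qed.

(** Bernstein type bound. All the moments of the average are controlled at once by
    its exponential moments at lam and - lam, with lam of the order of the inverse
    of the standard deviation. *)
Lemma mean_powR_iid_avg_le n p lam D : (0 < n)%N -> 0 <= p -> 0 < lam ->
  (forall x, `|Y x| <= D) -> lam * D <= n%:R / 2 ->
  (\int[Pn n]_X (`|n%:R^-1 * \sum_(i < n) Y (tnth X i)| `^ p)%:E <=
   (lam `^ (- p) * p `^ p * (2 * expR (2 * lam ^+ 2 * v / n%:R)))%:E)%E.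
Proof.
move=> n0 p0 l0 YD lD; have nR : 0 < n%:R :> R by rewrite ltr0n.
have bS := bm_iid_sum n bY; have [mS _] := bS.
pose t := lam / n%:R; have t0 : 0 < t by rewrite divr_gt0.
have tY x : `|t * Y x| <= 2^-1.
  rewrite normrM (gtr0_norm t0) (@le_trans _ _ (t * D))//.
    by rewrite ler_wpM2l// ltW.
  by rewrite /t mulrAC ler_pdivrMr// [leRHS]mulrC.
have hp := @mean_expR_sum_le n t (fun x => le_trans (ler_norm _) (tY x)).
have hm : (\int[Pn n]_X (expR (- t * \sum_(i < n) Y (tnth X i)))%:E <=
   (expR (n%:R * (2 * t ^+ 2 * v)))%:E)%E.
  have -> : t ^+ 2 = (- t) ^+ 2 by rewrite sqrrN.
  apply: mean_expR_sum_le => x.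
  by rewrite mulNr (le_trans (ler_norm _))// normrN.
pose C := lam `^ (- p) * p `^ p.
have C0 : 0 <= C by rewrite mulr_ge0// powR_ge0.
pose E u X := (expR (u * \sum_(i < n) Y (tnth X i)))%:E.
have mE u : measurable_fun setT (E u).
  by apply/measurable_EFinP; apply: measurableT_comp => //; exact: measurable_funM.
have E0 u X : (0 <= E u X)%E by rewrite lee_fin expR_ge0.
apply: (@le_trans _ _ (\int[Pn n]_X (C%:E * (E t X + E (- t)%R X)))%E).
  apply: ge0_le_integral => //.
  - apply/measurable_EFinP; apply: (measurableT_comp (measurable_powR _)).
    by apply: measurableT_comp => //; exact: measurable_funM.
  - by apply: emeasurable_funM => //; exact: emeasurable_funD.
  - move=> X _; rewrite /E -EFinD -EFinM lee_fin.
    set s := \sum_(i < n) _.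
    have -> : `|n%:R^-1 * s| `^ p = lam `^ (- p) * `|t * s| `^ p.
      have -> : t * s = lam * (n%:R^-1 * s) by rewrite /t mulrA.
      rewrite (normrM lam) (gtr0_norm l0).
      rewrite powRM ?(ltW l0)// mulrA -powRD; last by rewrite (gt_eqF l0) implybT.
      by rewrite addNr powRr0 mul1r.
    rewrite /C -[leRHS]mulrA ler_wpM2l ?powR_ge0//.
    apply: (le_trans (powR_le_expR p0 (normr_ge0 _))).
    rewrite ler_wpM2l ?powR_ge0// mulNr.
    case: (ger0P (t * s)) => _; first by rewrite lerDl expR_ge0.
    by rewrite lerDr expR_ge0.
have mEE : measurable_fun setT (fun X => (E t X + E (- t)%R X)%E).
  exact: emeasurable_funD.
rewrite (ge0_integralZl_EFin (Pn n) measurableT _ mEE C0); last first.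
  by move=> X _; exact: adde_ge0.
rewrite -/C [leRHS]EFinM lee_wpmul2l ?lee_fin//.
rewrite (ge0_integralD (Pn n) measurableT (fun X _ => E0 t X) (mE t)
  (fun X _ => E0 (- t) X) (mE (- t))).
apply: (le_trans (leeD hp hm)); rewrite -EFinD lee_fin.
rewrite (_ : n%:R * _ = 2 * lam ^+ 2 * v / n%:R); last first.
  by rewrite /t; field; rewrite gt_eqF.
lra.
Qed.

End exponential_moments.

(** * Upper bound for the minimax risk *)

Lemma integral_shifted_id {R : realType} (a l : R) : 0 < l ->
  (\int[lebesgue_measure]_(x in `[a, (a + l)%R]) (x - a)%R%:E = (l ^+ 2 / 2)%R%:E)%E.
Proof.
move=> l0; pose F (x : R) := (x - a) ^+ 2 / 2.
have dF (x : R) : is_derive x 1 F (x - a).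
  rewrite /F; apply: is_derive_eq.
  by rewrite /GRing.scale/= mulr0 mulr0 add0r subr0; field.
have cF (x : R) : {for x, continuous F}.
  apply: differentiable_continuous; apply/derivable1_diffP.
  by have [] := dF x.
rewrite (@continuous_FTC2 _ _ F).
- by rewrite /F subrr expr0n/= mul0r -EFinB subr0 addrC addKr.
- by rewrite ltrDl.
- apply: continuous_in_subspaceT => x _.
  by apply: cvgB; [exact: cvg_id|exact: cvg_cst].
- split.
  + by move=> x _; have [] := dF x.
  + by apply: cvg_at_right_filter; exact: cF.
  + by apply: cvg_at_left_filter; exact: cF.
- by move=> x _; rewrite derive1E; have [_] := dF x.
Qed.

Section box.
Context {R : realType} {d : nat}.
Local Notation leb := (@lebesgue_row R d).
Local Notation S := (@simplex R d).
Implicit Types (a : 'rV[R]_d) (l : R).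

Definition box a l : set 'rV[R]_d :=
  [set v | forall i, a ord0 i <= v ord0 i <= a ord0 i + l].

Lemma measurable_box a l : measurable (box a l).
Proof. exact: (measurable_cube (fun i => a ord0 i) (fun i => a ord0 i + l)). Qed.

Lemma box_volume a l : 0 <= l -> leb (box a l) = (l ^+ d)%:E.
Proof.
move=> l0; rewrite /box (@lebesgue_row_cube R d (fun i => a ord0 i) (fun i => a ord0 i + l)).
  by congr (_%:E); rewrite (eq_bigr (fun=> l)) ?prodr_const ?card_ord// => i _; rewrite addrC addKr.
by move=> i; rewrite lerDl.
Qed.

Lemma box_first_moment a l i : 0 < l ->
  (\int[leb]_(x in box a l) (x ord0 i - a ord0 i)%R%:E =
   (l ^+ d * (l / 2))%R%:E)%E.
Proof.
move=> l0; pose I j : set R := [set` `[a ord0 j, a ord0 j + l]].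
pose h j (x : R) := if j == i then x - a ord0 j else 1.
pose g j : R -> \bar R := (fun x => (h j x)%:E) \_ (I j).
have mI j : measurable (I j) by exact: measurable_itv.
have mg j : measurable_fun setT (g j).
  apply/(measurable_restrictT _ _).1 => //; apply/measurable_EFinP; rewrite /h.
  by case: (j == i) => //; exact: measurable_funB.
have g0 j x : (0 <= g j x)%E.
  rewrite /g patchE; case: ifPn => // /set_mem; rewrite /I/= in_itv/= => /andP[x0 _].
  by rewrite lee_fin /h; case: ifP => // _; rewrite subr_ge0.
rewrite integral_mkcond.
transitivity (\int[leb]_s (\prod_(j < d) g j (s ord0 j)))%E.
  apply: eq_integral => s _; rewrite patchE; case: ifPn => [/set_mem Qs|].
    have gE j : g j (s ord0 j) = (h j (s ord0 j))%:E.
      by rewrite /g patchE mem_set// /I/= in_itv/=; exact: Qs.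
    rewrite (bigD1 i)//= gE /h eqxx big1 ?mule1// => j ji.
    by rewrite gE /h (negbTE ji).
  move=> /negP; rewrite inE => /existsNP[j sj].
  by rewrite (bigD1 j)//= /g patchE memNset ?mul0e.
rewrite (ge0_integral_row_prod mg g0) (bigD1 i)//=.
have -> : (\int[lebesgue_measure]_x g i x = (l ^+ 2 / 2)%R%:E)%E.
  rewrite /g -integral_mkcond -(integral_shifted_id (a ord0 i) l0).
  by apply: eq_integral => x _; rewrite /h eqxx.
rewrite (eq_bigr (fun=> l%:E)) => [|j ji]; last first.
  rewrite /g -integral_mkcond.
  transitivity (\int[lebesgue_measure]_(x in I j) (cst 1%:E) x)%E.
    by apply: eq_integral => x _; rewrite /h (negbTE ji).
  have Il : (lebesgue_measure (I j) = l%:E)%E.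
    rewrite /I lebesgue_measure_itv/= lte_fin ltrDl l0 -EFinB.
    by rewrite addrC addKr.
  apply: etrans (integral_cst lebesgue_measure (mI j) 1%E) _.
  by rewrite mul1e; exact: Il.
rewrite prodEFin -EFinM; congr (_%:E).
rewrite (_ : \prod_(j < d | j != i) l = l ^+ d.-1); last first.
  by rewrite prodr_const cardC1 card_ord.
have /prednK {2}<- : (0 < d)%N by exact: leq_ltn_trans (ltn_ord i).
by rewrite [in RHS]exprS expr2; field.
Qed.

Section box_mass.
Variables (f : simplex_density R d) (a s : 'rV[R]_d) (l M : R) (c : 'I_d -> R).
Hypotheses (l_gt0 : 0 < l) (QS : box a l `<=` S)
  (fM : forall x, box a l x ->
    `|f x - f s - \sum_i c i * (x ord0 i - s ord0 i)| <= M).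

(** On a box the mean of an affine function is its value at the centre. *)
Lemma box_mass_taylor :
  `|fine (density_law f (box a l)) / l ^+ d -
    (f s + \sum_i c i * (a ord0 i + l / 2 - s ord0 i))| <= M.
Proof.
have l0 := l_gt0; have ld : 0 < l ^+ d by rewrite exprn_gt0.
have mQ := measurable_box a l.
have Qoo : (leb (box a l) < +oo)%E by rewrite (box_volume a (ltW l0)) ltry.
have bint g : bmfun (box a l) g -> leb.-integrable (box a l) (EFin \o g).
  exact: bm_integrable.
have bc i : bmfun (box a l) (fun x => x ord0 i - a ord0 i).
  split.
    by apply: measurable_funB => //; apply: measurable_funTS; exact: measurable_row_coord.
  exists l => x /(_ i)/andP[x1 x2]; rewrite ger0_norm ?subr_ge0//.
  by rewrite lerBlDl.
pose k := f s + \sum_i c i * (a ord0 i - s ord0 i).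
pose aff (x : 'rV[R]_d) := k + \sum_i c i * (x ord0 i - a ord0 i).
have bci i : bmfun (box a l) (fun x => c i * (x ord0 i - a ord0 i)).
  by apply: bmM => //; exact: bm_cst.
have bsum r : bmfun (box a l) (fun x => \sum_(i <- r) c i * (x ord0 i - a ord0 i)).
  exact: bm_sum.
have baff : bmfun (box a l) aff by apply: bmD; [exact: bm_cst|exact: bsum].
have affE x : f x - aff x = f x - f s - \sum_i c i * (x ord0 i - s ord0 i).
  rewrite /aff /k -[in LHS]addrA -big_split/= opprD addrA; congr (_ - _).
  by apply: eq_bigr => i _; rewrite -mulrDr; congr (_ * _); ring.
have bdiff : bmfun (box a l) (fun x => f x - aff x).
  split; last by exists M => x Qx; rewrite affE; exact: fM.
  apply: measurable_funB; last by case: baff.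
  exact: measurable_funS (@measurable_simplex R d) QS (measurable_pdf f).
have bf : bmfun (box a l) f.
  rewrite (_ : pdf f = fun x => (f x - aff x) + aff x); first exact: bmD.
  by apply/funext => x; rewrite subrK.
have If : \int[leb]_(x in box a l) f x = fine (density_law f (box a l)).
  by rewrite /Rintegral /density_law setIidl.
have Icst t : \int[leb]_(_ in box a l) t = t * l ^+ d.
  have Ql : fine (leb (box a l)) = l ^+ d by rewrite (box_volume a (ltW l0)).
  by rewrite -Ql; exact: (Rintegral_cst leb mQ).
have Iaff : \int[leb]_(x in box a l) aff x =
    l ^+ d * (f s + \sum_i c i * (a ord0 i + l / 2 - s ord0 i)).
  rewrite /aff (RintegralD mQ (bint _ (bm_cst _ k)) (bint _ (bsum _))) Icst.
  rewrite (_ : \int[leb]_(x in _) _ = \sum_i c i * (l ^+ d * (l / 2))); last first.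
    elim: (index_enum _) => [|i r IH].
      by under eq_Rintegral do rewrite big_nil; rewrite big_nil Icst mul0r.
    under eq_Rintegral do rewrite big_cons.
    rewrite big_cons -IH (RintegralD mQ (bint _ (bci i)) (bint _ (bsum r))).
    by rewrite (RintegralZl _ mQ (bint _ (bc i))) /Rintegral (box_first_moment a i l0).
  rewrite (_ : \sum_i _ = l ^+ d * \sum_i c i * (l / 2)); last first.
    by rewrite mulr_sumr; apply: eq_bigr => i _; rewrite mulrCA.
  rewrite [k * _]mulrC -mulrDr /k -addrA -big_split/=; congr (_ * (_ + _)).
  by apply: eq_bigr => i _; ring.
rewrite -If.
have -> : \int[leb]_(x in box a l) f x / l ^+ d -
    (f s + \sum_i c i * (a ord0 i + l / 2 - s ord0 i)) =
    (\int[leb]_(x in box a l) (f x - aff x)) / l ^+ d.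
  rewrite (RintegralB mQ (bint _ bf) (bint _ baff)) Iaff.
  by move: (\sum_i _) => X; field; rewrite gt_eqF.
rewrite normrM normfV (gtr0_norm ld) ler_pdivrMr// -Icst.
apply: (le_trans (le_normr_Rintegral mQ (bint _ bdiff))).
apply: le_Rintegral => //.
- apply: bint; have [mb [N bN]] := bdiff; split; last by exists N => x Qx; rewrite normr_id; exact: bN.
  exact: measurableT_comp.
- exact: bint (bm_cst _ M).
- by move=> x Qx; rewrite affE; exact: fM.
Qed.

End box_mass.

Lemma box_mass_le (f : simplex_density R d) a l B : 0 <= l -> box a l `<=` S ->
  (forall x, box a l x -> f x <= B) ->
  fine (density_law f (box a l)) <= B * l ^+ d.
Proof.
move=> l0 QS fB; rewrite -lee_fin fineK; last first.
  rewrite ge0_fin_numE ?measure_ge0// (le_lt_trans _ (ltry 1))//.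
  exact: (probability_le1 (density_law f) (measurable_box a l)).
have mQ := measurable_box a l.
rewrite EFinM -(box_volume a l0).
apply: (@le_trans _ _ (\int[leb]_(x in box a l) cst B%:E x)%E); last first.
  by rewrite integral_cst.
rewrite /density_law setIidl//.
apply: ge0_le_integral => //.
- by move=> x Qx; rewrite lee_fin; apply: pdf_ge0; exact: QS.
- apply/measurable_EFinP.
  exact: measurable_funS (@measurable_simplex R d) QS (measurable_pdf f).
Qed.

End box.

Section local_average.
Context {R : realType} {d : nat} (d_gt0 : (0 < d)%N).
Local Notation leb := (@lebesgue_row R d).
Local Notation S := (@simplex R d).
Local Notation O := (@osimplex R d).

(** The image of the cube [0, 1/d]^d under the homothety of centre s and ratio h;
    as the cube is contained in the convex simplex, so is its image. *)
Definition local_box (h : R) (s : 'rV[R]_d) : set 'rV[R]_d :=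
  box ((1 - h) *: s) (h / d%:R).

Definition local_volume (h : R) : R := (h / d%:R) ^+ d.

Let dR : 0 < d%:R :> R. Proof. by rewrite ltr0n. Qed.

Lemma local_volume_gt0 h : 0 < h -> 0 < local_volume h.
Proof. by move=> h0; rewrite exprn_gt0// divr_gt0. Qed.

Lemma local_box_coord h s x i : local_box h s x ->
  (1 - h) * s ord0 i <= x ord0 i <= (1 - h) * s ord0 i + h / d%:R.
Proof. by move=> /(_ i); rewrite !mxE. Qed.

Lemma local_box_sub h s : 0 < h -> h < 1 -> O s -> local_box h s `<=` O.
Proof.
move=> h0 h1 [s0 s1] x Qx; split=> [i|].
  have /andP[+ _] := local_box_coord i Qx; apply: lt_le_trans.
  by rewrite mulr_gt0 ?subr_gt0.
apply: (@le_lt_trans _ _ (\sum_i ((1 - h) * s ord0 i + h / d%:R))).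
  by apply: ler_sum => i _; have /andP[] := local_box_coord i Qx.
rewrite big_split/= -mulr_sumr sumr_const card_ord -(mulr_natr (h / d%:R)) divfK ?gt_eqF//.
have : (1 - h) * \sum_i s ord0 i < (1 - h) * 1 by rewrite ltr_pM2l ?subr_gt0.
by lra.
Qed.

Lemma local_box_norm1 h s x : 0 < h -> O s -> local_box h s x ->
  norm1 (x - s) <= 2 * h.
Proof.
move=> h0 [s0 s1] Qx.
have hd : 0 < h / d%:R by rewrite divr_gt0.
apply: (@le_trans _ _ (\sum_i (h * s ord0 i + h / d%:R))).
  apply: ler_sum => i _; rewrite !mxE.
  have /andP[x1 x2] := local_box_coord i Qx.
  have : 0 < h * s ord0 i by rewrite mulr_gt0.
  by rewrite ler_norml; move: x1 x2; move: (h / _) hd => t t0; lra.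
rewrite big_split/= -mulr_sumr sumr_const card_ord -(mulr_natr (h / d%:R)) divfK ?gt_eqF//.
have : h * \sum_i s ord0 i < h * 1 by rewrite ltr_pM2l.
by lra.
Qed.

Section averages.
Variables (beta L : R).
Hypotheses (beta_gt0 : 0 < beta) (beta_le2 : beta <= 2) (L_gt0 : 0 < L).
Variable (f : simplex_density R d).
Hypothesis fL : holder_class beta L f.
Local Notation P := (density_law f).

Definition local_average (h : R) (s : 'rV[R]_d) : R :=
  fine (P (local_box h s)) / local_volume h.

Lemma fin_density_law A : measurable A -> P A \is a fin_num.
Proof.
move=> mA; rewrite ge0_fin_numE//.
exact: le_lt_trans (probability_le1 P mA) (ltry 1).
Qed.

Lemma local_average_ge0 h s : 0 < h -> 0 <= local_average h s.
Proof.
by move=> h0; rewrite divr_ge0 ?(ltW (local_volume_gt0 h0))// fine_ge0.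
Qed.

Lemma local_average_le h s : 0 < h -> local_average h s <= (local_volume h)^-1.
Proof.
move=> h0; have V0 := local_volume_gt0 h0.
rewrite -[leRHS]mul1r ler_wpM2r ?invr_ge0 ?(ltW V0)// -lee_fin fineK.
  exact: (probability_le1 P (measurable_box _ _)).
by apply: fin_density_law; exact: measurable_box.
Qed.

(** The centre of the box at scale h is s + h w for a fixed vector w, so the linear
    terms in 2 * average h - average (2 h) cancel. *)
Lemma local_average_bias h s : 0 < h -> 2 * h < 1 -> O s ->
  `|2 * local_average h s - local_average (2 * h) s - f s| <=
    3 * L * (4 * h) `^ beta.
Proof.
move=> h0 h1 Os; have b0 := beta_gt0; have b2 := beta_le2; have L0 := L_gt0.
have [c fc] := holder_taylor b0 b2 (ltW L0) fL Os.
pose w := \sum_i c i * ((2 * d%:R)^-1 - s ord0 i).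
have key t : 0 < t -> t < 1 ->
    `|local_average t s - (f s + t * w)| <= L * (2 * t) `^ beta.
  move=> t0 t1; have QO := local_box_sub t0 t1 Os.
  have QS : local_box t s `<=` S by move=> x /QO; exact: osimplex_sub.
  have td : 0 < t / d%:R by rewrite divr_gt0.
  have -> : t * w = \sum_i c i * (((1 - t) *: s) ord0 i + t / d%:R / 2 - s ord0 i).
    rewrite mulr_sumr; apply: eq_bigr => i _; rewrite mxE mulrCA; congr (_ * _).
    by field; rewrite gt_eqF.
  apply: (box_mass_taylor td QS) => x Qx.
  apply: (le_trans (fc _ (QO _ Qx))); rewrite ler_wpM2l ?(ltW L0)//.
  apply: ge0_ler_powR; rewrite ?nnegrE ?(ltW b0)//.
  - by rewrite sumr_ge0.
  - by rewrite mulr_ge0// ltW.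
  - exact: local_box_norm1.

have h2 : h < 1 by lra.
have h3 : 0 < 2 * h by lra.
have K1 := key h h0 h2; have K2 := key (2 * h) h3 h1.
rewrite (_ : 2 * local_average h s - local_average (2 * h) s - f s =
  2 * (local_average h s - (f s + h * w)) -
  (local_average (2 * h) s - (f s + 2 * h * w))); last by ring.
rewrite (le_trans (ler_normB _ _))// normrM (ger0_norm (_ : 0 <= 2))//.
have p12 : (2 * h) `^ beta <= (4 * h) `^ beta.
  by apply: ge0_ler_powR; rewrite ?nnegrE ?(ltW b0)//; lra.
have E4 : 2 * (2 * h) = 4 * h by lra.
rewrite E4 in K2.
have := ler_wpM2l (ltW L0) p12.
by lra.
Qed.

(** A bound on all the densities of the class: a Hoelder density is close to a
    combination of its averages at the scale 1/4, which are at most the inverse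
    volume of a box. *)
Definition density_bound : R := 2 / local_volume 4^-1 + 3 * L.

Lemma density_le s : O s -> f s <= density_bound.
Proof.
(* At h = 1/4 the Hoelder remainder (4 h) ^ beta is 1. *)
move=> Os; have h0 : 0 < 4^-1 :> R by rewrite invr_gt0.
have h1 : 2 * 4^-1 < 1 :> R by lra.
have := local_average_bias h0 h1 Os; rewrite mulfV// powR1 mulr1.
have := local_average_le s h0.
have : 0 <= local_average (2 / 4) s by apply: local_average_ge0; lra.
rewrite ler_norml /density_bound.
by move: (local_average _ _) (local_average _ _) (local_volume _)^-1 => A B C; lra.
Qed.

Lemma density_bound_gt0 : 0 < density_bound.
Proof.
have h0 : 0 < 4^-1 :> R by rewrite invr_gt0.
by rewrite addr_gt0 ?divr_gt0 ?mulr_gt0 ?L_gt0 ?local_volume_gt0.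
Qed.

Lemma local_mass_le h s : 0 < h -> h < 1 -> O s ->
  fine (P (local_box h s)) <= density_bound * local_volume h.
Proof.
move=> h0 h1 Os; have QO := local_box_sub h0 h1 Os.
apply: box_mass_le.
- by rewrite divr_ge0// ltW.
- by move=> x /QO; exact: osimplex_sub.
- by move=> x /QO; exact: density_le.
Qed.

End averages.

Definition local_kernel (h : R) (s x : 'rV[R]_d) : R :=
  2 / local_volume h * \1_(local_box h s) x -
  (local_volume (2 * h))^-1 * \1_(local_box (2 * h) s) x.

Definition local_estimator (h : R) n (X : n.-tuple 'rV[R]_d) (s : 'rV[R]_d) : R :=
  n%:R^-1 * \sum_(i < n) local_kernel h s (tnth X i).

Lemma measurable_local_box_indic h d0 (U : measurableType d0)
    (g k : U -> 'rV[R]_d) : measurable_fun setT g -> measurable_fun setT k ->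
  measurable_fun setT (fun u => \1_(local_box h (g u)) (k u) : R).
Proof.
move=> mg mk.
have mc (u : U -> 'rV[R]_d) i : measurable_fun setT u ->
    measurable_fun setT (fun x => u x ord0 i).
  by move=> m; apply: (measurableT_comp (measurable_row_coord i) m).
rewrite (_ : (fun _ => _) = (fun u => \prod_(i < d)
    if ((1 - h) * g u ord0 i <= k u ord0 i) &&
       (k u ord0 i <= (1 - h) * g u ord0 i + h / d%:R) then 1 else 0)); last first.
  apply/funext => u; rewrite indicE; case: (boolP (k u \in _)) => [/set_mem Q|/negP].
    by rewrite big1// => i _; rewrite (local_box_coord i Q).
  rewrite inE => /existsNP[i /negP]; rewrite !mxE => Q.
  by rewrite (bigD1 i)//= (negbTE Q) mul0r.
apply: measurable_prod => i _; apply: measurable_fun_ifT => //.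
have ml : measurable_fun setT (fun u => (1 - h) * g u ord0 i).
  by apply: measurable_funM => //; exact: mc.
apply: measurable_and; apply: measurable_fun_ler => //; try exact: mc.
exact: measurable_funD.
Qed.

Lemma is_estimator_local h n : is_estimator (@local_estimator h n).
Proof.
apply: measurable_funM => //; apply: measurable_sum => i.
have mX : measurable_fun setT
    (fun z : n.-tuple 'rV[R]_d * 'rV[R]_d => tnth z.1 i).
  exact: (measurableT_comp (measurable_tnth i) measurable_fst).
have ms : measurable_fun setT
    (fun z : n.-tuple 'rV[R]_d * 'rV[R]_d => z.2) by exact: measurable_snd.
apply: measurable_funB; apply: measurable_funM => //;
  exact: measurable_local_box_indic.
Qed.

End local_average.

Section local_estimator_risk.
Context {R : realType} {d : nat} (d_gt0 : (0 < d)%N).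
Local Notation S := (@simplex R d).
Local Notation O := (@osimplex R d).
Variables (p beta L : R).
Hypotheses (p_gt0 : 0 < p) (beta_gt0 : 0 < beta) (beta_le2 : beta <= 2)
  (L_gt0 : 0 < L).
Local Notation B := (@density_bound R d L).

Section one_density.
Variables (f : simplex_density R d) (h : R) (s : 'rV[R]_d).
Hypotheses (fL : holder_class beta L f) (h_gt0 : 0 < h) (h_lt : 2 * h < 1)
  (Os : O s).
Local Notation P := (density_law f).
Local Notation q := (@local_volume R d h)^-1.
Local Notation q2 := (@local_volume R d (2 * h))^-1.
Local Notation Q := (local_box h s).
Local Notation Q2 := (local_box (2 * h) s).

Let q_gt0 : 0 < q.
Proof. by rewrite invr_gt0 local_volume_gt0. Qed.

Let q2_gt0 : 0 < q2.
Proof. by rewrite invr_gt0 local_volume_gt0// mulr_gt0. Qed.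

Let q2_le : q2 <= q.
Proof.
have h0 := h_gt0; have dR : 0 < d%:R :> R by rewrite ltr0n.
rewrite lef_pV2 ?posrE ?local_volume_gt0 ?mulr_gt0//.
by apply: lerXn2r; rewrite ?nnegrE ?divr_ge0 ?ler_wpM2r ?invr_ge0//; lra.
Qed.

Let bm_indic h' : bmfun setT (\1_(local_box h' s) : 'rV[R]_d -> R).
Proof.
split; first exact: measurable_local_box_indic.
by exists 1 => x _; rewrite indicE; case: (_ \in _); rewrite ?normr1 ?normr0.
Qed.

Let bq (a h' : R) : bmfun setT (fun x : 'rV[R]_d => a * \1_(local_box h' s) x).
Proof. by apply: bmM => //; exact: bm_cst. Qed.

Lemma bm_local_kernel : bmfun setT (local_kernel h s).
Proof. exact: bmB. Qed.

Let mean_indic (a h' : R) :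
  \int[P]_x (a * \1_(local_box h' s) x) = a * fine (P (local_box h' s)).
Proof.
rewrite (RintegralZl _ measurableT (bm_integrableT P (bm_indic h'))).
by rewrite /Rintegral integral_indic ?setIT//; exact: measurable_box.
Qed.

Lemma mean_local_kernel : \int[P]_x local_kernel h s x =
  2 * local_average f h s - local_average f (2 * h) s.
Proof.
rewrite (RintegralB measurableT (bm_integrableT P (bq _ _)) (bm_integrableT P (bq _ _))).
rewrite !mean_indic /local_average [_^-1 * fine _]mulrC; congr (_ - _).
by rewrite mulrAC mulrA.
Qed.

Lemma local_kernel_norm_le x : `|local_kernel h s x| <= 3 * q.
Proof.
have := q_gt0; have := q2_gt0; have := q2_le => qq q20 q0.
rewrite /local_kernel !indicE; move: qq q20 q0.
move: (@local_volume R d h)^-1 (@local_volume R d (2 * h))^-1 => u v vu v0 u0.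
by rewrite ler_norml; case: (_ \in _); case: (_ \in _); rewrite /= ?mulr1 ?mulr0; lra.
Qed.

(** Boundedness of the density saves one factor of the inverse volume compared with
    the square of the sup norm. *)
Lemma mean_local_kernel_sqr_le :
  \int[P]_x (local_kernel h s x ^+ 2) <= 10 * B * q.
Proof.
have := q_gt0; have := q2_gt0; have := q2_le => qq q20 q0.
have h0 := h_gt0; have hlt := h_lt.
have B0 := density_bound_gt0 d_gt0 L_gt0.
have b2 := bmX 2 bm_local_kernel.
have bu := bmD (bq (8 * q ^+ 2) h) (bq (2 * q2 ^+ 2) (2 * h)).
apply: (@le_trans _ _ (\int[P]_x (8 * q ^+ 2 * \1_Q x + 2 * q2 ^+ 2 * \1_Q2 x))).
  apply: le_Rintegral => //; [exact: (bm_integrableT P b2)|exact: (bm_integrableT P bu)|].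
  move=> x _; rewrite /local_kernel !indicE.
  move: (@local_volume R d h)^-1 (@local_volume R d (2 * h))^-1 qq q20 q0 => u v vu v0 u0.
  have := sqr_ge0 (2 * u + v); have := sqr_ge0 u; have := sqr_ge0 v; rewrite !expr2.
  by case: (_ \in _); case: (_ \in _); rewrite /= ?mulr1 ?mulr0; nra.
rewrite (RintegralD measurableT (bm_integrableT P (bq _ _)) (bm_integrableT P (bq _ _))).
rewrite !mean_indic.
have m1 : fine (P Q) * q <= B.
  rewrite ler_pdivrMr ?local_volume_gt0//; apply: (local_mass_le d_gt0 beta_gt0) => //.
  by lra.
have m2 : fine (P Q2) * q2 <= B.
  rewrite ler_pdivrMr ?local_volume_gt0 ?mulr_gt0//.
  by apply: (local_mass_le d_gt0 beta_gt0) => //; rewrite mulr_gt0.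
have -> : 8 * q ^+ 2 * fine (P Q) = 8 * q * (fine (P Q) * q) by ring.
have -> : 2 * q2 ^+ 2 * fine (P Q2) = 2 * q2 * (fine (P Q2) * q2) by ring.
have a1 : 8 * q * (fine (P Q) * q) <= 8 * q * B by rewrite ler_wpM2l// mulr_ge0// ltW.
have a2 : 2 * q2 * (fine (P Q2) * q2) <= 2 * q * B.
  apply: (@le_trans _ _ (2 * q2 * B)); first by rewrite ler_wpM2l// mulr_ge0// ltW.
  by rewrite ler_wpM2r ?(ltW B0)// ler_wpM2l.
move: a1 a2; move: (8 * q * (_ * _)) (2 * q2 * (_ * _)) => X Y; lra.
Qed.

Variables (n : nat) (lam : R).
Hypotheses (n_gt0 : (0 < n)%N) (lam_ge : 12 <= lam) (lamE : lam ^+ 2 * q = n%:R).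

(** Bias plus stochastic term. The choice lam ^+ 2 = n * volume is the inverse of
    the variance up to constants, which makes the exponential moment bounded. *)
Lemma local_estimator_mean_loss :
  (\int[sample_law n f]_X (`|local_estimator h X s - f s| `^ p)%:E <=
   (2 `^ p * (lam `^ (- p) * p `^ p * (2 * expR (20 * B)) +
      (3 * L * (4 * h) `^ beta) `^ p))%:E)%E.
Proof.
have p0 := p_gt0; have l0 : 0 < lam by have := lam_ge; lra.
have nR : 0 < n%:R :> R by rewrite ltr0n.
have [mu muE] : exists mu, \int[P]_x local_kernel h s x = mu by eexists.
pose Y x := local_kernel h s x - mu.
have bK := bm_local_kernel.
have bY : bmfun setT Y by apply: bmB => //; exact: bm_cst.
have iK := bm_integrableT P bK; have ic := bm_integrableT P (bm_cst setT mu).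
have Y0 : \int[P]_x Y x = 0.
  by rewrite (RintegralB measurableT iK ic) muE Rintegral_prob_cst subrr.
have mu3 : `|mu| <= 3 * q.
  rewrite -muE (le_trans (le_normr_Rintegral measurableT iK))//.
  rewrite -[leRHS](Rintegral_prob_cst P); apply: le_Rintegral => //.
  - by apply: bm_integrableT; have [mK [M KM]] := bK; split;
      [exact: measurableT_comp|exists M => x _; rewrite normr_id; exact: KM].
  - exact: (bm_integrableT P (bm_cst setT _)).
  - by move=> x _; exact: local_kernel_norm_le.
have YD x : `|Y x| <= 6 * q.
  rewrite (le_trans (ler_normB _ _))//.
  by have := local_kernel_norm_le x; move: mu3; lra.
have Yv : \int[P]_x (Y x ^+ 2) <= 10 * B * q.
  apply: le_trans mean_local_kernel_sqr_le.
  have i2 := bm_integrableT P (bmX 2 bK).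
  have bl : bmfun setT (fun x => (2 * mu) * local_kernel h s x) by apply: bmM => //; exact: bm_cst.
  have bl' : bmfun setT (fun x => (2 * mu) * local_kernel h s x - mu ^+ 2).
    by apply: bmB => //; exact: bm_cst.
  have -> : \int[P]_x (Y x ^+ 2) =
      \int[P]_x (local_kernel h s x ^+ 2 - ((2 * mu) * local_kernel h s x - mu ^+ 2)).
    by apply: eq_Rintegral => x _; rewrite /Y; ring.
  rewrite (RintegralB measurableT i2 (bm_integrableT P bl')).
  rewrite (RintegralB measurableT (bm_integrableT P bl) (bm_integrableT P (bm_cst setT (mu ^+ 2)))).
  rewrite (RintegralZl _ measurableT iK) muE Rintegral_prob_cst gerBl.
  by rewrite (_ : _ - _ = mu ^+ 2) ?sqr_ge0//; ring.
have lD : lam * (6 * q) <= n%:R / 2.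
  rewrite -lamE; have := lam_ge => l12.
  have : 0 <= lam * q * (lam - 12) by rewrite !mulr_ge0 ?subr_ge0// ltW.
  by rewrite expr2; lra.
have M := mean_powR_iid_avg_le bY Y0 Yv n_gt0 (ltW p0) l0 YD lD.
rewrite (_ : 2 * lam ^+ 2 * (10 * B * q) / n%:R = 20 * B) in M; last first.
  by rewrite -lamE; field; rewrite !gt_eqF// local_volume_gt0.
have avgE (X : n.-tuple 'rV[R]_d) : local_estimator h X s - f s =
    n%:R^-1 * (\sum_(i < n) Y (tnth X i)) + (mu - f s).
  have -> : \sum_(i < n) Y (tnth X i) =
      \sum_(i < n) local_kernel h s (tnth X i) - n%:R * mu.
    by rewrite /Y [LHS]sumrB sumr_const card_ord mulr_natl.
  rewrite /local_estimator.
  by move: (\sum_(i < n) _) => A; field; rewrite gt_eqF.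
have bias : `|mu - f s| <= 3 * L * (4 * h) `^ beta.
  by rewrite -muE mean_local_kernel; exact: local_average_bias.
have [mS _] := bm_iid_sum n bY.
pose g (X : n.-tuple 'rV[R]_d) := `|n%:R^-1 * (\sum_(i < n) Y (tnth X i))| `^ p.
have mg : measurable_fun setT g.
  apply: (measurableT_comp (measurable_powR _)).
  by apply: measurableT_comp => //; exact: measurable_funM.
have mg' : measurable_fun setT (EFin \o g) by exact/measurable_EFinP.
pose c := (3 * L * (4 * h) `^ beta) `^ p.
have c0 : 0 <= c by exact: powR_ge0.
have two0 : 0 <= (2 : R) `^ p by exact: powR_ge0.
rewrite -[sample_law n f]/(power_measure P n).
apply: (@le_trans _ _ (\int[power_measure P n]_X ((2 `^ p)%:E * ((g X)%:E + c%:E)))%E).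
  apply: ge0_le_integral => //.
  - under eq_fun do rewrite avgE; apply/measurable_EFinP.
    apply: (measurableT_comp (measurable_powR _)); apply: measurableT_comp => //.
    by apply: measurable_funD => //; exact: measurable_funM.
  - by apply: emeasurable_funM => //; exact: emeasurable_funD.
  - move=> X _; rewrite avgE -EFinD -EFinM lee_fin /g.
    move: (n%:R^-1 * _) => y.
    apply: (@le_trans _ _ ((2 * Num.max `|y| `|mu - f s|) `^ p)).
      have m0 : 0 <= 2 * Num.max `|y| `|mu - f s| by rewrite mulr_ge0// le_max normr_ge0.
      apply: (ge0_ler_powR (ltW p0)); rewrite ?nnegrE//.
      rewrite (le_trans (ler_normD _ _))// mulrDl mul1r.
      by apply: lerD; rewrite le_max lexx ?orbT.
    rewrite powRM// ?le_max ?normr_ge0// ler_wpM2l//.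
    have hb : `|mu - f s| `^ p <= c.
      apply: ge0_ler_powR; rewrite ?nnegrE ?(ltW p0)//.
      exact: le_trans bias.
    case: (leP `|y| `|mu - f s|) => _; first by rewrite (le_trans hb)// lerDr powR_ge0.
    by rewrite lerDl.
have mgc : measurable_fun setT (fun X => (g X)%:E + c%:E)%E by exact: emeasurable_funD.
rewrite (ge0_integralZl_EFin (power_measure P n) measurableT _ mgc two0); last first.
  by move=> X _; rewrite -EFinD lee_fin addr_ge0// powR_ge0.
rewrite [leRHS]EFinM lee_wpmul2l ?lee_fin//.
rewrite (ge0_integralD (power_measure P n) measurableT _ mg')//; last first.
  by move=> X _; rewrite lee_fin powR_ge0.
rewrite [leRHS]EFinD leeD//.
by rewrite integral_cst//= probability_setT mule1.
Qed.

End one_density.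

(** The condition on h balances the bias h ^ beta and the standard deviation
    (n h ^ d) ^ (- 1/2). *)
Lemma minimax_risk_le : exists2 C, 0 < C & exists2 h0, 0 < h0 &
  forall n h, (0 < n)%N -> 0 < h -> h <= h0 ->
    n%:R * (h `^ beta) ^+ 2 * h ^+ d = 1 ->
    (minimax_risk d n p beta L <= (C * h `^ beta)%:E)%E.
Proof.
have p0 := p_gt0; have b0 := beta_gt0; have b2 := beta_le2; have L0 := L_gt0.
have dd0 : 0 < d%:R ^+ d :> R by rewrite exprn_gt0// ltr0n.
pose D := Num.sqrt (d%:R ^+ d : R).
have D0 : 0 < D by rewrite sqrtr_gt0.
have D2 : D ^+ 2 = d%:R ^+ d by rewrite sqr_sqrtr// ltW.
pose C0 := 2 `^ p * (D `^ p * p `^ p * (2 * expR (20 * B)) + (3 * L * 4 `^ beta) `^ p).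
have C00 : 0 < C0.
  rewrite mulr_gt0 ?powR_gt0// ltr_wpDr ?powR_ge0//.
  by rewrite !mulr_gt0 ?powR_gt0 ?expR_gt0.
exists (C0 `^ p^-1); first exact: powR_gt0.
pose h1 := (12 * D)^-1 `^ beta^-1.
have h10 : 0 < h1 by rewrite powR_gt0 ?invr_gt0 ?mulr_gt0.
exists (Num.min 4^-1 h1); first by rewrite lt_min h10 andbT invr_gt0.
move=> n h n0 h0; rewrite le_min => /andP[h4 hh1] nh.
set H := h `^ beta in nh *.
have H0 : 0 < H by exact: powR_gt0.
have HD : H <= (12 * D)^-1.
  have -> : (12 * D)^-1 = h1 `^ beta.
    by rewrite -powRrM mulVf ?gt_eqF// powRr1// invr_ge0 mulr_ge0// ltW.
  by apply: (ge0_ler_powR (ltW b0)); rewrite ?nnegrE ?(ltW h0) ?(ltW h10).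
pose lam := (D * H)^-1.
have lam12 : 12 <= lam.
  rewrite -[leLHS]invrK lef_pV2 ?posrE ?invr_gt0 ?mulr_gt0//.
  rewrite -ler_pdivlMl// (le_trans HD)//.
  by rewrite invfM mulrC.
have lamE : lam ^+ 2 * (@local_volume R d h)^-1 = n%:R.
  rewrite /local_volume /lam expr_div_n -D2.
  have hd0 : 0 < h ^+ d by rewrite exprn_gt0.
  have -> : n%:R = (H ^+ 2 * h ^+ d)^-1.
    have nz : H ^+ 2 * h ^+ d != 0 by rewrite mulf_neq0 ?expf_neq0 ?gt_eqF.
    by apply: (mulIf nz); rewrite mulVf// mulrA.
  by move: (h ^+ d) hd0 => t t0; field; rewrite !gt_eqF.
apply: (@le_trans _ _ (max_risk p beta L (@local_estimator R d h n))).
  by apply: ereal_inf_lbound; exists (@local_estimator R d h n) => //; exact: is_estimator_local.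
apply: ge_ereal_sup => _ [f /= fL <-].
have -> : C0 `^ p^-1 * H = (C0 * H `^ p) `^ p^-1.
  rewrite powRM ?powR_ge0 ?(ltW C00)// -powRrM mulfV ?gt_eqF// powRr1//.
  exact: ltW.
apply: (risk_le (@is_estimator_local R d h n) p0) => //.
  by rewrite mulr_ge0 ?powR_ge0// ltW.
move=> s Os; have h2 : 2 * h < 1 by lra.
apply: (le_trans (local_estimator_mean_loss fL h0 h2 Os n0 lam12 lamE)).
rewrite lee_fin /C0 -[leRHS]mulrA le_eqVlt; apply/orP; left; apply/eqP.
congr (_ * _); rewrite [RHS]mulrDl; congr (_ + _).
  have -> : lam `^ (- p) = D `^ p * H `^ p.
    have DH : 0 <= D * H by rewrite mulr_ge0// ltW.
    rewrite /lam -(powR_inv1 DH) -powRrM mulN1r opprK powRM//; exact: ltW.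
  by move: (D `^ p) (H `^ p) (p `^ p) (expR _) => x y z t; ring.
have -> : (4 * h) `^ beta = 4 `^ beta * H by rewrite (@powRM _ 4 h)// ltW.
have X0 : 0 <= 3 * L * 4 `^ beta by rewrite !mulr_ge0 ?powR_ge0// ltW.
by rewrite mulrA (powRM p X0 (ltW H0)).
Qed.

End local_estimator_risk.

(** * Comparison of the two risks *)

(** Division by 0 gives +oo, so the bound persists when the denominator
    vanishes. *)
Lemma ereal_div_ge {R : realType} (M m : \bar R) (x y : R) :
  0 < x -> 0 < y ->
  (x%:E <= M -> 0 <= m -> m <= y%:E -> (x / y)%:E <= M / m)%E.
Proof.
move=> x0 y0 xM m0 my.
have yV : ((y^-1)%:E <= m^-1)%E.
  case: m m0 my => [r| |]// ; rewrite !lee_fin => r0 ry.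
  rewrite inver; case: eqP => [_|/eqP rN0]; first by rewrite leey.
  have rp : 0 < r by rewrite lt_neqAle eq_sym rN0.
  by rewrite lee_fin lef_pV2.
rewrite EFinM; apply: lee_pmul => //; rewrite lee_fin; first exact: ltW.
by rewrite invr_ge0 ltW.
Qed.

Section asymptotics.
Context {R : realType} {d : nat} (d_gt0 : (0 < d)%N).
Variables (p beta L : R).
Hypotheses (p_ge4 : 4 <= p) (beta_gt0 : 0 < beta) (beta_le2 : beta <= 2)
  (L_gt0 : 0 < L).

Lemma exists_rate_bandwidth (eps : R) : 0 < eps ->
  exists2 n0, (0 < n0)%N & forall n, (n0 <= n)%N ->
  exists2 h, 0 < h <= eps & n%:R * (h `^ beta) ^+ 2 * h ^+ d = 1.
Proof.
move=> e0; have b0 := beta_gt0; pose r := beta * 2 + d%:R.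
have r0 : 0 < r by rewrite addr_gt0 ?mulr_gt0// ltr0n.
have hE (x : R) : 0 < x -> (x `^ beta) ^+ 2 * x ^+ d = x `^ r.
  move=> x0; rewrite -!powR_mulrn ?powR_ge0 ?(ltW x0)// -powRrM -powRD//.
  by rewrite (gt_eqF x0) implybT.
have er : 0 < eps `^ r by exact: powR_gt0.
pose n0 := Num.bound (eps `^ r)^-1.
have n0e : (eps `^ r)^-1 < n0%:R.
  by apply: archi_boundP; rewrite invr_ge0 ltW.
exists n0.
  by rewrite -(ltr0n R); apply: lt_trans n0e; rewrite invr_gt0.
move=> n nn; have nR : (eps `^ r)^-1 < n%:R by apply: (lt_le_trans n0e); rewrite ler_nat.
have n_gt0 : 0 < n%:R :> R by apply: lt_trans nR; rewrite invr_gt0.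
pose h := n%:R `^ (- r^-1).
have h0 : 0 < h by exact: powR_gt0.
have hr : h `^ r = n%:R^-1.
  by rewrite /h -powRrM mulNr mulVf ?gt_eqF// powR_inv1// ltW.
exists h; last by rewrite -mulrA hE// hr mulfV// gt_eqF.
rewrite h0/= leNgt; apply/negP => eh.
have : eps `^ r <= h `^ r.
  by apply: (ge0_ler_powR (ltW r0)); rewrite ?nnegrE ltW.
rewrite hr leNgt => /negP; apply.
by rewrite -[ltRHS]invrK ltf_pV2 ?posrE ?invr_gt0.
Qed.

(** Bias and variance compete: either b is so large that the bias wins, or b is
    at most a multiple of h ^+ 2 and the logarithm in the variance bound exceeds
    any constant once h is small. *)
Lemma max_risk_rate_lower (K : R) : 0 < K -> exists2 eps, 0 < eps &
  forall n h b, (0 < n)%N -> 0 < h <= eps ->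
    n%:R * (h `^ beta) ^+ 2 * h ^+ d = 1 -> 0 < b < 1 ->
    ((K * h `^ beta)%:E <= max_risk p beta L (@dirichlet_kde R d n b))%E.
Proof.
move=> K0; have p4 := p_ge4; have b0 := beta_gt0; have b2 := beta_le2.
have L0 := L_gt0; have p0 : 0 < p by lra.
have p1 : 1 <= p by lra.
have [c1 c10 bias] := @max_risk_bias_lower R d d_gt0 p beta L p1 b0 b2 L0.
have [c2 c20 var] := @max_risk_variance_lower R d d_gt0 p beta L p4 b0 b2 L0.
have bp : 0 < beta * p by rewrite mulr_gt0.
have Kp : 0 < K `^ p by exact: powR_gt0.
pose kap := (K `^ p / c1) `^ (2 / (beta * p)).
have kap0 : 0 < kap by rewrite powR_gt0// divr_gt0.
pose Lam := kap `^ (p / 4) * (1 + K `^ p / c2).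
(* For b <= bmax, ln (1 + 1 / (d b)) >= Lam. *)
pose bmax := Num.min (@variance_bandwidth R d) (expR (- Lam) / d%:R).
have dR : 0 < d%:R :> R by rewrite ltr0n.
have bmax0 : 0 < bmax.
  by rewrite lt_min variance_bandwidth_gt0// divr_gt0 ?expR_gt0.
(* So that kap h ^+ 2 <= bmax. *)
exists (Num.sqrt (bmax / kap)); first by rewrite sqrtr_gt0 divr_gt0.
move=> n h b n0 /andP[h0 he] nh b01; have /andP[bb0 bb1] := b01.
set H := h `^ beta in nh *; have H0 : 0 < H by exact: powR_gt0.
have h2 : kap * h ^+ 2 <= bmax.
  rewrite mulrC -ler_pdivlMr// -[leRHS]sqr_sqrtr ?divr_ge0 ?(ltW bmax0) ?(ltW kap0)//.
  by apply: lerXn2r; rewrite ?nnegrE ?sqrtr_ge0 ?(ltW h0).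
have HP : K * H = ((K `^ p) * H `^ p) `^ p^-1.
  rewrite -powRM ?(ltW K0) ?(ltW H0)// -powRrM mulfV ?gt_eqF// powRr1//.
  by rewrite mulr_ge0// ltW.
rewrite HP; apply: (max_risk_ge d_gt0 p0) => //.
  by rewrite mulr_ge0// powR_ge0.
have [hA|hB] := leP (K `^ p * H `^ p) (c1 * b `^ (beta * p / 2)).
  by apply: le_trans (bias n b n0 b01); rewrite lee_fin.
have bk : b <= kap * h ^+ 2.
  have -> : b = (b `^ (beta * p / 2)) `^ (2 / (beta * p)).
    rewrite -powRrM (_ : _ * _ = 1) ?powRr1 ?(ltW bb0)//.
    by field; rewrite !gt_eqF.
  have -> : kap * h ^+ 2 = (K `^ p / c1 * H `^ p) `^ (2 / (beta * p)).
    rewrite powRM ?powR_ge0 ?divr_ge0 ?(ltW Kp) ?(ltW c10)//; congr (_ * _).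
    rewrite -powR_mulrn ?(ltW h0)// /H -!powRrM; congr (_ `^ _).
    by field; rewrite !gt_eqF.
  have e0 : 0 <= 2 / (beta * p) by rewrite divr_ge0// ltW.
  have y0 : 0 <= K `^ p / c1 * H `^ p by rewrite mulr_ge0 ?divr_ge0 ?powR_ge0// ltW.
  apply: (ge0_ler_powR e0); rewrite ?nnegrE ?powR_ge0//.
  by rewrite [leRHS]mulrAC ler_pdivlMr// [leLHS]mulrC ltW.
have bb : b <= bmax by exact: le_trans bk h2.
have := bb; rewrite le_min => /andP[bvar blam].
apply: le_trans (var n b n0 b01 bvar); rewrite lee_fin.
have hd0 : 0 < h ^+ d by rewrite exprn_gt0.
have nE : n%:R `^ (- (p / 2)) = H `^ p * (h `^ (p / 2)) ^+ d.
  have -> : n%:R = (H ^+ 2 * h ^+ d)^-1.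
    have nz : H ^+ 2 * h ^+ d != 0 by rewrite mulf_neq0 ?expf_neq0 ?gt_eqF.
    by apply: (mulIf nz); rewrite mulVf// mulrA.
  have z0 : 0 <= H ^+ 2 * h ^+ d by rewrite mulr_ge0 ?exprn_ge0 ?ltW.
  rewrite -(powR_inv1 z0) -powRrM mulN1r opprK powRM ?exprn_ge0 ?(ltW H0) ?(ltW h0)//.
  rewrite -(powR_mulrn _ (ltW H0)) -(powR_mulrn d (ltW h0)).
  rewrite -(powR_mulrn d (powR_ge0 h _)) -!powRrM; congr (_ `^ _ * _ `^ _); first by field.
  by rewrite mulrC.
rewrite {}nE.
have lnb : Lam <= ln (1 + (d%:R * b)^-1).
  rewrite -[leLHS]expRK ler_ln ?posrE ?expR_gt0 ?addr_gt0 ?invr_gt0 ?mulr_gt0//.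
  rewrite -[leLHS]add0r lerD// -[leLHS]invrK -expRN lef_pV2 ?posrE ?mulr_gt0 ?expR_gt0//.
  by rewrite mulrC -ler_pdivlMr.
have bpow : kap `^ (- (p / 4)) * h `^ (- (p / 2)) <= b `^ (- (p / 4)).
  have -> : kap `^ (- (p / 4)) * h `^ (- (p / 2)) = (kap * h ^+ 2) `^ (- (p / 4)).
    rewrite powRM ?exprn_ge0 ?(ltW kap0) ?(ltW h0)// -(powR_mulrn _ (ltW h0)) -powRrM.
    by congr (_ * _ `^ _); field.
  rewrite !powRN lef_pV2 ?posrE ?powR_gt0 ?mulr_gt0 ?exprn_gt0//.
  apply: ge0_ler_powR; rewrite ?nnegrE ?divr_ge0 ?(ltW p0) ?(ltW bb0)//.
  by rewrite mulr_ge0 ?exprn_ge0 ?ltW.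
have hh : h `^ (p / 2) * h `^ (- (p / 2)) = 1.
  by rewrite -powRD ?subrr ?powRr0// (gt_eqF h0) implybT.
have kk : kap `^ (- (p / 4)) * kap `^ (p / 4) = 1.
  by rewrite -powRD ?addNr ?powRr0// (gt_eqF kap0) implybT.
pose q := 1 + K `^ p / c2.
have q1 : 1 <= q by rewrite lerDl divr_ge0 ?ltW.
have low : q <= h `^ (p / 2) * (b `^ (- (p / 4)) * ln (1 + (d%:R * b)^-1)).
  have -> : q = h `^ (p / 2) * (kap `^ (- (p / 4)) * h `^ (- (p / 2)) * Lam).
    rewrite /Lam -/q; move: hh kk; move: (kap `^ _) (kap `^ _) (h `^ _) (h `^ _) => x y z t zt xy.
    transitivity ((t * z) * (y * x) * q); first by rewrite zt xy !mul1r.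
    move: (q) => Q0; ring.
  rewrite ler_wpM2l ?powR_ge0//; apply: ler_pM => //.
    by rewrite mulr_ge0 ?powR_ge0.
  by rewrite mulr_ge0 ?powR_ge0// (le_trans ler01).
set E := b `^ _ * _ in low *.
have lowd : q <= (h `^ (p / 2)) ^+ d * E ^+ d.
  rewrite -exprMn; apply: le_trans (_ : q ^+ d <= _).
    by rewrite ler_eXnr.
  have q0 := le_trans ler01 q1; have E0 := le_trans q0 low.
  by apply: lerXn2r.
move: lowd; move: (_ ^+ d) (E ^+ d) => x y xy.
rewrite (_ : c2 * _ * y = H `^ p * (c2 * (x * y))); last by ring.
rewrite mulrC ler_wpM2l ?powR_ge0//.
apply: (@le_trans _ _ (c2 * q)); last by rewrite ler_wpM2l// ltW.
by rewrite /q mulrDr mulrCA mulfV ?gt_eqF// !mulr1 lerDr ltW.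
Qed.

End asymptotics.

Unset Implicit Arguments.

Theorem proposition3 (R : realType) (d : nat) (L p beta : R) (b : nat -> R)
    (d_gt0 : (0 < d)%N) (L_gt0 : 0 < L) (p_ge4 : 4 <= p)
    (beta_gt0 : 0 < beta) (beta_le2 : beta <= 2)
    (b01 : forall n, (0 < n)%N -> 0 < b n < 1) :
  limn_einf (fun n : nat =>
    (max_risk p beta L (@dirichlet_kde R d n (b n)) /
     minimax_risk d n p beta L)%E) = +oo%E.
Proof.
have p_gt0 : 0 < p by lra.
set u := (fun n : nat => _).
suff uoo : u n @[n --> \oo] --> +oo%E by have [] := cvg_limn_einf_sup uoo.
have [C C0 [h0 h00 up]] :=
  @minimax_risk_le R d d_gt0 p beta L p_gt0 beta_gt0 beta_le2 L_gt0.
apply/cvgeyPge => A; pose K := C * (1 + `|A|).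
have A1 : 0 < 1 + `|A| by rewrite ltr_wpDr.
have K0 : 0 < K by rewrite mulr_gt0.
have [eps eps0 low] := @max_risk_rate_lower R d d_gt0 p beta L p_ge4
  beta_gt0 beta_le2 L_gt0 K K0.
have me0 : 0 < Num.min h0 eps by rewrite lt_min h00.
have [N N0 hN] := @exists_rate_bandwidth R d d_gt0 beta beta_gt0 _ me0.
exists N => // n /= Nn; have [h /andP[hh0 hm] nh] := hN n Nn.
have n0 : (0 < n)%N by exact: leq_trans Nn.
move: hm; rewrite le_min => /andP[hm1 hm2].
have H0 : 0 < h `^ beta by exact: powR_gt0.
have m0 : (0 <= minimax_risk d n p beta L)%E.
  apply: le_ereal_inf_tmp => _ [T _ <-]; exact: max_risk_ge0.
have h01 : 0 < h <= eps by rewrite hh0.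
apply: (@le_trans _ _ (K * h `^ beta / (C * h `^ beta))%:E).
  rewrite lee_fin /K (_ : _ / _ = 1 + `|A|).
    by rewrite (le_trans (ler_norm A))// lerDr.
  have CH : C * h `^ beta != 0 by rewrite gt_eqF// mulr_gt0.
  by rewrite (mulrC C) -(mulrA _ C) (mulfK CH).
apply: ereal_div_ge => //.
- exact: mulr_gt0.
- exact: mulr_gt0.
- by apply: low => //; exact: b01.
- exact: up.
Qed.
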